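(* Let $\Delta$ be fixed, and let $m\ge\Delta+2\ge5$, or, if $\Delta=3$, let $m\ge2$. Then the associated Markov chain $\mathcal{M}(\mathcal{H})$ yields an FPRAS (fully polynomial randomized approximation scheme) for the problem $\#(m,\Delta)\mu\mathrm{SAT}$ of counting the satisfying assignments of monotone $m$SAT instances in which each variable occurs at most $\Delta$ times.
   Context: A monotone $m$SAT instance is a conjunction of clauses, each clause being a disjunction of $m$ distinct un-negated variables. $\#(m,\Delta)\mu\mathrm{SAT}$ is the problem: given a monotone $m$SAT formula with at most $\Delta$ occurrences of each variable, compute its number of satisfying assignments. An FPRAS for a counting problem with value $N(f)$ on instance $f$ is a randomized algorithm which, given $f$ and $\epsilon>0$, runs in time polynomial in the size of $f$ and $1/\epsilon$ and outputs a number $\hat N$ with $\Pr[(1-\epsilon)N(f)\le\hat N\le(1+\epsilon)N(f)]\ge 3/4$. The hypergraph $\mathcal{H}=(\mathcal{V},\mathcal{E})$ associated with a monotone formula has the variables as its vertices and the variable sets of the clauses as its edges; it has edge size $m$ and degree at most $\Delta$. A vertex set is independent if it contains no edge; the satisfying assignments of the formula correspond bijectively to the independent sets of $\mathcal{H}$ (a satisfying assignment corresponds to its set of false variables). The Markov chain $\mathcal{M}(\mathcal{H})$ on the independent sets of $\mathcal{H}$ has the following transitions from state $X_t$: select $v\in\mathcal{V}$ uniformly at random; if $v\in X_t$, let $X_{t+1}=X_t\setminus\{v\}$ with probability $1/2$; if $v\notin X_t$ and $X_t\cup\{v\}$ is independent, let $X_{t+1}=X_t\cup\{v\}$ with probability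 $1/2$; otherwise let $X_{t+1}=X_t$. ''The chain yields an FPRAS'' means that there is an FPRAS which works by using simulations of such chains to sample (nearly uniform) independent sets, equivalently satisfying assignments. *)

(* Defs.v *)
From HB Require Import structures.
From mathcomp Require Import all_boot all_order all_algebra.

Set Implicit Arguments.
Unset Strict Implicit.
Unset Printing Implicit Defensive.

Import Order.TTheory GRing.Theory Num.Theory.

(* A monotone clause is the set of its variables; clauses may be repeated, and
   a variable need not occur in any clause. *)
Record formula := Formula { nvars : nat; clauses : seq {set 'I_nvars} }.

Definition satisfies (f : formula) (a : {ffun 'I_(nvars f) -> bool}) : bool :=
  all (fun c : {set 'I_(nvars f)} => [exists x in c, a x]) (clauses f).

Definition num_sat (f : formula) : nat :=
  #|[set a : {ffun 'I_(nvars f) -> bool} | satisfies a]|.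

(* Instances of #(m, D)muSAT; occurrences are counted with multiplicity. *)
Definition monotone_sat (m D : nat) (f : formula) : bool :=
  all (fun c : {set 'I_(nvars f)} => #|c| == m) (clauses f)
  && [forall x, count (fun c : {set 'I_(nvars f)} => x \in c) (clauses f) <= D].

Record hypergraph :=
  Hypergraph { nverts : nat; edges : {set {set 'I_nverts}} }.

Definition hypergraph_tag (H : hypergraph) : {n : nat & {set {set 'I_n}}} :=
  Tagged (fun n : nat => {set {set 'I_n}}) (edges H).
Definition hypergraph_untag (u : {n : nat & {set {set 'I_n}}}) : hypergraph :=
  Hypergraph (tagged u).
Lemma hypergraph_tagK : cancel hypergraph_tag hypergraph_untag.
Proof. by case. Qed.
HB.instance Definition _ :=
  Equality.copy hypergraph (can_type hypergraph_tagK).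

Definition hypergraph_of (f : formula) : hypergraph :=
  Hypergraph [set c in clauses f].

Definition uniform_bounded (m D : nat) (H : hypergraph) : bool :=
  [forall e in edges H, #|e| == m]
  && [forall x, #|[set e in edges H | x \in e]| <= D].

Definition independent (H : hypergraph) (X : {set 'I_(nverts H)}) : bool :=
  [forall e in edges H, ~~ (e \subset X)].
Arguments independent : clear implicits.

Section Chain.
Local Open Scope ring_scope.
Variable H : hypergraph.
Implicit Types (X Y : {set 'I_(nverts H)}) (v : 'I_(nverts H)).

(* Probability of moving from X to Y once v has been selected. *)
Definition update v X Y : rat :=
  if v \in X then ((Y == X :\ v)%:R + (Y == X)%:R) / 2
  else if independent H (v |: X) then ((Y == v |: X)%:R + (Y == X)%:R) / 2
  else (Y == X)%:R.

(* On the empty vertex set nothing can be selected and the chain stays put. *)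
Definition transition X Y : rat :=
  if nverts H == 0%N then (Y == X)%:R
  else (nverts H)%:R^-1 * \sum_v update v X Y.

(* The law of X_t when X_0 is the empty set. *)
Fixpoint law (t : nat) Y : rat :=
  if t is u.+1 then \sum_X law u X * transition X Y else (Y == set0)%:R.

Definition unif_indep X : rat :=
  (independent H X)%:R / #|[set Y | independent H Y]|%:R.

Definition tv_dist (p q : {set 'I_(nverts H)} -> rat) : rat :=
  2^-1 * \sum_X `|p X - q X|.

End Chain.

Arguments law : clear implicits.
Arguments unif_indep : clear implicits.

(* Randomized algorithms are programs of a While language over registers that
   hold binary trees with natural numbers at the leaves.  Time is logarithmic
   cost: every evaluated subexpression is charged the number of bits of its
   value.  The only random instruction is Simulate, which runs the chain of a
   hypergraph computed by the program from the empty set, for a number of steps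
   chosen by the program, and is charged for every step it simulates. *)
Inductive val := Leaf of nat | Cell of val & val.

Fixpoint vsize (v : val) : nat :=
  match v with
  | Leaf n => (trunc_log 2 n).+1
  | Cell a b => (vsize a + vsize b).+1
  end.

Definition vnum (v : val) : nat := if v is Leaf n then n else 0.
Definition vfst (v : val) : val := if v is Cell a _ then a else Leaf 0.
Definition vsnd (v : val) : val := if v is Cell _ b then b else Leaf 0.
Definition vtrue (v : val) : bool := if v is Leaf 0 then false else true.

(* Lists are right-nested cells ended by Leaf 0. *)
Definition vlist (s : seq val) : val := foldr Cell (Leaf 0) s.
Fixpoint unvlist (v : val) : seq val :=
  if v is Cell a b then a :: unvlist b else [::].
Definition vset (n : nat) (X : {set 'I_n}) : val :=
  vlist [seq Leaf (nat_of_ord i) | i <- enum X].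

(* The vertices are listed explicitly, so that the size of a formula is at
   least its number of variables. *)
Definition vformula (f : formula) : val :=
  Cell (vlist [seq Leaf i | i <- iota 0 (nvars f)])
       (vlist [seq vset c | c <- clauses f]).

Definition unvhypergraph (v : val) : hypergraph :=
  let n := size (unvlist (vfst v)) in
  Hypergraph [set e in
    [seq [set i : 'I_n | nat_of_ord i \in [seq vnum w | w <- unvlist u]]
       | u <- unvlist (vsnd v)]].

Inductive binop := Add | Sub | Mul | Div | Leq | Eqn.

Definition apply_binop (o : binop) (a b : nat) : nat :=
  match o with
  | Add => a + b
  | Sub => a - b
  | Mul => a * b
  | Div => a %/ b
  | Leq => a <= b
  | Eqn => a == b
  end.

Inductive expr :=
  | Var of nat
  | Lit of nat
  | Pair of expr & expr
  | Fst of expr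
  | Snd of expr
  | Op of binop & expr & expr.

Definition store := nat -> val.

Fixpoint eval (s : store) (e : expr) : val :=
  match e with
  | Var x => s x
  | Lit n => Leaf n
  | Pair a b => Cell (eval s a) (eval s b)
  | Fst a => vfst (eval s a)
  | Snd a => vsnd (eval s a)
  | Op o a b => Leaf (apply_binop o (vnum (eval s a)) (vnum (eval s b)))
  end.

Fixpoint cost (s : store) (e : expr) : nat :=
  vsize (eval s e) +
  match e with
  | Var _ | Lit _ => 0
  | Fst a | Snd a => cost s a
  | Pair a b | Op _ a b => cost s a + cost s b
  end.

Inductive cmd :=
  | Skip
  | Assign of nat & expr
  | Seq of cmd & cmd
  | If of expr & cmd & cmd
  | While of expr & cmd
  | Simulate of nat & expr & expr. (* target, hypergraph, number of steps *)

(* Besides the registers, the state records the time spent and the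
   simulations performed so far. *)
Record state := State {
  regs : store;
  time : nat;
  sims : seq (hypergraph * nat) }.

Definition upd (s : store) (x : nat) (v : val) : store :=
  fun y => if y == x then v else s y.

Definition tick (k : nat) (s : state) : state :=
  State (regs s) (time s + k) (sims s).
Definition write (x : nat) (v : val) (s : state) : state :=
  State (upd (regs s) x v) (time s) (sims s).
Definition record_sim (h : hypergraph * nat) (s : state) : state :=
  State (regs s) (time s) (h :: sims s).

(* Finitely supported distributions, as lists of weighted outcomes. *)
Definition dist (A : Type) := seq (rat * A).
Definition ret (A : Type) (a : A) : dist A := [:: (1%R, a)].
Definition bind (A B : Type) (d : dist A) (k : A -> dist B) : dist B :=
  flatten [seq [seq ((wa.1 * wb.1)%R, wb.2) | wb <- k wa.2] | wa <- d].
Definition prob (A : Type) (d : dist A) (E : pred A) : rat :=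
  (\sum_(wa <- d | E wa.2) wa.1)%R.
Definition surely (A : Type) (d : dist A) (E : pred A) : bool :=
  all (fun wa => E wa.2) d.

(* Only outcomes of nonzero probability are listed. *)
Definition simulate (H : hypergraph) (t : nat) : dist {set 'I_(nverts H)} :=
  [seq (law H t X, X) | X <- enum {set 'I_(nverts H)} & law H t X != 0%R].

(* The outcome None means that the recursion bound k was reached before the
   program halted. *)
Fixpoint exec (k : nat) (c : cmd) (s : state) : dist (option state) :=
  if k is j.+1 then
    let andthen d c := bind d (fun o => if o is Some s' then exec j c s'
                                        else ret None) in
    match c with
    | Skip => ret (Some (tick 1 s))
    | Assign x e =>
        ret (Some (write x (eval (regs s) e) (tick (cost (regs s) e).+1 s)))
    | Seq c1 c2 => andthen (exec j c1 s) c2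
    | If e c1 c2 =>
        exec j (if vtrue (eval (regs s) e) then c1 else c2)
             (tick (cost (regs s) e).+1 s)
    | While e c1 =>
        let s' := tick (cost (regs s) e).+1 s in
        if vtrue (eval (regs s) e) then andthen (exec j c1 s') (While e c1)
        else ret (Some s')
    | Simulate x e1 e2 =>
        let v := eval (regs s) e1 in
        let H := unvhypergraph v in
        let t := vnum (eval (regs s) e2) in
        let s' := record_sim (H, t)
          (tick (cost (regs s) e1 + cost (regs s) e2 + t.+1 * vsize v) s) in
        bind (simulate H t) (fun X => ret (Some (write x (vset X) s')))
    end
  else ret None.

(* The formula and the accuracy are passed in register 0, the accuracy eps
   being presented as the integer ceil (1 / eps); the output is the fraction
   found in register 0. *)
Definition init (f : formula) (eps : rat) : state :=
  State (upd (fun=> Leaf 0) 0 (Cell (vformula f) (Leaf `|Num.ceil eps^-1|%N)))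
        0 [::].

Definition output (s : state) : rat :=
  ((vnum (vfst (regs s 0)))%:R / (vnum (vsnd (regs s 0)))%:R)%R.

Section FPRAS.
Local Open Scope ring_scope.

Definition in_time (c : nat) (f : formula) (eps : rat) (o : option state) :=
  if o is Some s
  then (time s)%:R <= c%:R * ((vsize (vformula f))%:R + eps^-1) ^+ c
  else false.

Definition accurate (N : nat) (eps : rat) (o : option state) :=
  if o is Some s
  then (1 - eps) * N%:R <= output s <= (1 + eps) * N%:R
  else false.

Definition FPRAS (inst : pred formula) (N : formula -> nat) (P : cmd) : Prop :=
  exists c : nat, forall (f : formula) (eps : rat), inst f -> 0 < eps ->
    exists k : nat, let d := exec k P (init f eps) in
      surely d (in_time c f eps) /\ 3 / 4 <= prob d (accurate (N f) eps).

(* Every simulation performed by P is of the chain of a hypergraph of the given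
   class and yields a nearly uniform independent set, and the chain of the
   input's own hypergraph is among those simulated. *)
Definition samples_by_chain (inst : pred formula) (cls : pred hypergraph)
    (P : cmd) : Prop :=
  forall (f : formula) (eps : rat), inst f -> 0 < eps -> forall k : nat,
    surely (exec k P (init f eps)) (fun o =>
      if o is Some s then
        all (fun h => cls h.1 && (tv_dist (law h.1 h.2) (unif_indep h.1) <= eps))
            (sims s)
        && (hypergraph_of f \in [seq h.1 | h <- sims s])
      else true).

Definition chain_yields_FPRAS (m D : nat) : Prop :=
  exists P : cmd,
    FPRAS (monotone_sat m D) num_sat P
    /\ samples_by_chain (monotone_sat m D) (uniform_bounded m D) P.

End FPRAS.

(* Main.v *)
Require Import Defs.
From mathcomp Require Import all_boot all_order all_algebra zify ring lra.

Set Implicit Arguments.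
Unset Strict Implicit.
Unset Printing Implicit Defensive.

Import Order.TTheory GRing.Theory Num.Theory.

(** The theorem has two halves: the chain of every hypergraph of the class mixes
in polynomial time, and samples from such chains are enough to count.

Mixing.  Write [X] and [X + w] for two independent sets that differ at one
vertex.  The distance between them is taken to be a small constant plus, for
each edge [e] containing [w], a weight [c i] that depends on the number [i] of
vertices of [e] in [X].  The weights increase to [c (m - 2) = 1]: at [i = m - 2]
the edge is critical, which means that it forbids adding its last vertex to
[X + w] but not to [X], and only the choice of such a vertex can make the two
sets differ at a second place.  When [m >= D + 2] the weights can be solved for
from a three-term recurrence, in such a way that the expected distance
decreases at every step ([admissible_large]).

For [D = 3] and [m <= 3] single-vertex updates alone are too weak for this
argument.  It works once the chain may also, at rate [p], swap a vertex of the
set for a vertex that is blocked: a critical vertex that enters [X] can then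
replace [w] in [X + w], and the two sets meet ([drift_vertex_split]).  The swap
chain is only a device of the proof.  For the reversible swap chain, decay of
every discrete Lipschitz function forces a spectral gap ([aux_gap], by
log-convexity of the norms of the iterates); each swap factors through two
moves of the original chain, so that the Dirichlet forms are comparable
([swap_energy_le]) and the gap passes to the original chain ([glauber_gap]).
Taking [p = 0] when [m >= 4], all cases go through the same argument, and
[rapid_mixing] follows from the usual bound of total variation by the L2 norm.

Counting.  Delete the clauses one at a time.  Adding an edge to a hypergraph at
most halves the number of independent sets, since removing a fixed vertex of
the edge is injective on the sets that contain the edge ([nind_cons_ge]).  Each
ratio of consecutive counts is therefore at least one half and is estimated by
the proportion of sampled sets that do not contain the new edge; the
intermediate hypergraphs are subhypergraphs of the input, so the chains
simulated all belong to the class.  The product of the ratios and of [2 ^ n] is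
the answer.  Its first two moments are exact products over the clauses
([expect_estimate]), and Chebyshev's inequality gives [estimate_accurate].

The program [estimator] does this with loops over lists.  Its execution is
followed by a relation [runs], which pairs the outcomes of a command one by one
with the outcomes of an explicit distribution and keeps track of the registers
and of a bound on the time. *)

Local Open Scope ring_scope.

(** * Moves between independent sets *)
Section Moves.
Variable H : hypergraph.
Implicit Types (X Y : {set 'I_(nverts H)}) (u v w : 'I_(nverts H)).
Implicit Types (e : {set 'I_(nverts H)}).

(** The heat-bath update at [v] moves to [toggle v X] or stays put, each with
probability one half: in the blocked case [toggle] is the identity, so the three
cases of the chain become one. *)
Definition toggle v X : {set 'I_(nverts H)} :=
  if v \in X then X :\ v else if independent H (v |: X) then v |: X else X.

Definition swap u v X : {set 'I_(nverts H)} := v |: (X :\ u).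

(** A swap is allowed only towards a blocked vertex: where [v] could simply be
inserted, insertions already couple perfectly. *)
Definition swappable X u v : bool :=
  [&& u \in X, v \notin X, ~~ independent H (v |: X)
    & independent H (swap u v X)].

Lemma independentP X :
  reflect (forall e, e \in edges H -> ~~ (e \subset X)) (independent H X).
Proof. exact: 'forall_implyP. Qed.

Lemma independentS X Y : X \subset Y -> independent H Y -> independent H X.
Proof.
move=> sXY /independentP iY; apply/independentP=> e /iY.
by apply: contra => /subset_trans; apply.
Qed.

Lemma dependentP X :
  ~~ independent H X -> exists2 e, e \in edges H & e \subset X.
Proof.
by case/forall_inPn => e He /negPn; exists e.
Qed.

Lemma independent_toggle v X : independent H X -> independent H (toggle v X).
Proof.
rewrite /toggle => iX; case: ifP => _; last by case: ifP.
by apply: independentS iX; apply: subD1set.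
Qed.

Lemma toggleK v X : independent H X -> toggle v (toggle v X) = X.
Proof.
move=> iX; rewrite /toggle; case vX: (v \in X).
  by rewrite setD11 setD1K // iX.
case iv: (independent H (v |: X)); first by rewrite setU11 setU1K ?vX.
by rewrite vX iv.
Qed.

Lemma swapK u v X : u \in X -> v \notin X -> swap v u (swap u v X) = X.
Proof.
move=> uX vX; rewrite /swap setU1K ?setD1K //.
by rewrite !inE negb_and vX orbT.
Qed.

Lemma swappable_sym X u v :
  independent H X -> swappable X u v -> swappable (swap u v X) v u.
Proof.
move=> iX /and4P[uX vX nv iS]; have uv: u != v by apply: contraNneq vX => <-.
rewrite /swappable swapK // iX andbT !inE eqxx /= (negPf uv) eqxx /=.
by rewrite /swap setUCA setD1K.
Qed.

End Moves.

(** * The drift of the swap chain *)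
(** Parameters of the contraction argument: [c i] is the weight of an edge with [i]
occupied vertices besides the one that differs, [p] the rate of swaps, [dl] the
weight carried by every difference whatever its edges, [ka] the contraction
rate, and [M] the price of an update that the two sets cannot both make.  The
fields [adm_c_low] and [adm_c_crit] are the drift of one edge; the last two
bound the price when the critical vertex is free, respectively blocked, in the
smaller set. *)
Record admissible (m D : nat) (c : nat -> rat) (p dl ka M : rat) : Prop := {
  adm_c_ge0 : forall i, (i.+1 < m)%N -> 0 <= c i;
  adm_c_mono : forall i, (i.+2 < m)%N -> c i <= c i.+1;
  adm_c_top : c m.-2 = 1;
  adm_c_low : forall i, (i.+2 < m)%N ->
    i%:R * (c i.-1 - c i) + (m.-1 - i)%:R * (c i.+1 - c i) <= (2 - 2 * ka) * c i;
  adm_c_crit : m.-2%:R * (c (m - 3)%N - 1) + M <= 2 - 2 * ka;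
  adm_p_ge0 : 0 <= p;
  adm_p_le1 : p * m.-1%:R <= 1;
  adm_dl_gt0 : 0 < dl;
  adm_ka_gt0 : 0 < ka;
  adm_ka_lt1 : ka < 1;
  adm_M_free : (1 - p) * (D%:R + dl) - p <= M;
  adm_M_blocked : p * m.-1%:R * (2 * (D%:R + dl)) <= M }.

Fact pred2_bounds i m :
  (i.+1 < m)%N -> (i <= m.-2)%N && (m.-2.+1 < m)%N.
Proof. lia. Qed.

Section Drift.
Variables (H : hypergraph) (m D : nat).
Hypothesis unifH : uniform_bounded m D H.
Hypothesis m_ge2 : (2 <= m)%N.
Variables (c : nat -> rat) (p dl ka M : rat).
Hypothesis adm : admissible m D c p dl ka M.
Local Notation c_ge0 := (adm_c_ge0 adm).
Local Notation c_mono := (adm_c_mono adm).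
Local Notation c_top := (adm_c_top adm).
Local Notation c_low := (adm_c_low adm).
Local Notation c_crit := (adm_c_crit adm).
Local Notation p_ge0 := (adm_p_ge0 adm).
Local Notation p_le1 := (adm_p_le1 adm).
Local Notation dl_gt0 := (adm_dl_gt0 adm).
Local Notation M_free := (adm_M_free adm).
Local Notation M_blocked := (adm_M_blocked adm).

Implicit Types (X Y : {set 'I_(nverts H)}) (u v w : 'I_(nverts H)).
Implicit Types (e : {set 'I_(nverts H)}).

Local Notation I := (independent H).

(** Distance between [X] and [w |: X]. *)
Definition flip_cost X w : rat :=
  dl + \sum_(e in edges H | w \in e) c #|e :&: X|.

Lemma edge_card e : e \in edges H -> #|e| = m.
Proof. by case/andP: unifH => /forall_inP h _ /h /eqP. Qed.

Lemma degree_le w : (#|[set e in edges H | w \in e]| <= D)%N.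
Proof. by case/andP: unifH => _ /forallP. Qed.

Lemma card_edgeI e X : e \in edges H -> I X -> (#|e :&: X| < m)%N.
Proof.
move=> eH /independentP /(_ _ eH); rewrite -(edge_card eH) => neX.
by rewrite proper_card // properEneq subsetIl andbT; apply: contraNneq neX => /setIidPl.
Qed.

Lemma card_edgeI_lt e X w :
  e \in edges H -> w \in e -> w \notin X -> I (w |: X) ->
  (#|e :&: X|.+1 < m)%N.
Proof.
move=> eH we wX /(card_edgeI eH); rewrite setIUr (setIidPr _) ?sub1set //.
by rewrite cardsU1 !inE (negPf wX) andbF.
Qed.

Lemma c_homo i j : (i <= j)%N -> (j.+1 < m)%N -> c i <= c j.
Proof.
elim: j => [|j IH]; first by rewrite leqn0 => /eqP->.
rewrite leq_eqVlt ltnS => /orP[/eqP->//|/IH ij] jm.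
by apply: le_trans (ij _) (c_mono _) => //; apply: ltnW.
Qed.

Lemma c_le1 i : (i.+1 < m)%N -> c i <= 1.
Proof.
by move=> im; rewrite -c_top; have /andP[] := pred2_bounds im; apply: c_homo.
Qed.

Lemma flip_cost_le X w : w \notin X -> I (w |: X) -> flip_cost X w <= D%:R + dl.
Proof.
move=> wX iY; rewrite /flip_cost addrC lerD2r.
apply: (@le_trans _ _ (\sum_(e in edges H | w \in e) 1)).
  apply: ler_sum => e /andP[eH we]; apply: c_le1.
  exact: card_edgeI_lt we wX iY.
rewrite sumr_const ler_nat (leq_trans _ (degree_le w)) //.
by rewrite subset_leq_card //; apply/subsetP=> e; rewrite !inE.
Qed.

Lemma flip_cost_ge X w : w \notin X -> I (w |: X) -> dl <= flip_cost X w.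
Proof.
move=> wX iY; rewrite /flip_cost lerDl; apply: sumr_ge0 => e /andP[eH we].
exact/c_ge0/(card_edgeI_lt eH we wX iY).
Qed.

(** Change of the weight of [e] when [v] is removed from or added to both sets.  At
[i = m - 2] a common insertion is impossible, whence the value [0]. *)
Definition edge_change X v e : rat :=
  let i := #|e :&: X| in
  if v \notin e then 0
  else if v \in X then c i.-1 - c i
  else if (i.+2 < m)%N then c i.+1 - c i else 0.

Definition change X w v : rat :=
  \sum_(e in edges H | w \in e) edge_change X v e.

Lemma flip_cost_remove X w v : v \in X -> w \notin X -> I (w |: X) ->
  flip_cost (X :\ v) w = flip_cost X w + change X w v.
Proof.
move=> vX wX iY; rewrite /flip_cost -addrA -big_split; congr (_ + _).
apply: eq_bigr => e /andP[eH we] /=; rewrite /edge_change vX setIDA.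
case: ifPn => [ve|/negPn ve].
  by rewrite addr0 (setDidPl _) // disjoint_sym disjoints1 !inE negb_and ve.
by rewrite addrC subrK [in RHS](cardsD1 v) !inE ve vX.
Qed.

Lemma flip_cost_add X w v : v \notin X -> w \notin X -> v != w ->
  I (v |: (w |: X)) -> flip_cost (v |: X) w = flip_cost X w + change X w v.
Proof.
move=> vX wX vw iY; rewrite /flip_cost -addrA -big_split; congr (_ + _).
apply: eq_bigr => e /andP[eH we] /=; rewrite /edge_change (negPf vX) setIUr.
case: ifPn => [ve|/negPn ve].
  rewrite addr0 (_ : e :&: [set v] = set0) ?set0U //.
  by apply/eqP; rewrite setI_eq0 disjoint_sym disjoints1.
rewrite (setIidPr _) ?sub1set // cardsU1 !inE (negPf vX) andbF /= add1n.
have: (#|e :&: (v |: X)|.+1 < m)%N.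
  by apply: card_edgeI_lt we _ _ => //; rewrite ?inE 1?eq_sym ?negb_or ?vw // setUCA.
rewrite setIUr (setIidPr _) ?sub1set // cardsU1 !inE (negPf vX) andbF /= add1n.
by move->; rewrite addrC subrK.
Qed.

Lemma edge_change_ge0 X v e : v \notin X -> 0 <= edge_change X v e.
Proof.
move=> vX; rewrite /edge_change (negPf vX); case: ifP => // _.
by case: ifP => // im; rewrite subr_ge0 c_mono.
Qed.

Lemma change_ge0 X w v : v \notin X -> 0 <= change X w v.
Proof. by move=> vX; apply: sumr_ge0 => e _; apply: edge_change_ge0. Qed.

(** A swap towards [v] can only raise the weight of the edges through [v], and by
no more than an insertion of [v] would; removing [u] lowers weights. *)
Lemma flip_cost_swap X w u v : u \in X -> v \notin X -> w \notin X -> v != w ->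
  I (w |: X) -> I (w |: swap u v X) ->
  flip_cost (swap u v X) w <= flip_cost X w + change X w v.
Proof.
move=> uX vX wX vw iY iZ; rewrite /flip_cost -addrA -big_split lerD2l.
apply: ler_sum => e /andP[eH we] /=.
have im := card_edgeI_lt eH we wX iY.
have wZ: w \notin swap u v X by rewrite !inE eq_sym (negPf vw) (negPf wX) andbF.
have := card_edgeI_lt eH we wZ iZ.
rewrite /edge_change (negPf vX) /swap setIUr.
case: ifPn => [ve|/negPn ve].
  have -> : e :&: [set v] = set0.
    by apply/eqP; rewrite setI_eq0 disjoint_sym disjoints1.
  rewrite set0U addr0 => lt; apply: c_homo => //.
  by rewrite subset_leq_card // setIS // subD1set.
rewrite (setIidPr _) ?sub1set // cardsU1 !inE (negPf vX) !andbF /= add1n.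
rewrite setIDA; case ue: (u \in e).
  move=> _; have -> : (#|(e :&: X) :\ u|.+1 = #|e :&: X|)%N.
    by rewrite [RHS](cardsD1 u) !inE ue uX.
  by rewrite lerDl; case: ifP => // ?; rewrite subr_ge0 c_mono.
rewrite (setDidPl _) 1?disjoint_sym ?disjoints1 ?inE ?ue // => ->.
by rewrite addrC subrK.
Qed.

(** [v] is the last unoccupied vertex of an edge through [w]. *)
Definition critical X w v : bool :=
  [exists e in edges H, [&& w \in e, v \in e, v \notin X & #|e :&: X|.+2 == m]].

Lemma criticalI X w v e : e \in edges H -> w \notin X -> v \notin X -> v != w ->
  I (w |: X) -> w \in e -> e \subset v |: (w |: X) -> critical X w v.
Proof.
move=> eH wX vX vw iY we se; apply/exists_inP; exists e => //.
have ve: v \in e.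
  apply/negPn/negP => ve; case/independentP/(_ e eH)/negP: iY.
  apply/subsetP=> x xe; move/subsetP/(_ x xe): se; rewrite !inE.
  by case: eqP xe => // ->; rewrite (negPf ve).
rewrite we ve vX /= -(edge_card eH) (cardsD1 v e) ve (cardsD1 w (e :\ v)).
rewrite !inE we [w == v]eq_sym vw /= !add1n; apply/eqP; congr _.+2.
apply: eq_card => x; rewrite !inE.
case xe: (x \in e); rewrite ?andbF //=; move/subsetP/(_ x xe): se; rewrite !inE.
have [->|xv] := eqVneq x v; first by rewrite (negPf vX) andbF.
have [->|xw] //= := eqVneq x w; first by rewrite (negPf wX).
Qed.

Lemma critical_cost X w v : w \notin X -> I (w |: X) ->
  critical X w v -> 1 <= flip_cost X w.
Proof.
move=> wX iY /exists_inP[e eH /and4P[we ve vX /eqP im]].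
rewrite /flip_cost (bigD1 e) ?eH //= addrA.
have -> : c #|e :&: X| = 1 by rewrite -c_top -im.
rewrite -addrA addrCA lerDl addr_ge0 ?(ltW dl_gt0) //.
apply: sumr_ge0 => f /andP[/andP[fH wf] _].
exact/c_ge0/(card_edgeI_lt fH wf wX iY).
Qed.

(** Every vertex that may be exchanged for [v] lies in any edge that blocks [v]. *)
Lemma card_swappable Z v : I Z -> (#|[set u | swappable Z u v]| <= m.-1)%N.
Proof.
move=> iZ; case iv: (I (v |: Z)).
  rewrite (_ : [set u | _] = set0) ?cards0 //; apply/setP=> u.
  by rewrite !inE /swappable iv !andbF.
have [e eH se] := dependentP (negbT iv).
case vZ: (v \in Z).
  rewrite (_ : [set u | _] = set0) ?cards0 //; apply/setP=> u.
  by rewrite !inE /swappable vZ !andbF.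
have ve: v \in e.
  apply/negPn/negP => ve; case/independentP/(_ e eH)/negP: iZ.
  apply/subsetP=> x xe; move/subsetP/(_ x xe): se; rewrite !inE.
  by case: eqP xe => // ->; rewrite (negPf ve).
rewrite -(edge_card eH) (cardsD1 v e) ve subset_leq_card //.
apply/subsetP=> u; rewrite !inE => /and4P[uZ _ _ iS].
case: eqP uZ => [->|_ uZ]; first by rewrite vZ.
apply: contraTT iS => ue; apply/independentP => /(_ e eH)/negP[].
apply/subsetP => x xe; move/subsetP/(_ x xe): se; rewrite !inE.
by case: eqP => //= _ ->; rewrite andbT; apply: contraNneq ue => <-.
Qed.

Definition lipschitz (a : rat) (h : {set 'I_(nverts H)} -> rat) : Prop :=
  forall X w, w \notin X -> I (w |: X) ->
    `|h (w |: X) - h X| <= a * flip_cost X w.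

(** Twice the contribution of the target [v] to one step of the swap chain;
[2 * n] times one step is the sum of these over [v]. *)
Definition aux_at (h : {set 'I_(nverts H)} -> rat) v X : rat :=
  h X + h (toggle v X) + p * \sum_(u | swappable X u v) (h (swap u v X) - h X).

Lemma M_ge0 : 0 <= M.
Proof.
have d0 := ltW dl_gt0; apply: le_trans M_blocked.
by rewrite !mulr_ge0 ?addr_ge0 ?p_ge0 ?ler0n.
Qed.

Lemma swapU w u v X : u != w -> swap u v (w |: X) = w |: swap u v X.
Proof.
move=> uw; rewrite /swap setUCA setDUl; congr (_ |: (_ :|: _)).
by rewrite (setDidPl _) // disjoints1 inE eq_sym.
Qed.

Lemma p_card_le1 (k : nat) : (k <= m.-1)%N -> p * k%:R <= 1.
Proof.
by move=> km; apply: le_trans p_le1; rewrite ler_wpM2l ?p_ge0 ?ler_nat.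
Qed.

Lemma drift_vertex_in h X w v : lipschitz 1 h -> w \notin X -> I (w |: X) ->
  v \in X ->
  `|aux_at h v (w |: X) - aux_at h v X| <= 2 * flip_cost X w + change X w v.
Proof.
move=> lip wX iY vX; have vY: v \in w |: X by rewrite !inE vX orbT.
have vw: v != w by apply: contraNneq wX => <-.
rewrite /aux_at !big_pred0 => [| u | u];
  try by rewrite /swappable ?vX ?vY !andbF.
rewrite /toggle vX vY !mulr0 !addr0.
have -> : (w |: X) :\ v = w |: (X :\ v).
  by rewrite setDUl (setDidPl _) // disjoints1 inE eq_sym.
have A := lip _ _ wX iY.
have wZ: w \notin X :\ v by rewrite !inE negb_and wX orbT.
have iZ: I (w |: X :\ v).
  by apply: independentS iY; apply: setUS; apply: subD1set.
have B := lip _ _ wZ iZ; rewrite flip_cost_remove // in B.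
move: A B; rewrite !mul1r !ler_norml => /andP[A1 A2] /andP[B1 B2].
by apply/andP; split; lra.
Qed.

Lemma drift_vertex_free h X w v : lipschitz 1 h -> w \notin X ->
  v \notin X -> v != w -> I (v |: (w |: X)) ->
  `|aux_at h v (w |: X) - aux_at h v X| <= 2 * flip_cost X w + change X w v.
Proof.
move=> lip wX vX vw iZ; have vY: v \notin w |: X by rewrite !inE negb_or vw.
have iY: I (w |: X) by apply: independentS iZ; apply: subsetUr.
have iV: I (v |: X) by apply: independentS iZ; apply: setUS; apply: subsetUr.
rewrite /aux_at !big_pred0 => [| u | u];
  try by rewrite /swappable ?iV ?iZ !andbF.
rewrite /toggle (negPf vX) (negPf vY) iV iZ !mulr0 !addr0.
have A := lip _ _ wX iY.
have wV: w \notin v |: X by rewrite !inE negb_or wX eq_sym vw.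
rewrite setUCA in iZ *; have B := lip _ _ wV iZ.
rewrite setUCA in iZ; rewrite flip_cost_add // in B.
move: A B; rewrite !mul1r !ler_norml => /andP[A1 A2] /andP[B1 B2].
by apply/andP; split; lra.
Qed.

(** [v] is free in [X] and blocked in [w |: X].  The insertion of [v] into [X] is
coupled with the swap of [w] for [v], after which the sets coincide, with the
swaps of other vertices of [w |: X] for [v], and with no move at all for the
remaining probability. *)
Lemma drift_vertex_split h X w v : lipschitz 1 h -> w \notin X ->
  v \notin X -> v != w -> I (w |: X) -> I (v |: X) -> ~~ I (v |: (w |: X)) ->
  `|aux_at h v (w |: X) - aux_at h v X|
     <= 2 * flip_cost X w + change X w v + M /\ critical X w v.
Proof.
move=> lip wX vX vw iY iV niZ; set Y := w |: X.
have vY: v \notin Y by rewrite !inE negb_or vw.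
have cr: critical X w v.
  have [e eH se] := dependentP niZ.
  have we: w \in e.
    apply/negPn/negP => we; case/independentP/(_ e eH)/negP: iV.
    apply/subsetP=> x xe; move/subsetP/(_ x xe): se; rewrite !inE.
    by case: (x =P w) xe => [->|] //; rewrite (negPf we).
  exact: criticalI eH wX vX vw iY we se.
split=> //; set U := [set u | swappable Y u v].
have wU: w \in U.
  by rewrite inE /swappable !inE eqxx (negPf vX) (negPf vw) niZ /swap setU1K ?iV.
rewrite /aux_at [in X in _ - X]big_pred0 => [|u]; last first.
  by rewrite /swappable iV !andbF.
rewrite /toggle (negPf vX) (negPf vY) iV (negPf niZ) mulr0 addr0.
have -> : \sum_(u | swappable Y u v) (h (swap u v Y) - h Y) =
   \sum_(u in U :\ w) (h (swap u v Y) - h (v |: X)) + #|U|%:R * (h (v |: X) - h Y).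
  rewrite (eq_bigl (fun u => u \in U)) => [|u]; last by rewrite inE.
  rewrite (eq_bigr (fun u => (h (swap u v Y) - h (v |: X)) + (h (v |: X) - h Y)));
    last by move=> u _; rewrite addrA subrK.
  rewrite big_split /= sumr_const mulr_natl; congr (_ + _).
  by rewrite (big_setD1 w) //= {1}/swap /Y setU1K // subrr add0r.
have kU := card_swappable v iY; rewrite -/Y -/U in kU.
have k1 : #|U| = (#|U :\ w|).+1 by rewrite (cardsD1 w) wU.
have A := lip _ _ wX iY; rewrite -/Y mul1r in A.
have B : `|h Y - h (v |: X)| <= flip_cost X w + (D%:R + dl).
  have := lip _ _ vX iV; have := flip_cost_le vX iV; rewrite mul1r => V1.
  move: A; rewrite !ler_norml => /andP[A1 A2] /andP[B1 B2].
  by apply/andP; split; lra.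
have S : `|\sum_(u in U :\ w) (h (swap u v Y) - h (v |: X))| <=
   #|U :\ w|%:R * (flip_cost X w + change X w v + (D%:R + dl)).
  apply: le_trans (ler_norm_sum _ _ _) _; rewrite mulr_natl -sumr_const.
  apply: ler_sum => u; rewrite !inE => /andP[uw /and4P[uY _ _]].
  rewrite swapU // => iS; move: uY; rewrite !inE (negPf uw) /= => uX.
  have wS : w \notin swap u v X.
    by rewrite !inE negb_or negb_and wX orbT andbT eq_sym.
  have iS' : I (swap u v X) by apply: independentS iS; apply: subsetUr.
  have uS : u \notin swap u v X.
    by rewrite !inE eqxx orbF; apply: contraNneq vX => <-.
  have E1 : u |: swap u v X = v |: X by rewrite /swap setUCA setD1K.
  have := lip _ _ wS iS; have := flip_cost_swap uX vX wX vw iY iS.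
  have := lip (swap u v X) u uS; rewrite E1 => /(_ iV).
  have := flip_cost_le uS; rewrite E1 => /(_ iV).
  rewrite !mul1r !ler_norml => K1 /andP[B1 B2] K2 /andP[C1 C2].
  by apply/andP; split; lra.
have p0 := p_ge0; have d1 := critical_cost wX iY cr.
have ch := change_ge0 w vX.
have pk := p_card_le1 kU.
move: A B S pk; rewrite k1 -[_.+1]addn1 natrD.
move: (\sum_(_ in _) _) #|U :\ w| => S k.
set d := flip_cost X w in d1 *; set K := D%:R + dl => A B Sb pk; have Kf : (1 - p) * K - p <= M by exact: M_free.
have k0 : 0 <= k%:R :> rat by rewrite ler0n.
have pk0 : 0 <= 1 - p * (k%:R + 1) by rewrite subr_ge0.
have pkc : p * k%:R * change X w v <= change X w v.
  rewrite -[leRHS]mul1r; apply: ler_wpM2r => //.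
  by apply: le_trans pk; rewrite mulrDr mulr1 lerDl.
have pd : 0 <= p * (d - 1) by rewrite mulr_ge0 // subr_ge0.
have S1 : `|p * S| <= p * (k%:R * (d + change X w v + K)).
  by rewrite normrM (ger0_norm p_ge0) ler_wpM2l.
have B1 : `|(1 - p * (k%:R + 1)) * (h Y - h (v |: X))|
    <= (1 - p * (k%:R + 1)) * (d + K).
  by rewrite normrM (ger0_norm pk0) ler_wpM2l.
rewrite (_ : _ - _ = (h Y - h X) + (1 - p * (k%:R + 1)) * (h Y - h (v |: X)) + p * S);
  last by ring.
apply: le_trans (ler_normD _ _) _; apply: le_trans (lerD (ler_normD _ _) S1) _.
apply: le_trans (lerD (lerD A B1) (lexx _)) _; lra.
Qed.

(** [v] is blocked in both sets.  Swaps allowed in [w |: X] are allowed in [X], and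
are made together; a swap allowed only in [X] puts the sets at distance three,
which requires an edge through [v] and [w] to be critical. *)
Lemma drift_vertex_blocked h X w v : lipschitz 1 h -> w \notin X ->
  v \notin X -> v != w -> I (w |: X) -> ~~ I (v |: X) ->
  `|aux_at h v (w |: X) - aux_at h v X|
     <= 2 * flip_cost X w + change X w v + (critical X w v)%:R * M.
Proof.
move=> lip wX vX vw iY niV; set Y := w |: X.
have p0 := p_ge0; have d0 := dl_gt0; have M0 := M_ge0.
have iX : I X by apply: independentS iY; apply: subsetUr.
have vY: v \notin Y by rewrite !inE negb_or vw.
have niZ : ~~ I (v |: Y) by apply: contra niV; apply/independentS/setUS/subsetUr.
rewrite /aux_at /toggle (negPf vX) (negPf vY) (negPf niV) (negPf niZ).
pose UX := [set u | swappable X u v]; pose UY := [set u | swappable Y u v].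
have UYP u : u \in UY -> [/\ u != w, u \in X & I (w |: swap u v X)].
  rewrite inE => /and4P[uY _ _]; case: (eqVneq u w) => [->|uw].
    by rewrite /swap setU1K // (negPf niV).
  by move: uY; rewrite !inE (negPf uw) /= swapU.
have sUXY : UY \subset UX.
  apply/subsetP => u uU; have [uw uX iS] := UYP u uU.
  by rewrite inE /swappable uX vX niV; apply: independentS iS; apply: subsetUr.
have EX : \sum_(u | swappable X u v) (h (swap u v X) - h X) =
   \sum_(u in UY) (h (swap u v X) - h X)
   + \sum_(u in UX :\: UY) (h (swap u v X) - h X).
  rewrite (eq_bigl (fun u => u \in UX)) => [|u]; last by rewrite inE.
  by rewrite (big_setID UY) (setIidPr sUXY).
have EY : \sum_(u | swappable Y u v) (h (swap u v Y) - h Y) =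
   \sum_(u in UY) (h (swap u v Y) - h (swap u v X))
   + \sum_(u in UY) (h (swap u v X) - h X) - #|UY|%:R * (h Y - h X).
  rewrite (eq_bigl (fun u => u \in UY)) => [|u]; last by rewrite inE.
  rewrite mulr_natl -sumr_const -big_split -sumrB /=; apply: eq_bigr => u _.
  by ring.
have kX := card_swappable v iX; rewrite -/UX in kX.
have kY := leq_trans (subset_leq_card sUXY) kX.
have A := lip _ _ wX iY; rewrite -/Y mul1r in A.
have ch := change_ge0 w vX.
have S : `|\sum_(u in UY) (h (swap u v Y) - h (swap u v X))| <=
   #|UY|%:R * (flip_cost X w + change X w v).
  apply: le_trans (ler_norm_sum _ _ _) _; rewrite mulr_natl -sumr_const.
  apply: ler_sum => u /UYP[uw uX iS]; rewrite swapU //.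
  have wS : w \notin swap u v X.
    by rewrite !inE negb_or negb_and wX orbT andbT eq_sym.
  by have := lip _ _ wS iS; rewrite mul1r => /le_trans; apply; apply: flip_cost_swap.
have S' : `|\sum_(u in UX :\: UY) (h (swap u v X) - h X)| <=
   #|UX :\: UY|%:R * (2 * (D%:R + dl)).
  apply: le_trans (ler_norm_sum _ _ _) _; rewrite mulr_natl -sumr_const.
  apply: ler_sum => u; rewrite !inE => /andP[_ /and4P[uX _ _ iS]].
  have uZ : u \notin X :\ u by rewrite !inE eqxx.
  have vZ : v \notin X :\ u by rewrite !inE negb_and vX orbT.
  have := lip _ _ vZ iS; have := flip_cost_le vZ iS.
  have := lip _ _ uZ; have := flip_cost_le uZ; rewrite setD1K // -/(swap u v X).
  move=> /(_ iX) K1 /(_ iX); rewrite !mul1r !ler_norml => /andP[B1 B2] K2 /andP[C1 C2].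
  by apply/andP; split; lra.
have S'' : `|p * \sum_(u in UX :\: UY) (h (swap u v X) - h X)|
    <= (critical X w v)%:R * M.
  case: (set_0Vmem (UX :\: UY)) => [->|[u]].
    by rewrite big_set0 mulr0 normr0 mulr_ge0 ?ler0n.
  rewrite !inE => /andP[nS /and4P[uX _ _ iS]].
  have -> : critical X w v.
    have uw : u != w by apply: contraNneq wX => <-.
    have [e eH se] : exists2 e, e \in edges H & e \subset swap u v Y.
      apply: dependentP; apply: contra nS => ?.
      by rewrite /swappable !inE uX orbT negb_or vw vX niZ.
    apply: (@criticalI X w v e) => //; last first.
      by apply: subset_trans se _; apply/setUS/subD1set.
    apply/negPn/negP => we; case/independentP/(_ e eH)/negP: iS.
    apply/subsetP=> x xe; move/subsetP/(_ x xe): se; rewrite swapU // in_setU1.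
    by case: eqP xe => // ->; rewrite (negPf we).
  rewrite mul1r normrM (ger0_norm p_ge0); apply: le_trans M_blocked.
  rewrite -mulrA ler_wpM2l //; apply: le_trans S' _; rewrite ler_wpM2r //.
    by rewrite mulr_ge0 // addr_ge0 ?ler0n // ltW.
  by rewrite ler_nat (leq_trans _ kX) // subset_leq_card // subsetDl.
have pk := p_card_le1 kY.
have pk0 : 0 <= p * #|UY|%:R by rewrite mulr_ge0 ?ler0n.
have S1 : `|p * \sum_(u in UY) (h (swap u v Y) - h (swap u v X))| <=
   p * (#|UY|%:R * (flip_cost X w + change X w v)).
  by rewrite normrM (ger0_norm p_ge0) ler_wpM2l.
have A1 : `|(2 - p * #|UY|%:R) * (h Y - h X)| <= (2 - p * #|UY|%:R) * flip_cost X w.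
  by rewrite normrM ger0_norm ?ler_wpM2l //; lra.
have pkc : p * #|UY|%:R * change X w v <= change X w v.
  by rewrite -[leRHS]mul1r ler_wpM2r.
rewrite EX EY; move: S1 S'' A1.
set s1 := \sum_(u in UY) (_ - h (swap _ _ _)).
set s2 := \sum_(u in UY) _; set s3 := \sum_(u in _) _ => S1 S3 A1.
rewrite (_ : _ - _ = (2 - p * #|UY|%:R) * (h Y - h X) + p * s1 - p * s3); last by ring.
apply: le_trans (ler_normB _ _) _; apply: lerD S3.
apply: le_trans (ler_normD _ _) _; apply: le_trans (lerD A1 S1) _; lra.
Qed.

Lemma drift_vertex h X w v : lipschitz 1 h -> w \notin X -> v != w ->
  I (w |: X) ->
  `|aux_at h v (w |: X) - aux_at h v X|
     <= 2 * flip_cost X w + change X w v + (critical X w v)%:R * M.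
Proof.
move=> lip wX vw iY; have M0 := M_ge0.
have base b : b <= 2 * flip_cost X w + change X w v ->
    b <= 2 * flip_cost X w + change X w v + (critical X w v)%:R * M.
  by move=> /le_trans; apply; rewrite lerDl mulr_ge0 ?ler0n.
case vX : (v \in X); first by apply/base/drift_vertex_in.
case iV : (I (v |: X)); last by apply: drift_vertex_blocked; rewrite ?vX ?iV.
case iZ : (I (v |: (w |: X))).
  by apply/base/drift_vertex_free; rewrite ?vX ?iZ.
case: (drift_vertex_split lip wX (negbT vX) vw iY iV (negbT iZ)).
by move=> le ->; rewrite mul1r.
Qed.

(** Drift of a single edge through [w] when all other vertices are updated: each of
the [i] occupied vertices may leave, and each of the [m - 1 - i] others may
enter, the last one at the price [M]. *)
Lemma sum_edge_change X w e : e \in edges H -> w \in e -> w \notin X ->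
  I (w |: X) ->
  \sum_(v | v != w) (edge_change X v e
     + [&& v \in e, v \notin X & #|e :&: X|.+2 == m]%:R * M)
  <= (2 - 2 * ka) * c #|e :&: X|.
Proof.
move=> eH we wX iY; have im := card_edgeI_lt eH we wX iY.
set i := #|e :&: X| in im *.
pose f v := if v \in X then c i.-1 - c i
            else if (i.+2 < m)%N then c i.+1 - c i else M.
rewrite (eq_bigr (fun v => if v \in e then f v else 0)); last first.
  move=> v _; rewrite /f /edge_change -/i; case: (v \in e) => /=; last by rewrite mul0r addr0.
  case: (v \in X) => /=; first by rewrite mul0r addr0.
  case: ltnP => im'; first by rewrite (ltn_eqF im') mul0r addr0.
  by rewrite eqn_leq im im' mul1r add0r.
rewrite -big_mkcondr /=.
rewrite (eq_bigl (fun v => v \in e :\ w)) => [|v]; last by rewrite !inE.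
rewrite (big_setID X) /=.
rewrite (eq_bigr (fun=> c i.-1 - c i)) => [|v]; last first.
  by rewrite /f !inE => /andP[_ ->].
rewrite [X in _ + X](eq_bigr (fun=> if (i.+2 < m)%N then c i.+1 - c i else M))
  => [|v]; last by rewrite /f !inE => /andP[/negPf->].
rewrite !sumr_const.
have eXw : #|(e :\ w) :&: X| = i.
  rewrite setIDAC (setDidPl _) // disjoint_sym disjoints1 inE negb_and wX.
  by rewrite orbT.
rewrite eXw; have -> : #|(e :\ w) :\: X| = (m.-1 - i)%N.
  have := cardsD1 w e; rewrite we (edge_card eH) => ->.
  by rewrite add1n /= -(cardsID X (e :\ w)) eXw addKn.
case: ifP => im'; first by rewrite -!(mulr_natl (_ - _)); apply: c_low.
have E : m = i.+2 by apply/eqP; rewrite eqn_leq im andbT leqNgt im'.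
have ci : c i = 1 by rewrite -c_top E.
rewrite ci E /= subSnn mulr1n -[_ *+ i]mulr_natl [(2 - _) * 1]mulr1.
by have := c_crit; rewrite E /= !subSS subn1.
Qed.

(** The update at [w] itself makes the sets equal, which saves [2 * flip_cost X w];
[sum_edge_change] says that the other updates lose slightly less than that. *)
Lemma drift h X w : lipschitz 1 h -> w \notin X -> I (w |: X) ->
  `|\sum_v aux_at h v (w |: X) - \sum_v aux_at h v X|
    <= 2 * ((nverts H)%:R - ka) * flip_cost X w.
Proof.
move=> lip wX iY; have M0 := M_ge0; rewrite -sumrB (bigD1 w) //=.
have -> : aux_at h w (w |: X) - aux_at h w X = 0.
  rewrite /aux_at /toggle setU11 (negPf wX) iY setU1K // !big_pred0 => [|u|u].
  - by rewrite !mulr0 !addr0 [h X + _]addrC subrr.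
  - by rewrite /swappable iY !andbF.
  - by rewrite /swappable setU11 andbF.
rewrite add0r; apply: le_trans (ler_norm_sum _ _ _) _.
apply: (@le_trans _ _ (\sum_(v | v != w) (2 * flip_cost X w + \sum_(e in edges H | w \in e)
   (edge_change X v e + [&& v \in e, v \notin X & #|e :&: X|.+2 == m]%:R * M)))).
  apply: ler_sum => v vw; apply: le_trans (drift_vertex lip wX vw iY) _.
  rewrite -addrA lerD2l big_split lerD2l -mulr_suml ler_wpM2r //.
  case cr: (critical X w v); last by apply: sumr_ge0 => *; apply: ler0n.
  case/exists_inP: cr => e eH /and4P[we ve vX im].
  by rewrite (bigD1 e) ?eH //= ve vX im lerDl; apply: sumr_ge0 => *; apply: ler0n.
rewrite big_split /= sumr_const exchange_big /=.
have -> : #|(fun v => v != w)| = (nverts H).-1.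
  by rewrite cardC1 card_ord.
apply: (@le_trans _ _ ((2 * flip_cost X w) *+ (nverts H).-1 + (2 - 2 * ka) * flip_cost X w)).
  rewrite lerD2l /flip_cost mulrDr mulr_sumr.
  apply: (@le_trans _ _ (\sum_(e in edges H | w \in e) (2 - 2 * ka) * c #|e :&: X|)).
    by apply: ler_sum => e /andP[eH we]; apply: sum_edge_change.
  have ka1 := adm_ka_lt1 adm; rewrite lerDr mulr_ge0 ?(ltW dl_gt0) //; lra.
have : (0 < nverts H)%N by case: w {wX iY} => ?; apply: leq_trans.
case: (nverts H) => // k _; rewrite -mulr_natr -[k.+1]addn1 natrD addn1 /=.
by rewrite le_eqVlt; apply/orP; left; apply/eqP; ring.
Qed.

End Drift.

(** * The two chains as self-adjoint operators *)
Lemma cauchy_schwarz (T : finType) (P : pred T) (a b : T -> rat) :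
  (\sum_(t | P t) a t * b t) ^+ 2
    <= (\sum_(t | P t) a t ^+ 2) * (\sum_(t | P t) b t ^+ 2).
Proof.
have E (f g : T -> rat) : (\sum_(t | P t) f t) * (\sum_(t | P t) g t) =
   \sum_(t | P t) \sum_(s | P s) f t * g s.
  by rewrite mulr_suml; apply: eq_bigr => t _; rewrite mulr_sumr.
suff : 0 <= \sum_(t | P t) \sum_(s | P s) (a t * b s - a s * b t) ^+ 2.
  rewrite (eq_bigr (fun t => \sum_(s | P s) a t ^+ 2 * b s ^+ 2
     + \sum_(s | P s) b t ^+ 2 * a s ^+ 2
     - 2 * \sum_(s | P s) (a t * b t) * (a s * b s))) => [|t _]; last first.
    by rewrite mulr_sumr -big_split -sumrB /=; apply: eq_bigr => s _; ring.
  rewrite sumrB big_split /= -mulr_sumr -!E expr2.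
  by set u := \sum_(t | P t) a t ^+ 2; set v := \sum_(t | P t) b t ^+ 2; lra.
by apply: sumr_ge0 => t _; apply: sumr_ge0 => s _; apply: sqr_ge0.
Qed.

Lemma bernoulli (x : rat) k : 0 <= x -> 1 + k%:R * x <= (1 + x) ^+ k.
Proof.
move=> x0; elim: k => [|k IH]; first by rewrite mul0r addr0 expr0.
rewrite exprS; apply: le_trans (ler_wpM2l _ IH); last by rewrite addr_ge0.
have : 0 <= k%:R * x * x by rewrite !mulr_ge0 ?ler0n.
by rewrite -[k.+1]addn1 natrD; lra.
Qed.

(** The successive ratios of a log-convex sequence increase, so a geometric bound on
its tail already bounds its first ratio. *)
Lemma log_convex_decay (b : nat -> rat) (r C : rat) :
  0 < r -> (forall t, 0 <= b t) -> (forall t, b t.+1 ^+ 2 <= b t * b t.+2) ->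
  (forall t, b t <= C * r ^+ t) -> b 1%N <= r * b 0%N.
Proof.
move=> r0 b0 lc bC; case: (eqVneq (b 0%N) 0) => [z|nz].
  by have := lc 0%N; rewrite z mul0r mulr0 exprn_even_le0 //= => /eqP->.
rewrite leNgt; apply/negP => lt.
have bp : 0 < b 0%N by rewrite lt0r nz b0.
pose q := b 1%N / b 0%N.
have rq : r < q by rewrite ltr_pdivlMr.
have q0 : 0 < q by apply: lt_trans rq.
have H t : 0 < b t /\ q * b t <= b t.+1.
  elim: t => [|t [bt IH]]; first by rewrite /q divfK.
  have bt1 : 0 < b t.+1 by apply: lt_le_trans IH; apply: mulr_gt0.
  split=> //; rewrite -(ler_pM2l bt); apply: le_trans (lc t).
  by rewrite mulrCA mulrA expr2 ler_wpM2r // ltW.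
have Hp t : b 0%N * q ^+ t <= b t.
  elim: t => [|t IH]; first by rewrite mulr1.
  by apply: le_trans (H t).2; rewrite exprS mulrCA ler_wpM2l // ltW.
pose x := q / r - 1.
have x0 : 0 < x by rewrite subr_gt0 ltr_pdivlMr // mul1r.
have Hx t : b 0%N * (1 + t%:R * x) <= C.
  apply: le_trans (_ : b 0%N * (q / r) ^+ t <= _).
    rewrite ler_wpM2l //; have -> : q / r = 1 + x by rewrite /x addrC subrK.
    by apply: bernoulli; apply: ltW.
  rewrite expr_div_n mulrA ler_pdivrMr ?exprn_gt0 //.
  exact: le_trans (Hp t) (bC t).
have C0 : 0 <= C by apply: le_trans (Hx 0%N); rewrite mul0r addr0 mulr1 ltW.
have := archi_boundP (divr_ge0 C0 (ltW (mulr_gt0 bp x0))).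
set k := Num.bound _; rewrite ltr_pdivrMr ?mulr_gt0 // => lt'.
by have := Hx k; rewrite leNgt mulrDr mulr1 mulrCA ltr_wpDl // ltW.
Qed.

Section Involution.
Variables (T : finType) (P : pred T) (s : T -> T).
Hypothesis sP : forall t, P t -> P (s t).
Hypothesis sK : forall t, P t -> s (s t) = t.

Lemma sum_involution (F : T -> rat) : \sum_(t | P t) F (s t) = \sum_(t | P t) F t.
Proof.
rewrite [RHS](reindex_onto s s) //=; apply: eq_bigl => t.
apply/idP/andP => [Pt|[Pst /eqP <-]]; last exact: sP.
by rewrite sP ?sK.
Qed.

(** Summation by parts for a reversible involutive move. *)
Lemma sum_dirichlet (a : T -> rat) :
  \sum_(t | P t) a t * (a t - a (s t)) = 2^-1 * \sum_(t | P t) (a t - a (s t)) ^+ 2.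
Proof.
have E := sum_involution (fun t => a t ^+ 2).
transitivity (2^-1 * (\sum_(t | P t) a t ^+ 2 + \sum_(t | P t) a (s t) ^+ 2)
               - \sum_(t | P t) a t * a (s t)).
  rewrite E (eq_bigr (fun t => a t ^+ 2 - a t * a (s t))) => [|t _]; last by ring.
  by rewrite sumrB; field.
rewrite -big_split /= !mulr_sumr -sumrB; apply: eq_bigr => t _; by field.
Qed.

End Involution.

Section Operators.
Variable H : hypergraph.
Local Notation V := 'I_(nverts H).
Local Notation I := (independent H).
Local Notation n := (nverts H).
Implicit Types (f g h : {set V} -> rat) (X Y : {set V}) (u v w : V).
Variable p : rat.

(** Inner product with respect to the uniform measure, up to its mass. *)
Definition ip f g : rat := \sum_(X | I X) f X * g X.

Definition glauber f X : rat := n%:R^-1 * \sum_v (f X + f (toggle v X)) / 2.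
Definition aux f X : rat := (2 * n%:R)^-1 * \sum_v aux_at p f v X.

(** Dirichlet forms of the single-vertex moves and of the swaps, both without
normalization. *)
Definition move_energy f : rat :=
  \sum_(t : {set V} * V | I t.1) (f t.1 - f (toggle t.2 t.1)) ^+ 2.

Definition can_swap (t : {set V} * (V * V)) := I t.1 && swappable t.1 t.2.1 t.2.2.
Definition do_swap (t : {set V} * (V * V)) : {set V} * (V * V) :=
  (swap t.2.1 t.2.2 t.1, (t.2.2, t.2.1)).

Definition swap_energy f : rat :=
  \sum_(t | can_swap t) (f t.1 - f (do_swap t).1) ^+ 2.

Lemma can_do_swap t : can_swap t -> can_swap (do_swap t).
Proof.
case: t => X [u v] /andP[/= iX sX]; rewrite /can_swap /do_swap /=.
by rewrite swappable_sym //; case/and4P: sX => _ _ _ ->.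
Qed.

Lemma do_swapK t : can_swap t -> do_swap (do_swap t) = t.
Proof.
by case: t => X [u v] /andP[/= iX /and4P[uX vX _ _]]; rewrite /do_swap /= swapK.
Qed.

Lemma move_inv1 (t : {set V} * V) : I t.1 -> I (toggle t.2 t.1, t.2).1.
Proof. exact: independent_toggle. Qed.

Lemma move_inv2 (t : {set V} * V) : I t.1 ->
  (toggle (toggle t.2 t.1, t.2).2 (toggle t.2 t.1, t.2).1, (toggle t.2 t.1, t.2).2) = t.
Proof. by case: t => X v /= iX; rewrite toggleK. Qed.

Lemma sum_moves (F : {set V} -> V -> rat) :
  \sum_(X | I X) \sum_v F X v = \sum_(t : {set V} * V | I t.1) F t.1 t.2.
Proof.
by rewrite pair_big_dep /=; apply: eq_bigl => t; rewrite andbT.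
Qed.

Lemma sum_swaps (F : {set V} -> V -> V -> rat) :
  \sum_(X | I X) \sum_v \sum_(u | swappable X u v) F X u v
   = \sum_(t | can_swap t) F t.1 t.2.1 t.2.2.
Proof.
under eq_bigr => X iX.
  rewrite (exchange_big_dep xpredT) //= pair_big_dep /=.
  over.
by rewrite pair_big_dep.
Qed.

Lemma ip_sym f g : ip f g = ip g f.
Proof. by apply: eq_bigr => X _; rewrite mulrC. Qed.

Lemma glauber_energy f : (0 < n)%N -> ip f (fun X => f X - glauber f X) =
  (4 * n%:R)^-1 * move_energy f.
Proof.
move=> n0; have nn : n%:R != 0 :> rat by rewrite pnatr_eq0 -lt0n n0.
rewrite /ip (eq_bigr (fun X => (2 * n%:R)^-1 * \sum_v f X * (f X - f (toggle v X)))).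
  rewrite -mulr_sumr sum_moves.
  rewrite (sum_dirichlet move_inv1 move_inv2 (fun t => f t.1)) /=.
  by rewrite mulrA; congr (_ * _); field.
move=> X _; rewrite -mulr_sumr sumrB sumr_const card_ord /glauber.
rewrite -mulr_suml big_split /= sumr_const card_ord -mulr_natr.
by field.
Qed.

Lemma aux_energy f : (0 < n)%N -> ip f (fun X => f X - aux f X) =
  (4 * n%:R)^-1 * (move_energy f + p * swap_energy f).
Proof.
move=> n0; have nn : n%:R != 0 :> rat by rewrite pnatr_eq0 -lt0n n0.
rewrite /ip (eq_bigr (fun X => (2 * n%:R)^-1 * ((\sum_v f X * (f X - f (toggle v X)))
   + p * \sum_v \sum_(u | swappable X u v) f X * (f X - f (swap u v X))))).
  rewrite -mulr_sumr big_split -mulr_sumr /= sum_moves sum_swaps.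
  rewrite (sum_dirichlet move_inv1 move_inv2 (fun t => f t.1)) /=.
  rewrite (sum_dirichlet can_do_swap do_swapK (fun t => f t.1)) /=.
  rewrite /move_energy /swap_energy /=.
  move: (\sum_(t | I _) _) (\sum_(t | can_swap _) _) => a b.
  by field.
move=> X _; rewrite /aux /aux_at !big_split /= -!mulr_sumr.
rewrite !sumr_const card_ord.
under [in RHS]eq_bigr => v _.
  rewrite -mulr_sumr -[\sum_(_ | _) _]opprK -sumrN.
  under eq_bigr do rewrite opprB.
  over.
rewrite -mulr_sumr sumrN sumrB sumr_const card_ord -(mulr_natr (f X) n).
move: (\sum_v _) (\sum_v _) => a b.
by field.
Qed.

Lemma aux_selfadjoint f g : ip (aux f) g = ip f (aux g).
Proof.
have E h k : ip (aux h) k = (2 * n%:R)^-1 *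
   (n%:R * ip h k + \sum_(t : {set V} * V | I t.1) h (toggle t.2 t.1) * k t.1
    + p * \sum_(t | can_swap t) (h (do_swap t).1 * k t.1 - h t.1 * k t.1)).
  rewrite -(sum_moves (fun X v => h (toggle v X) * k X)) -(sum_swaps (fun X u v => h (swap u v X) * k X - h X * k X)).
  rewrite /ip !mulr_sumr -!big_split mulr_sumr /=; apply: eq_bigr => X _.
  rewrite /aux /aux_at !big_split /= -mulr_sumr -mulrA; congr (_ * _).
  rewrite sumr_const card_ord !mulrDl !mulr_suml.
  rewrite -mulrA -(mulr_natl (h X)) -mulrA; congr (_ + _ + _ * _); rewrite mulr_suml; apply: eq_bigr => v _.
  by rewrite mulr_suml; apply: eq_bigr => u _; rewrite mulrBl.
rewrite E [RHS]ip_sym E [ip g f]ip_sym; congr (_ * (_ + _ + _ * _)).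
  rewrite -(sum_involution move_inv1 move_inv2) /=.
  by apply: eq_bigr => -[X v] iX; rewrite toggleK // mulrC.
rewrite !sumrB; congr (_ - _); last by apply: eq_bigr => t _; rewrite mulrC.
rewrite -(sum_involution can_do_swap do_swapK (fun t => f (do_swap t).1 * g t.1)).
by apply: eq_bigr => t ct; rewrite do_swapK // mulrC.
Qed.

(** A step is the average over [v] of orthogonal projections. *)
Lemma glauber_contracts f : (0 < n)%N ->
  ip (glauber f) (glauber f) <= ip f (glauber f).
Proof.
move=> n0; have nn : n%:R != 0 :> rat by rewrite pnatr_eq0 -lt0n n0.
pose U v X := (f X + f (toggle v X)) / 2.
apply: (@le_trans _ _ (n%:R^-1 * \sum_(X | I X) \sum_v U v X ^+ 2)).
  rewrite /ip mulr_sumr; apply: ler_sum => X _; rewrite /glauber -/(U _ X).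
  have := cauchy_schwarz predT (fun=> 1) (fun v => U v X).
  rewrite -[\sum_(_ | _) (1 * _)]/(\sum_v 1 * U v X).
  under eq_bigr do rewrite mul1r; rewrite expr1n sumr_const card_ord => cs.
  rewrite mulrACA -!expr2 [_^-1 ^+ 2]expr2 -mulrA ler_wpM2l ?invr_ge0 ?ler0n //.
  by rewrite ler_pdivrMl ?ltr0n.
rewrite sum_moves /ip.
have -> : \sum_(X | I X) f X * glauber f X =
  n%:R^-1 * \sum_(t : {set V} * V | I t.1) f t.1 * U t.2 t.1.
  rewrite -(sum_moves (fun X v => f X * U v X)) mulr_sumr; apply: eq_bigr => X _.
  by rewrite /glauber mulrCA mulr_sumr.
rewrite ler_wpM2l ?invr_ge0 ?ler0n //.
rewrite (eq_bigr (fun t => 4^-1 * f t.1 ^+ 2 + 4^-1 * f (toggle t.2 t.1) ^+ 2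
   + 2^-1 * (f t.1 * f (toggle t.2 t.1)))) => [|t _]; last by rewrite /U; field.
rewrite !big_split /= -!mulr_sumr.
rewrite (sum_involution move_inv1 move_inv2 (fun t => f t.1 ^+ 2)).
rewrite [leRHS](eq_bigr (fun t => 2^-1 * f t.1 ^+ 2
   + 2^-1 * (f t.1 * f (toggle t.2 t.1)))) => [|t _]; last by rewrite /U; field.
rewrite big_split /= -!mulr_sumr lerD2r; lra.
Qed.

Lemma aux1 X : (0 < n)%N -> aux (fun=> 1) X = 1.
Proof.
move=> n0; have nn : n%:R != 0 :> rat by rewrite pnatr_eq0 -lt0n n0.
rewrite /aux /aux_at (eq_bigr (fun=> 2)) => [|v _].
  by rewrite sumr_const card_ord -mulr_natr; field.
by rewrite big1 ?mulr0 ?addr0 // => u _; rewrite subrr.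
Qed.

Lemma eq_aux f g X : f =1 g -> aux f X = aux g X.
Proof.
move=> fg; congr (_ * _); apply: eq_bigr => v _; rewrite /aux_at !fg.
by congr (_ + _ * _); apply: eq_bigr => u _; rewrite !fg.
Qed.

Lemma auxZ a f X : aux (fun Y => a * f Y) X = a * aux f X.
Proof.
rewrite /aux [RHS]mulrCA [a * _]mulr_sumr; congr (_ * _); apply: eq_bigr => v _.
rewrite /aux_at mulrDr [a * (_ + _)]mulrDr; congr (_ + _ + _).
rewrite [RHS]mulrCA; congr (_ * _); rewrite mulr_sumr.
by apply: eq_bigr => u _; rewrite mulrBr.
Qed.

Section Uniform.
Variables (m D : nat).
Hypothesis unifH : uniform_bounded m D H.
Hypothesis p_ge0 : 0 <= p.

(** A vertex that [u] can be exchanged for shares an edge with [u]. *)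
Lemma card_swaps_from X u :
  independent H X -> (#|[set v | swappable X u v]| <= D * m)%N.
Proof.
move=> iX; apply: (@leq_trans #|\bigcup_(e in [set e in edges H | u \in e]) e|).
  apply/subset_leq_card/subsetP => v; rewrite inE => /and4P[uX vX niZ iS].
  have [e eH se] := dependentP niZ.
  have ve: v \in e.
    apply/negPn/negP => ve; case/independentP/(_ e eH)/negP: iX.
    apply/subsetP=> x xe; move/subsetP/(_ x xe): se; rewrite !inE.
    by case: eqP xe => // ->; rewrite (negPf ve).
  apply/bigcupP; exists e => //; rewrite inE eH /=.
  apply/negPn/negP => ue; case/independentP/(_ e eH)/negP: iS.
  apply/subsetP=> x xe; move/subsetP/(_ x xe): se; rewrite !inE.
  by case: (x =P u) xe => // ->; rewrite (negPf ue).
apply: (@leq_trans (\sum_(e in [set e in edges H | u \in e]) m)).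
  elim/big_ind2: _ => [|x1 x2 y1 y2 s1 s2|e]; first by rewrite cards0.
    by apply: leq_trans (leq_add s1 s2); rewrite cardsU leq_subr.
  by rewrite inE => /andP[eH _]; rewrite (edge_card unifH eH).
by rewrite sum_nat_const leq_mul2r (degree_le unifH) orbT.
Qed.

(** The swap of [u] for [v] is the removal of [u] followed by the insertion of [v],
and the reverse swap exchanges the two halves; a given removal is used at most
[D * m] times. *)
Lemma swap_energy_le f : swap_energy f <= (4 * D * m)%:R * move_energy f.
Proof.
pose G (t : {set V} * (V * V)) := (f t.1 - f (t.1 :\ t.2.1)) ^+ 2.
apply: (@le_trans _ _ (4 * \sum_(t | can_swap t) G t)).
  have -> : 4 * \sum_(t | can_swap t) G t =
     \sum_(t | can_swap t) (2 * G t + 2 * G (do_swap t)).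
    rewrite big_split -!mulr_sumr /= (sum_involution can_do_swap do_swapK); lra.
  apply: ler_sum => -[X [u v]] /andP[/= _ /and4P[uX vX _ _]].
  rewrite /G /do_swap /=.
  have -> : swap u v X :\ v = X :\ u.
    by rewrite /swap setU1K // !inE negb_and vX orbT.
  set a := f X; set b := f (swap _ _ _); set z := f (X :\ u).
  have := sqr_ge0 (a - z - (z - b)); rewrite !expr2; lra.
rewrite -mulnA natrM -mulrA ler_wpM2l // /move_energy.
rewrite -(sum_moves (fun X u => (f X - f (toggle u X)) ^+ 2)).
rewrite /G -(sum_swaps (fun X u v => (f X - f (X :\ u)) ^+ 2)) mulr_sumr.
apply: ler_sum => X iX; rewrite (exchange_big_dep xpredT) //= mulr_sumr.
apply: ler_sum => u _.
case uX: (u \in X); last first.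
  rewrite big_pred0 => [|v]; first by rewrite mulr_ge0 ?ler0n ?sqr_ge0.
  by rewrite /swappable uX.
rewrite /toggle uX sumr_const -[leLHS]mulr_natl ler_wpM2r ?sqr_ge0 // ler_nat.
by have := card_swaps_from u iX; rewrite cardsE.
Qed.

Lemma glauber_gap f (ga : rat) : (0 < n)%N ->
  ga * ip f f <= ip f (fun X => f X - aux f X) ->
  ga / (1 + p * (4 * D * m)%:R) * ip f f <= ip f (fun X => f X - glauber f X).
Proof.
move=> n0; rewrite aux_energy // glauber_energy // => h.
have q0 : 0 < 1 + p * (4 * D * m)%:R.
  by rewrite ltr_pwDl ?mulr_ge0 ?ler0n.
rewrite mulrAC ler_pdivrMr //; apply: le_trans h _.
rewrite -mulrA ler_wpM2l ?invr_ge0 ?mulr_ge0 ?ler0n //.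
rewrite mulrDr mulr1 lerD2l mulrCA ler_wpM2l // mulrC.
exact: swap_energy_le.
Qed.

End Uniform.

End Operators.

(** * From Lipschitz contraction to a spectral gap *)
Section SpectralGap.
Variables (H : hypergraph) (m D : nat) (p dl ka : rat) (c : nat -> rat).
Local Notation V := 'I_(nverts H).
Local Notation I := (independent H).
Local Notation n := (nverts H).
Local Notation lip := (lipschitz c dl).
Local Notation Q := (aux p).
Implicit Types (f g h : {set V} -> rat) (X Y : {set V}) (u v w : V).

Hypothesis n_gt0 : (0 < n)%N.
Hypothesis dl_gt0 : 0 < dl.
Hypothesis ka_lt1 : ka < 1.
Hypothesis cost_lo : forall X w, w \notin X -> I (w |: X) -> dl <= flip_cost c dl X w.
Hypothesis cost_hi : forall X w, w \notin X -> I (w |: X) ->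
  flip_cost c dl X w <= D%:R + dl.
Hypothesis driftQ : forall h X w, lip 1 h -> w \notin X -> I (w |: X) ->
  `|\sum_v aux_at p h v (w |: X) - \sum_v aux_at p h v X|
    <= 2 * (n%:R - ka) * flip_cost c dl X w.
Let rho := 1 - ka / n%:R.

Let nn : n%:R != 0 :> rat.
Proof. by rewrite pnatr_eq0 -lt0n. Qed.

Let rho_gt0 : 0 < rho.
Proof.
rewrite subr_gt0 ltr_pdivrMr ?ltr0n // mul1r; apply: lt_le_trans ka_lt1 _.
by rewrite ler1n.
Qed.

Lemma aux_lipschitz a h : 0 < a -> lip a h -> lip (rho * a) (Q h).
Proof.
move=> a0 lh X w wX iY; pose g Y := a^-1 * h Y.
have lg : lip 1 g.
  move=> Z v vZ iZ; rewrite -mulrBr normrM gtr0_norm ?invr_gt0 //.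
  by rewrite mul1r ler_pdivrMl //; apply: lh.
have E Y : Q h Y = a * Q g Y.
  by rewrite -auxZ; apply: eq_aux => Z; rewrite mulVKf // gt_eqF.
rewrite !E -mulrBr normrM (gtr0_norm a0) mulrAC mulrC ler_wpM2r ?(ltW a0) //.
rewrite /aux -mulrBr normrM ger0_norm ?invr_ge0 ?mulr_ge0 ?ler0n //.
rewrite ler_pdivrMl ?mulr_gt0 ?ltr0n //; apply: le_trans (driftQ lg wX iY) _.
by rewrite /rho le_eqVlt; apply/orP; left; apply/eqP; field.
Qed.

Lemma lipschitz_exists h : exists2 a, 0 < a & lip a h.
Proof.
pose B := \sum_X `|h X|.
have hB X : `|h X| <= B.
  by rewrite /B (bigD1 X) //= lerDl; apply: sumr_ge0 => *.
have B0 : 0 <= B by apply: le_trans (hB set0).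
exists ((2 * B + 1) / dl); first by rewrite divr_gt0 // ltr_wpDl ?mulr_ge0.
move=> X w wX iY; apply: (@le_trans _ _ (2 * B + 1)).
  by apply: le_trans (ler_normB _ _) _; have := hB X; have := hB (w |: X); lra.
rewrite mulrAC ler_pdivlMr // ler_wpM2l ?cost_lo //.
by rewrite addr_ge0 ?mulr_ge0.
Qed.

Lemma lipschitz_set0 a h X : 0 < a -> lip a h -> I X ->
  `|h X - h set0| <= #|X|%:R * (a * (D%:R + dl)).
Proof.
move=> a0 lh; have [k] := ubnPleq #|X|; elim: k X => [|k IH] X.
  by rewrite leqn0 cards_eq0 => /eqP-> _; rewrite subrr normr0 mulr_ge0 ?mulr_ge0 ?addr_ge0 ?ler0n // ltW.
case: (set_0Vmem X) => [-> _ _|[u uX] Xk iX].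
  by rewrite subrr normr0 mulr_ge0 ?mulr_ge0 ?addr_ge0 ?ler0n // ltW.
have uZ : u \notin X :\ u by rewrite !inE eqxx.
have iZ : I (X :\ u) by apply: independentS iX; apply: subD1set.
have Xu := setD1K uX.
have EX : #|X| = #|X :\ u|.+1 by rewrite (cardsD1 u X) uX.
rewrite EX in Xk *; have h1 := IH _ Xk iZ.
have := cost_hi uZ; have := lh _ _ uZ; rewrite Xu => /(_ iX) h2 /(_ iX) h3.
have h4 : a * flip_cost c dl (X :\ u) u <= a * (D%:R + dl) by rewrite ler_wpM2l // ltW.
rewrite -[_.+1]add1n natrD mulrDl mul1r -(subrKA (h (X :\ u))).
by apply: le_trans (ler_normD _ _) (lerD (le_trans h2 h4) h1).
Qed.

Lemma lipschitz_diff a h X Y : 0 < a -> lip a h -> I X -> I Y ->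
  `|h X - h Y| <= 2 * n%:R * (a * (D%:R + dl)).
Proof.
move=> a0 lh iX iY.
have K0 : 0 <= a * (D%:R + dl) by rewrite mulr_ge0 ?addr_ge0 ?ler0n // ltW.
have bd Z : I Z -> `|h Z - h set0| <= n%:R * (a * (D%:R + dl)).
  move=> iZ; apply: le_trans (lipschitz_set0 a0 lh iZ) _.
  by rewrite ler_wpM2r // ler_nat -[leqRHS]card_ord max_card.
rewrite -mulrA [leRHS]mulrC mulr_natr mulr2n -(subrKA (h set0)).
by apply: le_trans (ler_normD _ _) (lerD (bd X iX) _); rewrite distrC bd.
Qed.

Local Notation sq f := (ip f f).
Local Notation iterQ t f := (iter t Q f).

Lemma ip_ge0 f : 0 <= sq f.
Proof. by apply: sumr_ge0 => X _; rewrite -expr2 sqr_ge0. Qed.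

Lemma ip_cauchy_schwarz f g : ip f g ^+ 2 <= sq f * sq g.
Proof. exact: cauchy_schwarz. Qed.

Lemma aux_mean f : \sum_(X | I X) Q f X = \sum_(X | I X) f X.
Proof.
have := aux_selfadjoint p f (fun=> 1); rewrite /ip.
under eq_bigr do rewrite mulr1; move=> ->.
by apply: eq_bigr => X _; rewrite aux1 // mulr1.
Qed.

Lemma iter_mean t f : \sum_(X | I X) iterQ t f X = \sum_(X | I X) f X.
Proof. by elim: t => //= t IH; rewrite aux_mean. Qed.

Lemma iter_lipschitz a h t : 0 < a -> lip a h -> lip (rho ^+ t * a) (iterQ t h).
Proof.
move=> a0 lh; elim: t => [|t IH]; first by rewrite mul1r.
by rewrite exprS -mulrA iterS; apply: aux_lipschitz; rewrite ?mulr_gt0 ?exprn_gt0.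
Qed.

Lemma mean0_bound a h X : 0 < a -> lip a h -> \sum_(Y | I Y) h Y = 0 -> I X ->
  `|h X| <= 2 * n%:R * (a * (D%:R + dl)).
Proof.
move=> a0 lh h0 iX; set K := _ * (a * _).
pose N : rat := #|[set Y | I Y]|%:R.
have N0 : 0 < N by rewrite ltr0n; apply/card_gt0P; exists X; rewrite inE.
rewrite -(ler_pM2l N0) -{1}[N]gtr0_norm // -normrM.
have sumN x : \sum_(Y | I Y) x = N * x.
  by rewrite sumr_const mulr_natl cardsE.
have -> : N * h X = \sum_(Y | I Y) (h X - h Y).
  by rewrite sumrB h0 subr0 sumN.
rewrite -sumN; apply: le_trans (ler_norm_sum _ _ _) _; apply: ler_sum => Y iY.
exact: lipschitz_diff.
Qed.

(** Iterating the swap chain on a function of mean zero multiplies its Lipschitz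
constant by [rho] each time, which bounds the norms of all iterates; log-convexity
of these norms turns the asymptotic rate into a bound for one step. *)
Lemma aux_contracts f : \sum_(X | I X) f X = 0 -> sq (Q f) <= rho ^+ 2 * sq f.
Proof.
move=> f0; have [a a0 lf] := lipschitz_exists f.
pose K := 2 * n%:R * (a * (D%:R + dl)).
apply: (@log_convex_decay (fun t => sq (iterQ t f)) _ (\sum_(X | I X) K ^+ 2)).
- by rewrite exprn_gt0.
- by move=> t; apply: ip_ge0.
- move=> t; rewrite {1}iterS aux_selfadjoint -iterS /=; exact: ip_cauchy_schwarz.
move=> t; rewrite mulr_suml; apply: ler_sum => X iX.
rewrite -expr2 -real_normK ?num_real // -exprM mulnC exprM -exprMn.
have := mean0_bound (mulr_gt0 (exprn_gt0 t rho_gt0) a0) (iter_lipschitz t a0 lf)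
  (etrans (iter_mean t f) f0) iX.
rewrite (_ : _ * (_ * _) = K * rho ^+ t) => [le|]; last by rewrite /K; ring.
by apply: lerXn2r; rewrite ?nnegrE // (le_trans _ le).
Qed.

Lemma aux_gap f : \sum_(X | I X) f X = 0 ->
  (ka / n%:R) * sq f <= ip f (fun X => f X - Q f X).
Proof.
move=> f0; have := aux_contracts f0.
have : 0 <= sq (fun X => rho * f X - Q f X) by apply: ip_ge0.
have -> : sq (fun X => rho * f X - Q f X) =
   rho ^+ 2 * sq f - 2 * rho * ip f (Q f) + sq (Q f).
  by rewrite /ip !mulr_sumr -sumrB -big_split /=; apply: eq_bigr => X _; ring.
have -> : ip f (fun X => f X - Q f X) = sq f - ip f (Q f).
  by rewrite /ip -sumrB; apply: eq_bigr => X _; rewrite mulrBr.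
move=> h1 h2; have -> : ka / n%:R = 1 - rho by rewrite /rho; ring.
suff : rho * ip f (Q f) <= rho * (rho * sq f) by rewrite ler_pM2l //; lra.
rewrite mulrA -expr2; lra.
Qed.

End SpectralGap.

(** * Edge weights *)
Section Recursion.
Variables (N : nat) (eta : rat).
Hypothesis eta_ge0 : 0 <= eta.
Hypothesis eta_le1 : eta <= 1.

(** Two consecutive values of the sequence defined by [wt 0 = 1] and the recurrence
[wt_rec], which is equality in [adm_c_low] with [eta = 2 * ka] and
[N = m - 1]. *)
Fixpoint wt2 (i : nat) : rat * rat :=
  if i is j.+1 then
    let: (x, y) := wt2 j in
    (y, ((N%:R + 2 - eta) * y - j.+1%:R * x) / (N%:R - j.+1%:R))
  else (1, (N%:R + 2 - eta) / N%:R).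

Definition wt i := (wt2 i).1.

Lemma wtS i : wt i.+1 = (wt2 i).2.
Proof. by rewrite /wt /=; case: (wt2 i). Qed.

Lemma wt0 : wt 0 = 1. Proof. by []. Qed.

Lemma wt_rec i : (i < N)%N ->
  (N%:R - i%:R) * wt i.+1 = (N%:R + 2 - eta) * wt i - i%:R * wt i.-1.
Proof.
move=> iN; have nz : N%:R - i%:R != 0 :> rat.
  by rewrite subr_eq0 eqr_nat gtn_eqF.
case: i iN nz => [|i] iN nz.
  rewrite wtS wt0 !mulr1 [0%:R]/0 !subr0 /= mulrCA mulfV ?mulr1 //.
  by rewrite subr0 in nz.
rewrite wtS [i.+1.-1]/= /wt /=; case: (wt2 i) => x y /=.
by rewrite mulrC divfK.
Qed.

Lemma wt_mono i : (i < N)%N -> 0 < wt i /\ wt i <= wt i.+1.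
Proof.
have N0 j : (j < N)%N -> 0 < N%:R - j%:R :> rat by rewrite subr_gt0 ltr_nat.
elim: i => [|i IH] iN; have r := wt_rec iN; have p := N0 _ iN.
  split; first by rewrite wt0.
  by rewrite -(ler_pM2l p) r mul0r wt0; have e1 := eta_le1; lra.
have [w0 w1] := IH (ltnW iN); have w2 : 0 < wt i.+1 by apply: lt_le_trans w1.
split=> //; rewrite -(ler_pM2l p) r /=.
have : i.+1%:R * wt i <= i.+1%:R * wt i.+1 by rewrite ler_wpM2l ?ler0n.
have : 0 <= (2 - eta) * wt i.+1 by rewrite mulr_ge0 ?ltW //; have := eta_le1; lra.
lra.
Qed.

Lemma wt_bound i : (i <= N)%N -> wt i <= (N.+2)%:R ^+ i.
Proof.
elim: i => [|i IH] iN; first by rewrite wt0 expr0.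
have [w0 w1] := wt_mono iN.
have r := wt_rec iN.
have wp : 0 <= i%:R * wt i.-1.
  case: i {IH r w0 w1} iN => [|i] iN; first by rewrite mul0r.
  by rewrite mulr_ge0 ?ler0n // ltW //; case: (wt_mono (ltnW iN)).
have w2 : 0 < wt i.+1 by apply: lt_le_trans w1.
have : wt i.+1 <= (N%:R - i%:R) * wt i.+1.
  rewrite -[leLHS]mul1r; apply: ler_wpM2r; first exact: ltW.
  by rewrite lerBrDr nat1r ler_nat.
move=> h; rewrite exprS; apply: (@le_trans _ _ (N.+2%:R * wt i)); last first.
  by rewrite ler_wpM2l ?ler0n // IH // ltnW.
apply: le_trans h _; rewrite r -[N.+2]addn2 natrD.
have : 0 <= eta * wt i by rewrite mulr_ge0 // ltW.
lra.
Qed.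

(** The left-hand side would be constant in [i] for [eta = 0].  At [i = N - 2] it is
[2 * wt (N - 1) - (N - 1) * wt (N - 2)], and its positivity is the slack in
[adm_c_crit]. *)
Lemma wt_gap i : (i < N)%N ->
  (N%:R - i%:R) * wt i.+1 - (i.+1)%:R * wt i
    = N%:R + 1 - eta * \sum_(j < i.+1) wt j.
Proof.
elim: i => [|i IH] iN.
  by rewrite wt_rec // big_ord1 wt0 mul0r; ring.
have IH1 := IH (ltnW iN); rewrite wt_rec // big_ord_recr [i.+1.-1]/=.
move: IH1; rewrite /= -[i.+2%:R]natr1 -[i.+1%:R]natr1; move: (\sum_(j < i.+1) wt j) => S; lra.
Qed.

End Recursion.

(** The weights are [wt] normalized at the top.  [B] bounds all of [wt], and [eta] is
so small that the gap [N + 1] of the unperturbed recurrence loses at most [1]. *)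
Lemma admissible_large m D : (D + 2 <= m)%N -> (5 <= D + 2)%N ->
  exists c p dl ka M, admissible m D c p dl ka M.
Proof.
move=> Dm D3; pose N := m.-1.
have N4 : (4 <= N)%N by rewrite /N; lia.
have iN1 i : (i.+1 < m)%N -> (i < N)%N by rewrite /N; lia.
have iN2 i : (i.+2 < m)%N -> (i < N)%N by rewrite /N; lia.
have N2 : (N.-2 < N)%N by lia.
have NN : (N.-1 < N)%N by lia.
have N21 : N.-2.+1 = N.-1 by lia.
have NN2 : (N - N.-2 = 2)%N by lia.
have m3 : (m - 3 = N.-2)%N by rewrite /N; lia.
have DN1 : (D <= N.-1)%N by rewrite /N; lia.
have Ngt0 : (0 < N)%N by lia.
have N2' : (N <= N.+2)%N by lia.
pose B : rat := (N.+2)%:R ^+ N.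
have B1 : 1 <= B by rewrite exprn_ege1 // ler1n.
have NB : N%:R <= B.
  apply: (@le_trans _ _ N.+2%:R); first by rewrite ler_nat.
  rewrite /B -[N in _ ^+ N](prednK (ltnW (ltnW (ltnW N4)))) exprS -[leLHS]mulr1.
  by rewrite ler_wpM2l // exprn_ege1 // ler1n.
have B0 : 0 < B by apply: lt_le_trans B1.
pose eta := (N%:R * B)^-1.
have N0 : 0 < N%:R :> rat by rewrite ltr0n.
have N4' : 4 <= N%:R :> rat by rewrite (ler_nat _ 4).
have eta0 : 0 < eta by rewrite invr_gt0 mulr_gt0.
have eta4 : eta <= 4^-1.
  rewrite lef_pV2 ?posrE ?mulr_gt0 //; apply: le_trans N4' _.
  by rewrite -[leLHS]mulr1 ler_wpM2l // ltW.
have eta1 : eta <= 1 by lra.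
pose w := wt N eta; pose top := w N.-1.
have top0 : 0 < top by case: (wt_mono eta1 NN).
have wB i : (i < N)%N -> w i <= B.
  move=> iN; apply: le_trans (wt_bound (ltW eta0) eta1 (ltnW iN)) _.
  by rewrite /B ler_weXn2l ?ler1n // ltnW.
have gap : 2 * top - N.-1%:R * w N.-2 >= N%:R.
  have := wt_gap eta N2; rewrite N21.
  rewrite -natrB ?(ltnW N2) // NN2.
  rewrite -/w -/top => ->.
  suff : eta * \sum_(j < N.-1) w j <= 1 by lra.
  rewrite mulrC ler_pdivrMr ?mulr_gt0 // mul1r.
  apply: (@le_trans _ _ (\sum_(j < N.-1) B)).
    by apply: ler_sum => j _; apply: wB; apply: ltn_trans NN.
  by rewrite sumr_const card_ord -[leLHS]mulr_natl ler_wpM2r ?ler_nat ?ltW // ltnW.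
exists (fun i => w i / top), 0, (4 * B)^-1, (eta / 2), (D%:R + (4 * B)^-1).
have dl0 : 0 < (4 * B)^-1 by rewrite invr_gt0 mulr_gt0.
split=> //=.
- move=> i im; rewrite divr_ge0 ?(ltW top0) // ltW //.
  by have [] := wt_mono eta1 (iN1 _ im).
- move=> i im; rewrite ler_wpM2r ?invr_ge0 ?(ltW top0) //.
  by have [] := wt_mono eta1 (iN2 _ im).
- by rewrite divff // gt_eqF.
- move=> i im; have iN := iN2 _ im.
  rewrite -/N natrB ?(ltnW iN) // -!mulrBl !mulrA -mulrDl ler_wpM2r ?invr_ge0 ?(ltW top0) //.
  have r := wt_rec eta iN; rewrite -/w in r.
  have -> : i%:R * (w i.-1 - w i) + (N%:R - i%:R) * (w i.+1 - w i) =
     (2 - eta) * w i + ((N%:R - i%:R) * w i.+1 - ((N%:R + 2 - eta) * w i - i%:R * w i.-1)) by ring.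
  by rewrite r subrr addr0 le_eqVlt; apply/orP; left; apply/eqP; field.
- rewrite m3 (_ : m.-2 = N.-1) // (_ : N.-1%:R * (w N.-2 / top - 1) = (N.-1%:R * w N.-2) / top - N.-1%:R); last by ring.
  have h1 : (N.-1%:R * w N.-2) / top <= 2 - N%:R / B.
    rewrite ler_pdivrMr // mulrBl.
    suff : N%:R / B * top <= N%:R by move: gap; lra.
    rewrite mulrAC ler_pdivrMr // ler_wpM2l ?(ltW N0) //.
    by apply: wB.
  have DN : D%:R <= N.-1%:R :> rat by rewrite ler_nat.
  have h2 : N%:R / B >= 4 / B by rewrite ler_wpM2r ?invr_ge0 ?(ltW B0).
  have h3 : eta <= B^-1.
    by rewrite lef_pV2 ?posrE ?mulr_gt0 // -[leLHS]mul1r ler_wpM2r ?(ltW B0) // ler1n.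
  have h4 : (4 * B)^-1 = 4^-1 * B^-1 by rewrite invfM.
  have h5 : 0 < B^-1 by rewrite invr_gt0.
  rewrite h4; lra.
- by rewrite mul0r.
- by rewrite divr_gt0.
- lra.
- by rewrite !subr0 mul1r.
- by rewrite !mul0r addr_ge0 ?ler0n // ltW.
Qed.

(** Swaps are needed for [m = 2] and [m = 3]; for [m = 4] the weights suffice. *)
Lemma admissible_small m : (2 <= m)%N -> (m <= 4)%N ->
  exists c p dl ka M, admissible m 3 c p dl ka M.
Proof.
(* Simplification would unfold the arithmetic of rational literals, so each
   constant is hidden behind an equation. *)
have name (x : rat) : exists y, y = x by exists x.
case: m => [//|[//|[|[|[|//]]]]] _ _.
- have [p Ep] := name (3 / 10); have [dl Ed] := name 10^-1.
  have [ka Ek] := name 20^-1; have [M EM] := name (187 / 100).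
  exists (fun=> 1), p, dl, ka, M.
  split; [by []|by []|by []|by []|..]; 
    rewrite /= ?Ep ?Ed ?Ek ?EM; clear; lra.
- have [p Ep] := name 6^-1; have [dl Ed] := name 20^-1.
  have [ka Ek] := name 100^-1; have [M EM] := name (19 / 8).
  have [a Ea] := name (3 / 5).
  exists (fun i => if i is 0%N then a else 1), p, dl, ka, M.
  split; [case=> [|[|//]] _ |case=> [|//] _|by []|case=> [|//] _|..];
    rewrite ?subSS ?subn0 /= ?Ep ?Ed ?Ek ?EM ?Ea; clear; lra.
- have [p Ep] := name 0; have [dl Ed] := name 100^-1.
  have [ka Ek] := name 100^-1; have [M EM] := name (301 / 100).
  have [a Ea] := name (35 / 100); have [b Eb] := name (48 / 100).
  exists (fun i => if i is 0%N then a else if i is 1%N then b else 1), p, dl, ka, M.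
  split; [case=> [|[|[|//]]] _|case=> [|[|//]] _|by []|case=> [|[|//]] _|..];
    rewrite ?subSS ?subn0 /= ?Ep ?Ed ?Ek ?EM ?Ea ?Eb; clear; lra.
Qed.

Lemma admissible_exists m D :
  (D + 2 <= m /\ 5 <= D + 2 \/ D = 3 /\ 2 <= m)%N ->
  exists c p dl ka M, admissible m D c p dl ka M.
Proof.
case=> [[Dm D3]|[-> m2]]; first exact: admissible_large.
by have [m4|m4] := leqP m 4; [apply: admissible_small | apply: admissible_large].
Qed.

(** * Rapid mixing *)
Section Mixing.
Variables (H : hypergraph) (m D : nat).
Hypothesis unifH : uniform_bounded m D H.
Hypothesis m_ge2 : (2 <= m)%N.
Variables (c : nat -> rat) (p dl ka M : rat).
Hypothesis adm : admissible m D c p dl ka M.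
Hypothesis n_gt0 : (0 < nverts H)%N.

Local Notation n := (nverts H).
Local Notation V := 'I_(nverts H).
Local Notation I := (independent H).
Implicit Types (X Y : {set V}) (v : V).

Definition rate : rat := ka / (1 + p * (4 * D * m)%:R) / n%:R.

Lemma glauber_decay (f : {set V} -> rat) : \sum_(X | I X) f X = 0 ->
  ip (glauber f) (glauber f) <= (1 - rate) * ip f f.
Proof.
case: adm => c0 cm ct cl cc p0 p1 d0 k0 k1 Mf Mb f0.
apply: le_trans (glauber_contracts f n_gt0) _.
have h : ka / n%:R * ip f f <= ip f (fun X => f X - aux p f X).
  apply: (@aux_gap H D p dl ka c) => //.
  - exact: (flip_cost_ge unifH adm).
  - exact: (flip_cost_le unifH adm).
  - move=> h X w.
    exact: (drift unifH adm).
have := glauber_gap unifH p0 n_gt0 h.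
have -> : ip f (fun X => f X - glauber f X) = ip f f - ip f (glauber f).
  by rewrite /ip -sumrB; apply: eq_bigr => X _; rewrite mulrBr.
by rewrite /rate [X in X * _ <= _]mulrAC; lra.
Qed.

Lemma independent0 : I set0.
Proof.
apply/independentP => e eH; rewrite subset0 -cards_eq0 (edge_card unifH eH).
by rewrite -lt0n ltnW.
Qed.

Lemma update_toggle v X Y :
  update v X Y = ((Y == toggle v X)%:R + (Y == X)%:R) / 2.
Proof.
rewrite /update /toggle; case: ifP => // _; case: ifP => // _.
by case: (Y == X); lra.
Qed.

Lemma law_dependent t Y : ~~ I Y -> law H t Y = 0.
Proof.
elim: t Y => [|t IH] Y niY /=.
  by case: eqP niY => // ->; rewrite independent0.
apply: big1 => X _; case iX : (I X); last by rewrite IH ?iX ?mul0r.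
rewrite /transition gtn_eqF // big1 ?mulr0 ?mulr0 // => v _.
rewrite update_toggle; case: eqP niY => [->|_]; first by rewrite independent_toggle.
by case: eqP => [->|_]; [rewrite iX | rewrite addr0 mul0r].
Qed.

(** On independent sets transitions are symmetric, so the law evolves by the same
operator as functions do. *)
Lemma law_glauber t Y : I Y -> law H t.+1 Y = glauber (law H t) Y.
Proof.
move=> iY /=; rewrite (bigID I) /= [X in _ + X]big1 ?addr0 => [|X iX]; last first.
  by rewrite law_dependent ?mul0r.
rewrite /transition gtn_eqF //.
under eq_bigr => X _.
  rewrite mulrCA mulr_sumr.
  under eq_bigr => v _ do rewrite update_toggle.
  over.
rewrite -mulr_sumr /glauber exchange_big /=; congr (_ * _); apply: eq_bigr => v _.
under eq_bigr => X _ do rewrite mulrA mulrDr.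
rewrite -mulr_suml big_split /=; congr (_ / _); rewrite addrC; congr (_ + _).
  rewrite (bigD1 Y) //= eqxx mulr1 big1 ?addr0 // => X /andP[_ /negPf nXY].
  by rewrite eq_sym nXY mulr0.
rewrite (bigD1 (toggle v Y)) ?independent_toggle //= toggleK // eqxx mulr1.
rewrite big1 ?addr0 // => X /andP[iX nX].
have [E|_] := eqVneq Y (toggle v X); last by rewrite mulr0.
by rewrite E toggleK ?eqxx in nX.
Qed.

Local Notation N := (#|[set Y | I Y]|).

Let N_gt0 : (0 < N)%N.
Proof. by apply/card_gt0P; exists set0; rewrite inE independent0. Qed.

Let f0 (X : {set V}) : rat := law H 0 X - N%:R^-1.

(** The uniform law is stationary and can be subtracted before iterating. *)
Lemma law_iter t Y : I Y -> law H t Y - N%:R^-1 = iter t (@glauber H) f0 Y.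
Proof.
elim: t Y => [//|t IH] Y iY; rewrite law_glauber // iterS /glauber.
have nn : n%:R != 0 :> rat by rewrite pnatr_eq0 -lt0n.
have <- : n%:R^-1 * (\sum_(v : V) N%:R^-1) = N%:R^-1 :> rat.
  by rewrite sumr_const card_ord -[X in _ * X]mulr_natl mulKf.
rewrite -mulrBr -sumrB; congr (_ * _); apply: eq_bigr => v _.
rewrite -!IH ?independent_toggle //.
have nn2 : N%:R != 0 :> rat by rewrite pnatr_eq0 -lt0n.
by field.
Qed.

Lemma sum_uniform : \sum_(X | I X) N%:R^-1 = 1 :> rat.
Proof.
rewrite sumr_const -[LHS]mulr_natl -cardsE mulfV // pnatr_eq0 -lt0n.
exact: N_gt0.
Qed.

Lemma sum_start (g : {set V} -> rat) : \sum_(X | I X) law H 0 X * g X = g set0.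
Proof.
rewrite (bigD1 set0) ?independent0 //= eqxx mul1r big1 ?addr0 // => X.
by case/andP=> _ /negPf ->; rewrite mul0r.
Qed.

Lemma start_mean0 : \sum_(X | I X) f0 X = 0.
Proof.
rewrite sumrB sum_uniform -(sum_start (fun=> 1)).
by under [in X in _ - X]eq_bigr do rewrite mulr1; rewrite subrr.
Qed.

Lemma start_norm : ip f0 f0 <= 1.
Proof.
have -> : ip f0 f0 = \sum_(X | I X) law H 0 X * law H 0 X
   - 2 * (\sum_(X | I X) law H 0 X * N%:R^-1)
   + N%:R^-1 * \sum_(X | I X) N%:R^-1.
  rewrite !mulr_sumr -sumrB -big_split /=; apply: eq_bigr => X _; rewrite /f0.
  by set x := law _ _ _; set y := N%:R^-1; ring.
rewrite !sum_start sum_uniform /= eqxx.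
have : 0 <= N%:R^-1 :> rat by rewrite invr_ge0 ler0n.
rewrite (_ : true%:R = 1 :> rat) // mulr1; move: (_%:R^-1) => x; lra.
Qed.

Lemma rate_le1 : 0 < rate /\ rate < 1.
Proof.
case: adm => _ _ _ _ _ p0 _ _ k0 k1 _ _.
have q1 : 1 <= 1 + p * (4 * D * m)%:R by rewrite lerDl mulr_ge0.
have q0 : 0 < 1 + p * (4 * D * m)%:R by apply: lt_le_trans q1.
have n1 : 1 <= n%:R :> rat by rewrite ler1n.
have n0 : 0 < n%:R :> rat by rewrite ltr0n.
split; first by rewrite /rate !divr_gt0.
rewrite /rate ltr_pdivrMr // mul1r ltr_pdivrMr //; apply: lt_le_trans k1 _.
by rewrite -[1]mul1r ler_pM.
Qed.

Lemma glauber_aux0 f X : glauber f X = aux 0 f X.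
Proof.
rewrite /glauber /aux -mulr_suml mulrA [RHS]mulrC invfM.
under [in RHS]eq_bigr => v _ do rewrite /aux_at mul0r addr0.
by rewrite mulrAC [RHS]mulrC [2^-1 * _]mulrC -!mulrA; congr (_ * _); rewrite mulrC.
Qed.

Lemma iter_decay t :
  let f := iter t (@glauber H) f0 in
  \sum_(X | I X) f X = 0 /\ ip f f <= (1 - rate) ^+ t.
Proof.
have [r0 r1] := rate_le1.
elim: t => [|t [m0 IH]]; first by split; [apply: start_mean0 | apply: start_norm].
split.
  by rewrite /= -[RHS]m0 -[RHS](aux_mean 0 n_gt0); apply: eq_bigr => X _;
    rewrite glauber_aux0.
apply: le_trans (glauber_decay m0) _.
by rewrite exprS ler_wpM2l // subr_ge0 ltW.
Qed.

(** Total variation is half an L1 norm, and the state space has at most [2 ^ n]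
points. *)
Lemma tv_dist_decay t :
  tv_dist (law H t) (unif_indep H) ^+ 2 <= 2 ^+ n * (1 - rate) ^+ t.
Proof.
have [r0 r1] := rate_le1; have [_ dec] := iter_decay t.
set f := iter t (@glauber H) f0 in dec.
have -> : tv_dist (law H t) (unif_indep H) = 2^-1 * \sum_(X | I X) `|f X|.
  congr (_ * _); rewrite (bigID I) /= [X in _ + X]big1 ?addr0 => [|X niX].
    by apply: eq_bigr => X iX; rewrite /unif_indep iX mul1r law_iter.
  by rewrite law_dependent // /unif_indep (negPf niX) mul0r subr0 normr0.
apply: (@le_trans _ _ ((\sum_(X | I X) `|f X|) ^+ 2)).
  have : 0 <= (\sum_(X | I X) `|f X|) ^+ 2 by apply: sqr_ge0.
  by rewrite exprMn !expr2; lra.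
have := cauchy_schwarz I (fun X => `|f X|) (fun=> 1).
under [X in X ^+ 2 <= _]eq_bigr do rewrite mulr1.
move=> /le_trans; apply; rewrite mulrC.
under [X in X * _]eq_bigr do rewrite expr1n.
rewrite sumr_const.
have -> : \sum_(X | I X) `|f X| ^+ 2 = ip f f.
  by apply: eq_bigr => X _; rewrite real_normK ?num_real // expr2.
apply: ler_pM => //; first by rewrite sumr_ge0 // => X _; rewrite -expr2 sqr_ge0.
have -> : 2 ^+ n = #|{set V}|%:R :> rat.
  by rewrite -natrX -cardsT -powersetT card_powerset cardsT card_ord.
by rewrite ler_nat max_card.
Qed.

(** Every [k * n] steps halve the L2 norm squared; [n] halvings absorb the size of
the state space, and [2 ^ W] exceeds [W]. *)
Lemma tv_dist_le (k W : nat) : (0 < W)%N ->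
  (1 + p * (4 * D * m)%:R) / ka <= k%:R ->
  tv_dist (law H (k * n * (n + 2 * W))) (unif_indep H) <= W%:R^-1.
Proof.
move=> W0 hk; have [r0 r1] := rate_le1.
have tv0 t : 0 <= tv_dist (law H t) (unif_indep H).
  by rewrite /tv_dist mulr_ge0 ?invr_ge0 // sumr_ge0.
have p0 := adm_p_ge0 adm; have k0 := adm_ka_gt0 adm.
have q0 : 0 < 1 + p * (4 * D * m)%:R by rewrite ltr_wpDr ?mulr_ge0.
have kr : 1 <= (k * n)%:R * rate.
  have nn : n%:R != 0 :> rat by rewrite pnatr_eq0 -lt0n.
  rewrite natrM /rate -mulrA [n%:R * _]mulrC divfK //.
  by move: hk; rewrite ler_pdivrMr // mulrA ler_pdivlMr // mul1r.
have half : (1 - rate) ^+ (k * n) <= 2^-1.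
  have le1 : (1 - rate) ^+ (k * n) * (1 + rate) ^+ (k * n) <= 1.
    rewrite -exprMn exprn_ile1 //; have := sqr_ge0 rate; rewrite expr2; nra.
  have := bernoulli (k * n) (ltW r0).
  have : 0 <= (1 - rate) ^+ (k * n) by rewrite exprn_ge0 // subr_ge0 ltW.
  nra.
have tvW t : (t = k * n * (n + 2 * W))%N ->
   tv_dist (law H t) (unif_indep H) ^+ 2 <= (2^-1 ^+ W) ^+ 2.
  move=> ->; apply: le_trans (tv_dist_decay _) _.
  rewrite exprM; apply: (@le_trans _ _ (2 ^+ n * (2^-1) ^+ (n + 2 * W))).
    rewrite ler_wpM2l ?exprn_ge0 //; apply: lerXn2r => //; rewrite nnegrE //.
    by rewrite exprn_ge0 // subr_ge0 ltW.
  by rewrite exprD mulrA -exprMn divff // expr1n mul1r mulnC exprM.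
apply: (@le_trans _ _ (2^-1 ^+ W)).
  by rewrite -(ler_pXn2r (n := 2)) ?nnegrE ?exprn_ge0 // tvW.
rewrite exprVn lef_pV2 ?posrE ?exprn_gt0 ?ltr0n // -natrX ler_nat ltnW //.
exact: ltn_expl.
Qed.

End Mixing.

Lemma tv_dist_no_vertex (H : hypergraph) m D t :
  uniform_bounded m D H -> (0 < m)%N -> nverts H = 0%N ->
  tv_dist (law H t) (unif_indep H) = 0.
Proof.
move=> uH m0 n0.
have all0 (X : {set 'I_(nverts H)}) : X = set0.
  by apply/setP => x; have := ltn_ord x; rewrite [X in (_ < X)%N]n0.
have i0 : independent H set0.
  apply/independentP => e eH; rewrite subset0 -cards_eq0 (edge_card uH eH).
  by rewrite -lt0n.
have lt : law H t set0 = 1.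
  elim: t => [|t IH] /=; first by rewrite eqxx.
  rewrite (bigD1 set0) //= big1 ?addr0 => [|X]; last by rewrite (all0 X) eqxx.
  by rewrite IH mul1r /transition (introT eqP n0) eqxx.
rewrite /tv_dist big1 ?mulr0 // => X _; rewrite (all0 X) lt /unif_indep i0.
rewrite (_ : [set Y | _] = [set set0]) ?cards1 ?divr1 ?subrr ?normr0 //.
by apply/setP => Y; rewrite !inE (all0 Y) i0 eqxx.
Qed.

Theorem rapid_mixing m D :
  (D + 2 <= m /\ 5 <= D + 2 \/ D = 3 /\ 2 <= m)%N ->
  exists k : nat, forall (H : hypergraph) (W : nat),
    uniform_bounded m D H -> (0 < W)%N ->
    tv_dist (law H (k * nverts H * (nverts H + 2 * W))) (unif_indep H)
      <= W%:R^-1.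
Proof.
move=> hmD; have m2 : (2 <= m)%N.
  by case: hmD => [[Dm D5]|[]//]; rewrite (leq_trans _ Dm) // leq_addl.
have [c [p [dl [ka [M adm]]]]] := admissible_exists hmD.
exists (Num.bound ((1 + p * (4 * D * m)%:R) / ka)) => H W uH W0.
have [n0|n0] := posnP (nverts H).
  by rewrite (tv_dist_no_vertex _ uH (ltnW m2) n0) invr_ge0 ler0n.
apply: (tv_dist_le uH m2 adm) => //; apply/ltW/archi_boundP.
have p0 := adm_p_ge0 adm; have k0 := adm_ka_gt0 adm.
by rewrite divr_ge0 ?(ltW k0) // addr_ge0 ?mulr_ge0 ?ler0n.
Qed.

Local Close Scope ring_scope.

(** * Size and cost of evaluation *)
Lemma vsize_gt0 v : 0 < vsize v.
Proof. by case: v. Qed.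

Lemma vsize_leaf n k : 0 < k -> (vsize (Leaf n) <= k) = (n < 2 ^ k).
Proof.
move=> k0; apply/idP/idP => /= [le|lt].
  by apply: leq_trans (trunc_log_ltn n (isT : 1 < 2)) _; rewrite leq_exp2l.
case: n lt => [|n] lt; first by rewrite trunc_log0.
rewrite -(ltn_exp2l _ _ (isT : 1 < 2)); apply: leq_ltn_trans lt.
exact: trunc_logP.
Qed.

Lemma vnum_lt v : vnum v < 2 ^ vsize v.
Proof.
case: v => [n|a b] /=; last by rewrite expn_gt0.
by rewrite -[_ < _](@vsize_leaf n (trunc_log 2 n).+1).
Qed.

(** Size of the text of an expression, literals counting for their bits: this makes
[vsize_eval] and [cost_bound] linear in the size of the registers. *)
Fixpoint esize (e : expr) : nat :=
  match e with
  | Var _ => 1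
  | Lit n => vsize (Leaf n)
  | Pair a b | Op _ a b => (esize a + esize b).+1
  | Fst a | Snd a => (esize a).+1
  end.

Lemma esize_gt0 e : 0 < esize e.
Proof. by case: e. Qed.

(** The number of bits of the result of an operation is at most the total number of
bits of its arguments. *)
Lemma vsize_binop o a b :
  vsize (Leaf (apply_binop o (vnum a) (vnum b))) <= vsize a + vsize b.
Proof.
have a0 := vsize_gt0 a; have b0 := vsize_gt0 b.
have la := vnum_lt a; have lb := vnum_lt b.
rewrite vsize_leaf ?addn_gt0 ?a0 // expnD.
have pa : 2 <= 2 ^ vsize a by rewrite (@leq_exp2l 2 1).
have pb : 2 <= 2 ^ vsize b by rewrite (@leq_exp2l 2 1).
have lm : 2 ^ vsize a <= 2 ^ vsize a * 2 ^ vsize b by rewrite leq_pmulr // expn_gt0.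
case: o => /=.
- have : (2 ^ vsize a - 2 + 2) * (2 ^ vsize b - 2 + 2) = 2 ^ vsize a * 2 ^ vsize b.
    by rewrite !subnK.
  by move: la lb pa pb; nia.
- by apply: leq_ltn_trans (leq_trans la lm); apply: leq_subr.
- exact: ltn_mul.
- by apply: leq_ltn_trans (leq_trans la lm); apply: leq_div.
- by apply: leq_ltn_trans (leq_b1 _) (leq_trans (leq_trans _ pa) lm).
- by apply: leq_ltn_trans (leq_b1 _) (leq_trans (leq_trans _ pa) lm).
Qed.

Lemma vsize_fst v : vsize (vfst v) <= vsize v.
Proof. by case: v => //= a b; rewrite -addnS leq_addr. Qed.

Lemma vsize_snd v : vsize (vsnd v) <= vsize v.
Proof. by case: v => //= a b; rewrite -addSn leq_addl. Qed.

Lemma eq_eval s s' e : s =1 s' -> eval s e = eval s' e.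
Proof. by move=> ss; elim: e => //= [a -> b ->|a ->|a ->|o a -> b ->]. Qed.

Section Size.
Variables (B : nat) (s : store).
Hypothesis B_gt0 : 0 < B.
Hypothesis sB : forall x, vsize (s x) <= B.

Lemma vsize_eval e : vsize (eval s e) <= esize e * B.
Proof.
elim: e => [x|n|a IHa b IHb|a IHa|a IHa|o a IHa b IHb] /=.
- by rewrite mul1n.
- exact: leq_pmulr.
- by rewrite mulSn mulnDl -add1n leq_add ?leq_add.
- by apply: leq_trans (vsize_fst _) (leq_trans IHa _); rewrite mulSn leq_addl.
- by apply: leq_trans (vsize_snd _) (leq_trans IHa _); rewrite mulSn leq_addl.
- apply: leq_trans (vsize_binop o _ _) _.
  by rewrite mulSn mulnDl (leq_trans (leq_add IHa IHb)) // leq_addl.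
Qed.

Lemma cost_bound e : cost s e <= esize e ^ 2 * B.
Proof.
have step e' r : r.+1 <= esize e' -> forall c, c <= r ^ 2 * B ->
    vsize (eval s e') + c <= esize e' ^ 2 * B.
  move=> le c lec; apply: leq_trans (leq_add (vsize_eval e') lec) _.
  rewrite -mulnDl leq_mul2r; apply/orP; right.
  move: (esize e') le => k rk; rewrite -!mulnn.
  by apply: (@leq_trans (k + r * k)); rewrite ?leq_add2l ?leq_mul2l ?(ltnW rk) ?orbT // -mulSn leq_mul2r rk orbT.
elim: e => [x|n|a IHa b IHb|a IHa|a IHa|o a IHa b IHb].
- by rewrite /cost addn0; apply: leq_trans (vsize_eval _) _; rewrite leq_mul2r orbC.
- rewrite /cost addn0; apply: leq_trans (vsize_eval _) _.
  by rewrite leq_mul2r -mulnn leq_pmulr ?orbT // esize_gt0.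
- apply: (step (Pair a b) (esize a + esize b)%N) => //.
  apply: leq_trans (leq_add IHa IHb) _.
  by rewrite -mulnDl leq_mul2r sqrnD leq_addr orbT.
- exact: (step (Fst a) (esize a)).
- exact: (step (Snd a) (esize a)).
- apply: (step (Op o a b) (esize a + esize b)%N) => //.
  apply: leq_trans (leq_add IHa IHb) _.
  by rewrite -mulnDl leq_mul2r sqrnD leq_addr orbT.
Qed.

End Size.

(** * Symbolic execution of programs *)
Lemma bind_cons A A' (wa : rat * A) d (k : A -> dist A') :
  bind (wa :: d) k = [seq ((wa.1 * wb.1)%R, wb.2) | wb <- k wa.2] ++ bind d k.
Proof. by []. Qed.

Lemma surely_bind A A' (d : dist A) (k : A -> dist A') E :
  surely (bind d k) E = surely d (fun a => surely (k a) E).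
Proof.
rewrite /surely; elim: d => [//|[w a] d IH].
by rewrite bind_cons all_cat IH all_map.
Qed.

Lemma bind_ret_r A (d : dist A) : bind d (fun a => ret a) = d.
Proof. by elim: d => [//|[w a] d IH]; rewrite bind_cons IH /= mulr1. Qed.

Section Runs.
(** [B] bounds the size of every value held in a register.  Expressions are chosen
so that evaluating one costs at most [C * B]. *)
Variables (B C : nat).
Hypothesis B_gt0 : 0 < B.
Variable good : pred (hypergraph * nat).
Variable H0 : hypergraph.

Local Notation S := (C * B).

(** What is recorded about a state: the leading registers, a bound on the time, and
whether the chain of the distinguished hypergraph [H0] has been simulated. *)
Record config := Config {
  cregs : seq Defs.val;
  ctime : nat;
  cseen : bool }.

Record At (x : config) (s : state) : Prop := {
  at_regs : regs s =1 nth (Leaf 0) (cregs x);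
  at_time : time s <= ctime x;
  at_good : all good (sims s);
  at_seen : cseen x ==> (H0 \in [seq h.1 | h <- sims s]);
  at_size : forall r, vsize (nth (Leaf 0) (cregs x) r) <= B }.

(** The outcomes of an execution are those of [mu], in the same order and with the
same weights, and the state reached at the outcome [a] is described by
[post a]. *)
Fixpoint matched (A : Type) (d : dist (option state)) (mu : dist A)
    (post : A -> config) : Prop :=
  match d, mu with
  | [::], [::] => True
  | (w, Some s) :: d', (w', a) :: mu' =>
      [/\ w = w', At (post a) s & matched d' mu' post]
  | _, _ => False
  end.

(** The list of outcomes is required to be the same for all large recursion bounds,
so that bounds for finitely many continuations can be combined. *)
Definition runs (A : Type) (c : cmd) (x : config) (mu : dist A)
    (post : A -> config) : Prop :=
  forall s, At x s -> exists d K,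
    (forall k, K <= k -> exec k c s = d) /\ matched d mu post.

(** Effect on a configuration of testing a condition, respectively of an assignment. *)
Definition tock x := Config (cregs x) (ctime x + S) (cseen x).

Definition put (r : nat) (v : Defs.val) x :=
  Config (set_nth (Leaf 0) (cregs x) r v) (ctime x + S) (cseen x).

Definition eval_at x e := eval (nth (Leaf 0) (cregs x)) e.

Definition cheap e := esize e ^ 2 < C.

Lemma At_cost x s e : At x s -> cheap e -> (cost (regs s) e).+1 <= S.
Proof.
move=> [rs _ _ _ sB] ce.
have sB' r : vsize (regs s r) <= B by rewrite rs.
apply: leq_ltn_trans (cost_bound B_gt0 sB' e) _.
by rewrite ltn_mul2r B_gt0.
Qed.

Lemma At_tick x s e : At x s -> cheap e ->
  At (tock x) (tick (cost (regs s) e).+1 s).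
Proof.
move=> xs ce; have le := At_cost xs ce; case: xs => rs ts gs fs bs.
by split=> //=; apply: leq_add.
Qed.

Lemma matched_cat A (d1 d2 : dist (option state)) (mu1 mu2 : dist A) post :
  matched d1 mu1 post -> matched d2 mu2 post ->
  matched (d1 ++ d2) (mu1 ++ mu2) post.
Proof.
elim: d1 mu1 => [|[w [s|]] d1 IH] [|[w' a] mu1] //= [-> xs m1] m2.
by split=> //; apply: IH.
Qed.

Lemma matched_scale A (d : dist (option state)) (mu : dist A) post r :
  matched d mu post ->
  matched [seq ((r * wa.1)%R, wa.2) | wa <- d]
          [seq ((r * wa.1)%R, wa.2) | wa <- mu] post.
Proof.
elim: d mu => [|[w [s|]] d IH] [|[w' a] mu] //= [-> xs m1].
by split=> //; apply: IH.
Qed.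

Lemma bind_ret A A' (a : A) (k : A -> dist A') : bind (ret a) k = k a.
Proof.
rewrite /bind /= cats0 -[RHS]map_id; apply: eq_map => -[w b] /=.
by rewrite mul1r.
Qed.

Lemma matched_bind A A' c (d : dist (option state)) (mu : dist A)
    (post : A -> config) (P : pred A) (mu' : A -> dist A') (post' : A' -> config) :
  matched d mu post -> surely mu P ->
  (forall a, P a -> runs c (post a) (mu' a) post') ->
  exists d' K, (forall k, K <= k ->
     bind d (fun o => if o is Some s then exec k c s else ret None) = d')
     /\ matched d' (bind mu mu') post'.
Proof.
move=> + + R; elim: d mu => [|[w [s|]] d IH] [|[w' a] mu] //=.
  by move=> _ _; exists [::], 0.
case=> -> xs dm /andP[/= Pa Pm]; have [d2 [K2 [E2 M2]]] := IH mu dm Pm.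
have [d1 [K1 [E1 M1]]] := R a Pa s xs.
exists ([seq ((w' * wb.1)%R, wb.2) | wb <- d1] ++ d2), (maxn K1 K2); split.
  by move=> k; rewrite geq_max => /andP[k1 k2]; rewrite bind_cons /= E1 ?E2.
by rewrite bind_cons; apply: matched_cat => //; apply: matched_scale.
Qed.

Lemma runs_seq_inv A A' c1 c2 x (mu : dist A) post (P : pred A)
    (mu' : A -> dist A') (post' : A' -> config) :
  runs c1 x mu post -> surely mu P ->
  (forall a, P a -> runs c2 (post a) (mu' a) post') ->
  runs (Seq c1 c2) x (bind mu mu') post'.
Proof.
move=> R1 Pm R2 s xs; have [d1 [K1 [E1 M1]]] := R1 s xs.
have [d [K [E M]]] := matched_bind M1 Pm R2.
exists d, (maxn K1 K).+1; split=> // -[//|k].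
by rewrite ltnS geq_max => /andP[k1 k2] /=; rewrite E1 ?E.
Qed.

Lemma surely_T A (d : dist A) (P : pred A) : (forall a, P a) -> surely d P.
Proof. by move=> h; rewrite /surely; elim: d => //= wa d ->; rewrite h. Qed.

Lemma runs_seq A A' c1 c2 x (mu : dist A) post (mu' : A -> dist A')
    (post' : A' -> config) :
  runs c1 x mu post -> (forall a, runs c2 (post a) (mu' a) post') ->
  runs (Seq c1 c2) x (bind mu mu') post'.
Proof.
by move=> R1 R2; apply: runs_seq_inv R1 (@surely_T _ _ predT _) _.
Qed.

Lemma runs_while_true A A' e c x (mu : dist A) post (P : pred A)
    (mu' : A -> dist A') (post' : A' -> config) :
  cheap e -> vtrue (eval_at x e) ->
  runs c (tock x) mu post -> surely mu P ->
  (forall a, P a -> runs (While e c) (post a) (mu' a) post') ->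
  runs (While e c) x (bind mu mu') post'.
Proof.
move=> ce ve R1 Pm R2 s xs; have [d1 [K1 [E1 M1]]] := R1 _ (At_tick xs ce).
have [d [K [E M]]] := matched_bind M1 Pm R2.
exists d, (maxn K1 K).+1; split=> // -[//|k].
rewrite ltnS geq_max => /andP[k1 k2] /=.
by rewrite (eq_eval e (at_regs xs)) ve E1 ?E.
Qed.

Lemma runs_while_false A e c x (a : A) (post : A -> config) :
  cheap e -> ~~ vtrue (eval_at x e) -> post a = tock x ->
  runs (While e c) x (ret a) post.
Proof.
move=> ce ve pa s xs; exists (ret (Some (tick (cost (regs s) e).+1 s))), 1.
split=> [[//|k] _ /=|/=].
  by rewrite (eq_eval e (at_regs xs)) (negPf ve).
by rewrite pa; split=> //; apply: At_tick.
Qed.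

Lemma runs_assign A r e v x (a : A) (post : A -> config) :
  cheap e -> eval_at x e = v -> vsize v <= B -> post a = put r v x ->
  runs (Assign r e) x (ret a) post.
Proof.
move=> ce ev vB pa s xs.
exists (ret (Some (write r (eval (regs s) e) (tick (cost (regs s) e).+1 s)))), 1.
split=> [[//|k] _ //|]; rewrite /= pa; split=> //; have le := At_cost xs ce.
case: xs => rs ts gs fs bs; split=> //=.
- move=> y; rewrite /upd nth_set_nth /=; case: eqP => // _.
  by rewrite (eq_eval e rs).
- exact: leq_add.
- by move=> y; rewrite nth_set_nth /=; case: eqP.
Qed.

Lemma matched_simulate A (d : dist A) (f : A -> state) (post : A -> config) :
  (forall a, At (post a) (f a)) ->
  matched (bind d (fun a => ret (Some (f a)))) d post.
Proof.
move=> h; elim: d => [//|[w a] d IH]; rewrite bind_cons /= mulr1.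
by split.
Qed.

Lemma runs_simulate r e1 e2 H t x :
  cheap e1 -> cheap e2 -> unvhypergraph (eval_at x e1) = H ->
  vnum (eval_at x e2) = t -> good (H, t) ->
  (forall X : {set 'I_(nverts H)}, vsize (vset X) <= B) ->
  runs (Simulate r e1 e2) x (simulate H t) (fun X =>
    Config (set_nth (Leaf 0) (cregs x) r (vset X)) (ctime x + (t + 3) * S)
           (cseen x || (H == H0))).
Proof.
move=> c1 c2 eH et gH vB s xs.
have le1 := At_cost xs c1; have le2 := At_cost xs c2.
move: gH vB; rewrite -{t}et -{H}eH /eval_at -!(eq_eval _ (at_regs xs)).
set v := eval _ e1; set H := unvhypergraph v; set t := vnum _ => gH vB.
have vS : vsize v <= S.
  by apply: leq_trans (ltnW le1); rewrite /v; case: (e1) => *; apply: leq_addr.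
pose u := record_sim (H, t)
  (tick (cost (regs s) e1 + cost (regs s) e2 + t.+1 * vsize v) s).
exists (bind (simulate H t) (fun X => ret (Some (write r (vset X) u)))), 1.
split=> [[//|k] _ //|]; apply: matched_simulate => X.
case: xs => rs ts gs fs bs; split=> //=.
- by move=> y; rewrite /upd nth_set_nth /=; case: eqP.
- rewrite leq_add // (_ : t + 3 = 1 + 1 + t.+1); last by lia.
  by rewrite !(mulnDl _ _ S) mul1n !leq_add ?(ltnW le1) ?(ltnW le2) ?leq_mul2l ?vS ?orbT.
- by rewrite gH.
- rewrite inE; case: (cseen x) fs => /= [->|_]; first by rewrite orbT.
  by apply/implyP => /eqP->; rewrite eqxx.
- by move=> y; rewrite nth_set_nth /=; case: eqP.
Qed.

(** Distribution of a value carried through [N] rounds of a loop. *)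
Fixpoint chain (A : Type) (nu : nat -> A -> dist A) (i N : nat) (a : A) : dist A :=
  if N is N'.+1 then bind (nu i a) (chain nu i.+1 N') else ret a.

(** Rule for a loop whose number of iterations is known: [x j a] describes the state
before round [j] with carried value [a], and [P j] is an invariant of that
value. *)
Lemma runs_while A e c (nu : nat -> A -> dist A) (x : nat -> A -> config)
    (P : nat -> pred A) i N a :
  cheap e -> P i a ->
  (forall j a, i <= j < i + N -> P j a ->
     [/\ vtrue (eval_at (x j a) e), runs c (tock (x j a)) (nu j a) (x j.+1)
       & surely (nu j a) (P j.+1)]) ->
  (forall a, ~~ vtrue (eval_at (x (i + N) a) e)) ->
  runs (While e c) (x i a) (chain nu i N a) (fun a => tock (x (i + N) a)).
Proof.
move=> ce; elim: N i a => [|N IH] i a Pa step stop.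
  by apply: runs_while_false => //; rewrite addn0 in stop *.
have [|ve R Pm] := step i a _ Pa; first by rewrite leqnn addnS ltnS leq_addr.
apply: runs_while_true R Pm _ => // a' Pa'; rewrite -addSnnS; apply: IH => // [j b|b].
  by rewrite addSnnS => /andP[ij jN]; apply: step; rewrite (ltnW ij).
by rewrite addSnnS; apply: stop.
Qed.

Lemma surely_chain A (nu : nat -> A -> dist A) (P : nat -> pred A) i N a :
  P i a -> (forall j a, P j a -> surely (nu j a) (P j.+1)) ->
  surely (chain nu i N a) (P (i + N)).
Proof.
move=> + step; elim: N i a => [|N IH] i a Pa /=.
  by rewrite addn0 /surely /= Pa.
rewrite surely_bind -addSnnS; move: (step _ _ Pa); rewrite /surely.
by apply: sub_all => wa; apply: IH.
Qed.

Lemma runs_tt_seq A c1 c2 x y (mu : dist A) post :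
  runs c1 x (ret tt) (fun=> y) -> runs c2 y mu post ->
  runs (Seq c1 c2) x mu post.
Proof. by move=> R1 R2; rewrite -(bind_ret tt (fun=> mu)); apply: runs_seq R1 _. Qed.

Lemma runs_assign_seq A r e v c x (mu : dist A) (post : A -> config) :
  cheap e -> eval_at x e = v -> vsize v <= B -> runs c (put r v x) mu post ->
  runs (Seq (Assign r e) c) x mu post.
Proof.
by move=> ce ev vB; apply: runs_tt_seq; apply: runs_assign ev vB _.
Qed.

Lemma chain_tt (nu : nat -> unit -> dist unit) i N :
  (forall j, nu j tt = ret tt) -> chain nu i N tt = ret tt.
Proof. by move=> h; elim: N i => [//|N IH] i /=; rewrite h bind_ret. Qed.

Lemma runs_while_tt e c (x : nat -> config) N :
  cheap e ->
  (forall j, j < N -> vtrue (eval_at (x j) e)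
     /\ runs c (tock (x j)) (ret tt) (fun=> x j.+1)) ->
  ~~ vtrue (eval_at (x N) e) ->
  runs (While e c) (x 0) (ret tt) (fun=> tock (x N)).
Proof.
move=> ce step stop; rewrite -(@chain_tt (fun _ _ => ret tt) 0 N) //.
apply: (@runs_while unit e c (fun _ _ => ret tt) (fun j _ => x j) (fun _ _ => true)) => //.
by move=> j [] /andP[_ jN] _; have [] := step j jN.
Qed.

Lemma At_le x y s : cregs x = cregs y -> ctime x <= ctime y ->
  (cseen y ==> cseen x) -> At x s -> At y s.
Proof.
move=> r t f [rs ts gs fs bs]; split=> //; rewrite -?r //.
- exact: leq_trans t.
- by case: (cseen y) f => // /implyP/(_ isT); case: (cseen x) fs.
Qed.

Lemma runs_le A c x (mu : dist A) (post post' : A -> config) :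
  runs c x mu post ->
  (forall a, [/\ cregs (post a) = cregs (post' a), ctime (post a) <= ctime (post' a)
     & cseen (post' a) ==> cseen (post a)]) ->
  runs c x mu post'.
Proof.
move=> R le s xs; have [d [K [E M]]] := R s xs; exists d, K; split=> //.
elim: d mu M {E R} => [|[w [u|]] d IH] [|[w' a] mu] //= [-> au m].
by split=> //; [have [] := le a => *; apply: At_le au | apply: IH].
Qed.

Lemma runs_assign_le A r e v x (a : A) (post : A -> config) :
  cheap e -> eval_at x e = v -> vsize v <= B ->
  set_nth (Leaf 0) (cregs x) r v = cregs (post a) ->
  ctime x + S <= ctime (post a) -> (cseen (post a) ==> cseen x) ->
  runs (Assign r e) x (ret a) post.
Proof.
move=> ce ev vB pr pt ps.
have R := @runs_assign A r e v x a (fun=> put r v x) ce ev vB erefl.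
move=> s xs; have [d [K [Ed M]]] := R s xs; exists d, K; split=> // {Ed R}.
case: d M => [|[w [u|]] d] //= [-> au dn]; split=> //; last by case: d dn.
exact: At_le au.
Qed.

Lemma matched_surely A (d : dist (option state)) (mu : dist A) post
    (P : option state -> bool) :
  matched d mu post -> (forall a s, At (post a) s -> P (Some s)) -> surely d P.
Proof.
move=> + h; rewrite /surely.
by elim: d mu => [|[w [u|]] d IH] [|[w' a] mu] //= [_ /h -> /IH].
Qed.

Lemma matched_prob A (d : dist (option state)) (mu : dist A) post
    (P : pred (option state)) (Q : pred A) :
  matched d mu post -> (forall a s, At (post a) s -> P (Some s) = Q a) ->
  prob d P = prob mu Q.
Proof.
move=> + h; rewrite /prob; elim: d mu => [|[w [u|]] d IH] [|[w' a] mu] //=.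
  by rewrite !big_nil.
by case=> -> au /IH E; rewrite !big_cons /= (h _ _ au) E.
Qed.

End Runs.

Definition if_halted (E : pred state) (o : option state) : bool :=
  if o is Some s then E s else true.

Lemma eq_surely A (d : dist A) (E F : pred A) : E =1 F -> surely d E = surely d F.
Proof. by move=> EF; apply: eq_all => wa; apply: EF. Qed.

(** The outcomes reached with a small recursion bound are also reached with a larger
one. *)
Lemma exec_mono k c s E :
  surely (exec k.+1 c s) (if_halted E) -> surely (exec k c s) (if_halted E).
Proof.
elim: k c s E => [//|k IH] c s E.
have seq_step c1 c2 s' :
    surely (bind (exec k.+1 c1 s') (fun o => if o is Some s2 then exec k.+1 c2 s2
                                   else ret None)) (if_halted E) ->
    surely (bind (exec k c1 s') (fun o => if o is Some s2 then exec k c2 s2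
                                   else ret None)) (if_halted E).
  rewrite !surely_bind => h.
  pose F s2 := surely (exec k c2 s2) (if_halted E).
  rewrite (@eq_surely _ _ _ (if_halted F)); last by case.
  apply: (IH); move: h; rewrite /surely; apply: sub_all => -[w [s2|]] //=.
  exact: IH.
case: c => [|x e|c1 c2|e c1 c2|e c1|x e1 e2] //.
- exact: seq_step.
- exact: IH.
- set s' := tick (cost (regs s) e).+1 s.
  have E2 j : exec j.+1 (While e c1) s = if vtrue (eval (regs s) e)
      then bind (exec j c1 s') (fun o => if o is Some s2 then exec j (While e c1) s2
                                         else ret None)
      else ret (Some s') by [].
  by rewrite !E2; case: (vtrue _) => //; apply: seq_step.
Qed.

Lemma exec_mono_le k k' c s E : k <= k' ->
  surely (exec k' c s) (if_halted E) -> surely (exec k c s) (if_halted E).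
Proof.
move=> /subnK <-; elim: (k' - k) => [//|j IH]; rewrite addSn => h.
exact/IH/exec_mono.
Qed.

(** * The estimator and its execution *)
Local Notation IO := 0 (only parsing).
Local Notation REST := 1 (only parsing).
Local Notation NVAR := 2 (only parsing).
Local Notation TRIALS := 3 (only parsing).
Local Notation STEPS := 4 (only parsing).
Local Notation NUM := 5 (only parsing).
Local Notation DEN := 6 (only parsing).
Local Notation LEFT := 7 (only parsing).
Local Notation HITS := 8 (only parsing).
Local Notation CITER := 9 (only parsing).
Local Notation SAMPLE := 10 (only parsing).
Local Notation SITER := 11 (only parsing).
Local Notation COMMON := 12 (only parsing).
Local Notation CLAUSE := 13 (only parsing).

(** [COMMON] counts the pairs of equal elements of the clause and of the sample,
which is the size of their intersection. *)
Definition scan_sample : cmd :=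
  While (Var SITER)
    (Seq (Assign COMMON (Op Add (Var COMMON)
                                (Op Eqn (Fst (Var CITER)) (Fst (Var SITER)))))
         (Assign SITER (Snd (Var SITER)))).

Definition count_common : cmd :=
  While (Var CITER)
    (Seq (Assign SITER (Var SAMPLE))
    (Seq scan_sample
         (Assign CITER (Snd (Var CITER))))).

(** A sample hits when it does not contain the clause, that is, when it meets it in
fewer than [m] vertices.  Scratch registers are cleared, so that each round
starts from the same configuration. *)
Definition trial (m : nat) : cmd :=
  Seq (Assign LEFT (Op Defs.Sub (Var LEFT) (Lit 1)))
  (Seq (Simulate SAMPLE (Pair (Fst (Fst (Var IO))) (Var REST)) (Var STEPS))
  (Seq (Assign CITER (Var CLAUSE))
  (Seq count_common
  (Seq (Assign HITS (Op Add (Var HITS)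
                            (Op Defs.Sub (Lit 1) (Op Eqn (Var COMMON) (Lit m)))))
  (Seq (Assign COMMON (Lit 0))
       (Assign SAMPLE (Lit 0))))))).

(** The clause at the head of [REST] is tested against samples of the chain of the
clauses after it. *)
Definition clause_round (m : nat) : cmd :=
  Seq (Assign CLAUSE (Fst (Var REST)))
  (Seq (Assign REST (Snd (Var REST)))
  (Seq (Assign LEFT (Var TRIALS))
  (Seq (While (Var LEFT) (trial m))
  (Seq (Assign NUM (Op Mul (Var NUM) (Var HITS)))
  (Seq (Assign DEN (Op Mul (Var DEN) (Var TRIALS)))
  (Seq (Assign CLAUSE (Lit 0))
       (Assign HITS (Lit 0)))))))).

Definition count_vars : cmd :=
  While (Var REST)
    (Seq (Assign NVAR (Op Add (Var NVAR) (Lit 1)))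
    (Seq (Assign NUM (Op Add (Var NUM) (Var NUM)))
         (Assign REST (Snd (Var REST))))).

(** The first simulation is that of the input hypergraph; its sample is
discarded. *)
Definition estimator (m D k : nat) : cmd :=
  Seq (Assign REST (Fst (Fst (Var IO))))
  (Seq (Assign NUM (Lit 1))
  (Seq count_vars
  (Seq (Assign TRIALS (Op Mul (Op Mul (Lit 128) (Op Add (Op Mul (Lit D) (Var NVAR)) (Lit 1)))
                              (Op Mul (Snd (Var IO)) (Snd (Var IO)))))
  (Seq (Assign STEPS (Op Mul (Op Mul (Lit k) (Var NVAR))
                             (Op Add (Var NVAR) (Op Mul (Lit 2) (Var TRIALS)))))
  (Seq (Assign DEN (Lit 1))
  (Seq (Assign REST (Snd (Fst (Var IO))))
  (Seq (Simulate SAMPLE (Fst (Var IO)) (Var STEPS))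
  (Seq (Assign SAMPLE (Lit 0))
  (Seq (While (Var REST) (clause_round m))
       (Assign IO (Pair (Var NUM) (Var DEN)))))))))))).

Definition nlist (s : seq nat) : Defs.val := vlist [seq Leaf i | i <- s].

Lemma vset_nlist n (X : {set 'I_n}) : vset X = nlist [seq nat_of_ord i | i <- enum X].
Proof. by rewrite /vset /nlist -map_comp. Qed.

Lemma vsize_vlist (s : seq Defs.val) : vsize (vlist s) = (\sum_(v <- s) (vsize v).+1).+1.
Proof.
elim: s => [|v s IH] /=; first by rewrite big_nil trunc_log0.
by rewrite IH big_cons addnS addSn.
Qed.

Lemma vsize_drop j s : vsize (vlist (drop j s)) <= vsize (vlist s).
Proof.
rewrite -{2}(cat_take_drop j s) !vsize_vlist ltnS big_cat /=.
exact: leq_addl.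
Qed.

Lemma size_le_vsize s : size s <= vsize (vlist s).
Proof.
rewrite vsize_vlist; apply: leqW; rewrite -sum1_size; apply: leq_sum => v _.
by [].
Qed.

Lemma vsize_vset n (X : {set 'I_n}) : vsize (vset X) <= vsize (nlist (iota 0 n)).
Proof.
rewrite vset_nlist /nlist !vsize_vlist ltnS !big_map big_enum /=.
have -> : \sum_(i <- iota 0 n) (vsize (Leaf i)).+1 = \sum_(i < n) (vsize (Leaf i)).+1.
  by rewrite -(big_mkord predT (fun i => (vsize (Leaf i)).+1)) /index_iota subn0.
by rewrite [leqRHS](bigID (fun i => i \in X)) /= leq_addr.
Qed.

Lemma vsize_leaf_le n B : n < B -> vsize (Leaf n) <= B.
Proof.
move=> nB; rewrite vsize_leaf; last exact: leq_ltn_trans nB.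
by apply: (ltn_trans nB); apply: ltn_expl.
Qed.

Lemma vtrue_nlist_drop j s : vtrue (nlist (drop j s)) = (j < size s).
Proof.
rewrite /nlist; have := size_drop j s; case: (drop j s) => /= [|x t].
  by move/eqP; rewrite eq_sym subn_eq0 leqNgt => /negPf.
by move=> h; rewrite -subn_gt0 -h.
Qed.

Lemma sum_count_common n (c X : {set 'I_n}) :
  \sum_(x <- [seq nat_of_ord i | i <- enum c])
     count_mem x [seq nat_of_ord i | i <- enum X] = #|c :&: X|.
Proof.
rewrite big_map big_enum /= -sum1_card.
rewrite (eq_bigl (fun i => (i \in c) && (i \in X))) => [|i]; last by rewrite inE.
rewrite big_mkcondr /=; apply: eq_bigr => i _.
rewrite count_map (eq_count (a2 := pred1 i)) => [|j]; last by rewrite /= (inj_eq val_inj).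
by rewrite count_uniq_mem ?enum_uniq // mem_enum; case: (i \in X).
Qed.

(** Hypergraph whose edges are the listed clauses. *)
Definition hyp n (cl : seq {set 'I_n}) : hypergraph :=
  @Hypergraph n [set c in cl].

Definition clist n (cl : seq {set 'I_n}) : Defs.val := vlist [seq vset c | c <- cl].

Lemma unvlistK s : unvlist (vlist s) = s.
Proof. by elim: s => //= v s ->. Qed.

(** The number of vertices is read off the list of variables, which makes the two
types of vertices equal only after a rewriting step. *)
Lemma unvhypergraph_clist n (cl : seq {set 'I_n}) :
  unvhypergraph (Cell (nlist (iota 0 n)) (clist cl)) = hyp cl.
Proof.
rewrite /unvhypergraph /= !unvlistK.
have : size [seq Leaf i | i <- iota 0 n] = n by rewrite size_map size_iota.
move: (size _) => n' E; rewrite {}E /hyp; congr Hypergraph; apply/setP => e.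
rewrite !inE -map_comp (eq_map (g := id)) ?map_id // => c /=; apply/setP => i.
rewrite inE unvlistK -map_comp mem_map; last exact: val_inj.
by rewrite mem_enum.
Qed.

Definition hit_dist n t (rest : seq {set 'I_n}) (c : {set 'I_n}) h : dist nat :=
  bind (simulate (hyp rest) t) (fun X => ret (h + ~~ (c \subset X))).

Definition hits_dist n t w (rest : seq {set 'I_n}) (c : {set 'I_n}) : dist nat :=
  chain (fun=> hit_dist t rest c) 0 w 0.

(** Distribution of the final numerator; the denominator is not random. *)
Fixpoint estimate n t w (cl : seq {set 'I_n}) num : dist nat :=
  if cl is c :: rest
  then bind (hits_dist t w rest c) (fun h => estimate t w rest (num * h))
  else ret num.

Section Execution.
Variables (m D k : nat).
Let K := vsize (Leaf m) + vsize (Leaf D) + vsize (Leaf k) + vsize (Leaf 2) + vsize (Leaf 128) + 100.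
Let C := K ^ 2.
Variables (B : nat) (good : pred (hypergraph * nat)) (H0 : hypergraph).
Hypothesis B_gt0 : 0 < B.
Local Notation S := (C * B).
Local Notation runs := (runs B good H0).

Lemma cheapP e : esize e < K -> cheap C e.
Proof. by move=> h; rewrite /cheap ltn_exp2r. Qed.

(* The size of a literal is a logarithm that the arithmetic solver sees as an atom. *)
Ltac is_cheap := apply: cheapP; rewrite /K /= ?trunc_log0 ?trunc_log1; lia.

Definition regfile io rest n w t num den left hits ci sa si cm cl : seq Defs.val :=
  [:: io; rest; Leaf n; Leaf w; Leaf t; Leaf num; Leaf den; Leaf left; Leaf hits;
      ci; sa; si; Leaf cm; cl].

Lemma run_scan io rest n w t num den left hits x ci sa ys q cl tau b :
  vsize (nlist ys) <= B -> q + size ys < B ->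
  runs scan_sample
    (Config (regfile io rest n w t num den left hits (Cell (Leaf x) ci) sa (nlist ys) q cl)
            tau b)
    (ret tt)
    (fun=> Config (regfile io rest n w t num den left hits (Cell (Leaf x) ci) sa (Leaf 0)
                           (q + count_mem x ys) cl)
                  (tau + (3 * size ys + 1) * S) b).
Proof.
move=> yB qB.
pose st j := Config (regfile io rest n w t num den left hits (Cell (Leaf x) ci) sa
  (nlist (drop j ys)) (q + count_mem x (take j ys)) cl) (tau + j * (3 * S)) b.
have -> : Config (regfile io rest n w t num den left hits (Cell (Leaf x) ci) sa (nlist ys) q cl)
            tau b = st 0.
  by rewrite /st drop0 take0 /= addn0 mul0n addn0.
have := @runs_while_tt B C B_gt0 good H0 (Var SITER)
  (Seq (Assign COMMON (Op Add (Var COMMON)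
                                (Op Eqn (Fst (Var CITER)) (Fst (Var SITER)))))
         (Assign SITER (Snd (Var SITER)))) st (size ys).
move=> R.
have E : tock B C (st (size ys)) = Config (regfile io rest n w t num den left hits (Cell (Leaf x) ci) sa (Leaf 0)
                           (q + count_mem x ys) cl)
                  (tau + (3 * size ys + 1) * S) b.
  rewrite /tock /st drop_size take_size /=; congr Config; lia.
rewrite -E; apply: R; first by is_cheap.
  move=> j jys; split; first by rewrite /eval_at /= vtrue_nlist_drop.
  apply: (@runs_assign_seq B C B_gt0 good H0 unit _ _
     (Leaf (q + count_mem x (take j.+1 ys)))).
  - by is_cheap.
  - rewrite /eval_at /= (drop_nth 0 jys) /= (take_nth 0 jys) -cats1 count_cat /=.
    by rewrite addn0 addnA [x == _]eq_sym.
  - apply: vsize_leaf_le; apply: leq_ltn_trans qB; rewrite leq_add2l.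
    by apply: leq_trans (count_size _ _) _; rewrite size_take_min geq_minr.
  apply: (@runs_assign B C B_gt0 good H0 unit _ _ (nlist (drop j.+1 ys))).
  - by is_cheap.
  - by rewrite /eval_at /= (drop_nth 0 jys).
  - by apply: leq_trans yB; rewrite /nlist map_drop vsize_drop.
  - by rewrite /put /tock /st /=; congr Config; lia.
by rewrite /eval_at /= vtrue_nlist_drop ltnn.
Qed.

Let assign_seq A := @runs_assign_seq B C B_gt0 good H0 A.
Let assign A := @runs_assign B C B_gt0 good H0 A.
Let assign_le A := @runs_assign_le B C B_gt0 good H0 A.

Lemma run_count io rest n w t num den left hits xs ys cl tau b y :
  vsize (nlist ys) <= B -> vsize (nlist xs) <= B -> size ys <= y ->
  (size xs).+1 * y < B ->
  runs count_common
    (Config (regfile io rest n w t num den left hits (nlist xs) (nlist ys) (Leaf 0) 0 cl)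
            tau b)
    (ret tt)
    (fun=> Config (regfile io rest n w t num den left hits (Leaf 0) (nlist ys) (Leaf 0)
                           (\sum_(x <- xs) count_mem x ys) cl)
                  (tau + (size xs * (3 * y + 4) + 1) * S) b).
Proof.
move=> yB xB yy qB.
have cb j : \sum_(x <- take j xs) count_mem x ys <= size xs * y.
  apply: (@leq_trans (\sum_(x <- take j xs) y)).
    by apply: leq_sum => x _; apply: leq_trans yy; apply: count_size.
  by rewrite big_const_seq iter_addn_0 count_predT mulnC leq_mul2r size_take_min geq_minr orbT.
pose st j := Config (regfile io rest n w t num den left hits (nlist (drop j xs)) (nlist ys)
  (Leaf 0) (\sum_(x <- take j xs) count_mem x ys) cl) (tau + j * ((3 * y + 4) * S)) b.
have -> : Config (regfile io rest n w t num den left hits (nlist xs) (nlist ys) (Leaf 0) 0 cl)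
            tau b = st 0.
  by rewrite /st drop0 take0 big_nil mul0n addn0.
have E : tock B C (st (size xs)) = Config (regfile io rest n w t num den left hits (Leaf 0)
    (nlist ys) (Leaf 0) (\sum_(x <- xs) count_mem x ys) cl)
                  (tau + (size xs * (3 * y + 4) + 1) * S) b.
  by rewrite /tock /st drop_size take_size /=; congr Config; lia.
rewrite -E; apply: (@runs_while_tt B C B_gt0 good H0 _ _ st (size xs)).
- by is_cheap.
- move=> j jxs; split; first by rewrite /eval_at /= vtrue_nlist_drop.
  have cons_drop : nlist (drop j xs) = Cell (Leaf (nth 0 xs j)) (nlist (drop j.+1 xs)).
    by rewrite (drop_nth 0 jxs).
  apply: (assign_seq (v := nlist ys)) => //; first by is_cheap.
  apply: (runs_tt_seq (y := Config (regfile io rest n w t num den left hits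
     (nlist (drop j xs)) (nlist ys) (Leaf 0) (\sum_(x <- take j.+1 xs) count_mem x ys) cl)
     (tau + j * ((3 * y + 4) * S) + S + S + (3 * y + 1) * S) b)).
    rewrite /st (take_nth 0 jxs) -cats1 big_cat big_seq1 cons_drop /put /tock /=.
    apply: runs_le; first apply: run_scan => //.
      by apply: leq_ltn_trans qB; rewrite mulSn addnC leq_add.
    move=> []; split=> //=; last by case: (b).
    by rewrite leq_add2l leq_mul2r leq_add2r leq_mul2l yy !orbT.
  apply: (assign (v := nlist (drop j.+1 xs))) => //; first by is_cheap.
  - by rewrite /eval_at /regfile cons_drop.
  - by apply: leq_trans xB; rewrite /nlist map_drop vsize_drop.
  - by rewrite /put /st /=; congr Config; lia.
- by rewrite /eval_at /= vtrue_nlist_drop ltnn.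
Qed.

Variable n : nat.
Hypothesis vars_small : vsize (nlist (iota 0 n)) <= B.
Variables (fm : Defs.val) (E : nat).
Let io := Cell (Cell (nlist (iota 0 n)) fm) (Leaf E).

Definition trial_steps t := t + m * (3 * n + 4) + 9.

Lemma run_trial rest w t num den left hits (c : {set 'I_n}) tau b :
  #|c| = m -> good (hyp rest, t) -> left < B -> hits.+1 < B -> m.+1 * n < B ->
  vsize (Cell (nlist (iota 0 n)) (clist rest)) <= B ->
  runs (trial m)
    (Config (regfile io (clist rest) n w t num den left.+1 hits
               (Leaf 0) (Leaf 0) (Leaf 0) 0 (vset c)) tau b)
    (hit_dist t rest c hits)
    (fun h => Config (regfile io (clist rest) n w t num den left h
               (Leaf 0) (Leaf 0) (Leaf 0) 0 (vset c)) (tau + trial_steps t * S) b).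
Proof.
move=> cm gd lB hB mnB HB.
have B1 : 0 < B by [].
apply: (assign_seq (v := Leaf left)); first by is_cheap.
- by rewrite /eval_at /= subn1.
- exact: vsize_leaf_le.
rewrite /put /=; apply: runs_seq.
  apply: (@runs_simulate B C B_gt0 good H0 _ _ _ (hyp rest) t) => //.
  - by is_cheap.
  - by is_cheap.
  - exact: unvhypergraph_clist.
  - by move=> X; apply: leq_trans (vsize_vset X) _.
move=> X /=.
have cX : size [seq nat_of_ord i | i <- enum X] <= n.
  by rewrite size_map -cardE -[leqRHS]card_ord max_card.
apply: (assign_seq (v := vset c)) => //; first by is_cheap.
  exact: leq_trans (vsize_vset c) _.
rewrite /put /= !vset_nlist; apply: runs_tt_seq.
  apply: (run_count (y := n)) => //.
  - by rewrite -vset_nlist; apply: leq_trans (vsize_vset X) _.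
  - by rewrite -vset_nlist; apply: leq_trans (vsize_vset c) _.
  - by rewrite size_map -cardE cm.
rewrite sum_count_common size_map -cardE cm.
apply: (assign_seq (v := Leaf (hits + ~~ (c \subset X)))); first by is_cheap.
- rewrite /eval_at /=; congr (Leaf (_ + _)).
  have -> : (#|c :&: X| == m) = (c \subset X).
    by rewrite -cm (sameP setIidPl eqP) eqEcard subsetIl /= eqn_leq subset_leq_card ?subsetIl.
  by case: (c \subset X).
- by apply: vsize_leaf_le; apply: leq_ltn_trans hB; rewrite -addn1 leq_add2l leq_b1.
rewrite /put /=; apply: (assign_seq (v := Leaf 0)) => //; first by is_cheap.
rewrite /put /=.
apply: (assign_le (v := Leaf 0)) => //=; first by is_cheap.
- by rewrite /trial_steps; lia.
- by case: (b).
Qed.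

Lemma surely_ret (A : Type) (a : A) (P : pred A) : P a -> surely (ret a) P.
Proof. by rewrite /surely /= => ->. Qed.

Lemma surely_hit t rest (c : {set 'I_n}) j h :
  h <= j -> surely (hit_dist t rest c h) (fun h' => h' <= j.+1).
Proof.
move=> hj; rewrite /hit_dist surely_bind; apply: surely_T => X.
by apply: surely_ret; rewrite -addn1 leq_add // leq_b1.
Qed.

Lemma surely_hits t w rest (c : {set 'I_n}) :
  surely (hits_dist t w rest c) (fun h => h <= w).
Proof.
apply: (@surely_chain _ _ (fun j h => h <= j) 0) => // j h.
exact: surely_hit.
Qed.

Lemma run_trials rest w t num den (c : {set 'I_n}) tau b :
  #|c| = m -> good (hyp rest, t) -> w.+1 < B -> m.+1 * n < B ->
  vsize (Cell (nlist (iota 0 n)) (clist rest)) <= B ->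
  runs (While (Var LEFT) (trial m))
    (Config (regfile io (clist rest) n w t num den w 0
               (Leaf 0) (Leaf 0) (Leaf 0) 0 (vset c)) tau b)
    (hits_dist t w rest c)
    (fun h => Config (regfile io (clist rest) n w t num den 0 h
               (Leaf 0) (Leaf 0) (Leaf 0) 0 (vset c))
               (tau + (w * (trial_steps t).+1 + 1) * S) b).
Proof.
move=> cm gd wB mnB HB.
pose st j h := Config (regfile io (clist rest) n w t num den (w - j) h
               (Leaf 0) (Leaf 0) (Leaf 0) 0 (vset c))
               (tau + j * ((trial_steps t).+1 * S)) b.
have -> : Config (regfile io (clist rest) n w t num den w 0
               (Leaf 0) (Leaf 0) (Leaf 0) 0 (vset c)) tau b = st 0 0.
  by rewrite /st subn0 mul0n addn0.
apply: runs_le.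
  apply: (@runs_while B C B_gt0 good H0 nat _ _ (fun=> hit_dist t rest c) st
     (fun j h => h <= j)) => //; first by is_cheap.
    move=> j h /andP[_ jw] hj; rewrite add0n in jw.
    have E1 : w - j = (w - j.+1).+1 by rewrite -subSn.
    split; last exact: surely_hit.
      by rewrite /eval_at /= E1.
    rewrite /tock /st /= E1; apply: runs_le; first apply: run_trial => //.
    - by apply: leq_ltn_trans (leq_subr _ _) _; apply: ltnW.
    - by apply: leq_ltn_trans wB; rewrite ltnS (leq_trans hj) // ltnW.
    move=> h'; split=> //=; last by case: (b).
    by rewrite (mulSn j) (mulSn (trial_steps t)) -!addnA leq_add2l addnC !addnA.
  by move=> h; rewrite /eval_at /= add0n subnn.
move=> h; split=> //=; first by rewrite add0n subnn.
- by rewrite add0n mulnDl mulnA mul1n addnA.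
- by case: (b).
Qed.

Lemma run_rounds w t (cl : seq {set 'I_n}) num den tau b :
  (forall c, c \in cl -> #|c| = m) ->
  (forall c rest, suffix (c :: rest) cl -> good (hyp rest, t)) ->
  0 < w -> w.+1 < B -> m.+1 * n < B ->
  vsize (Cell (nlist (iota 0 n)) (clist cl)) <= B ->
  num * w ^ size cl < 2 ^ B -> den * w ^ size cl < 2 ^ B ->
  runs (While (Var REST) (clause_round m))
    (Config (regfile io (clist cl) n w t num den 0 0
               (Leaf 0) (Leaf 0) (Leaf 0) 0 (Leaf 0)) tau b)
    (estimate t w cl num)
    (fun z => Config (regfile io (Leaf 0) n w t z (den * w ^ size cl) 0 0
               (Leaf 0) (Leaf 0) (Leaf 0) 0 (Leaf 0))
               (tau + (size cl * (w * (trial_steps t).+1 + 9) + 1) * S) b).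
Proof.
move=> clm gd w0 wB mnB; elim: cl num den tau clm gd => [|c cl IH] num den tau clm gd HB numB denB /=.
  apply: runs_while_false => //; first by is_cheap.
  by rewrite muln1 mul0n add0n mul1n.
have HB' : vsize (Cell (nlist (iota 0 n)) (clist cl)) <= B.
  by apply: leq_trans HB; rewrite /= !ltnS leq_add2l; apply: leqW; apply: leq_addl.
have wcl : 0 < w ^ size cl by rewrite expn_gt0 w0.
have gdc : good (hyp cl, t) by apply: (gd c); apply: suffix_refl.
have cmc : #|c| = m by apply: clm; rewrite inE eqxx.
have vcB : vsize (vset c) <= B by apply: leq_trans (vsize_vset c) _.
rewrite /= in numB denB.
apply: runs_le.
  apply: (@runs_while_true B C B_gt0 good H0 nat nat _ _ _
     (hits_dist t w cl c) (fun h => Config (regfile io (clist cl) n w t (num * h) (den * w) 0 0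
               (Leaf 0) (Leaf 0) (Leaf 0) 0 (Leaf 0))
               (tau + (w * (trial_steps t).+1 + 9) * S) b) (fun h => h <= w)
     _ (fun z => Config (regfile io (Leaf 0) n w t z (den * w * w ^ size cl) 0 0
               (Leaf 0) (Leaf 0) (Leaf 0) 0 (Leaf 0))
               (tau + (w * (trial_steps t).+1 + 9) * S
                 + (size cl * (w * (trial_steps t).+1 + 9) + 1) * S) b)).
  - by is_cheap.
  - by [].
  - apply: (assign_seq (v := vset c)) => //; first by is_cheap.
    apply: (assign_seq (v := clist cl)) => //; first by is_cheap.
      by apply: leq_trans HB'; rewrite /= leqW // leq_addl.
    apply: (assign_seq (v := Leaf w)) => //; first by is_cheap.
      exact/vsize_leaf_le/ltnW.
    rewrite /put /= -(bind_ret_r (hits_dist t w cl c)).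
    apply: runs_seq_inv; first exact: run_trials.
      exact: surely_hits.
    move=> h hw.
    have nhB : num * h < 2 ^ B.
      apply: leq_ltn_trans numB; rewrite leq_mul2l expnS.
      by rewrite (leq_trans hw) ?orbT // leq_pmulr.
    apply: (assign_seq (v := Leaf (num * h))) => //; first by is_cheap.
      by rewrite vsize_leaf.
    apply: (assign_seq (v := Leaf (den * w))) => //; first by is_cheap.
      rewrite vsize_leaf //; apply: leq_ltn_trans denB.
      by rewrite leq_mul2l expnS leq_pmulr ?orbT.
    rewrite /put /=; apply: (assign_seq (v := Leaf 0)) => //; first by is_cheap.
    apply: (assign_le (v := Leaf 0)) => //=; first by is_cheap.
    + by lia.
    + by case: (b).
  - exact: surely_hits.
  - move=> h hw; apply: IH => //.
    + by move=> c' c'cl; apply: clm; rewrite inE c'cl orbT.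
    + move=> c' rest sf; apply: (gd c'); apply: suffix_trans sf _.
      exact: suffix_suffix [:: c] cl.
    + apply: leq_ltn_trans numB; rewrite expnS mulnA leq_mul2r leq_mul2l hw.
      by rewrite !orbT.
    + by apply: leq_ltn_trans denB; rewrite expnS mulnA.
move=> z; split=> //=; first by rewrite expnS mulnA.
- by rewrite mulSn; move: (w * _ + 9) => u; lia.
- by case: (b).
Qed.

Lemma surely_estimate t w (cl : seq {set 'I_n}) num :
  surely (estimate t w cl num) (fun z => z <= num * w ^ size cl).
Proof.
elim: cl num => [|c cl IH] num /=; first by rewrite /surely /= expn0 muln1 leqnn.
rewrite surely_bind; have := surely_hits t w cl c; rewrite /surely.
apply: sub_all => -[q h] /= hw; have := IH (num * h); rewrite /surely.
apply: sub_all => -[q' z] /= /leq_trans; apply.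
by rewrite expnS mulnA leq_mul2r leq_mul2l hw !orbT.
Qed.

Lemma run_count_vars tau b : n < B ->
  runs count_vars
    (Config (regfile io (nlist (iota 0 n)) 0 0 0 1 0 0 0
               (Leaf 0) (Leaf 0) (Leaf 0) 0 (Leaf 0)) tau b)
    (ret tt)
    (fun=> Config (regfile io (Leaf 0) n 0 0 (2 ^ n) 0 0 0
               (Leaf 0) (Leaf 0) (Leaf 0) 0 (Leaf 0)) (tau + (4 * n + 1) * S) b).
Proof.
move=> nB.
pose st j := Config (regfile io (nlist (drop j (iota 0 n))) j 0 0 (2 ^ j) 0 0 0
               (Leaf 0) (Leaf 0) (Leaf 0) 0 (Leaf 0)) (tau + j * (4 * S)) b.
have -> : Config (regfile io (nlist (iota 0 n)) 0 0 0 1 0 0 0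
               (Leaf 0) (Leaf 0) (Leaf 0) 0 (Leaf 0)) tau b = st 0.
  by rewrite /st drop0 mul0n addn0.
have -> : Config (regfile io (Leaf 0) n 0 0 (2 ^ n) 0 0 0
     (Leaf 0) (Leaf 0) (Leaf 0) 0 (Leaf 0)) (tau + (4 * n + 1) * S) b = tock B C (st n).
  rewrite /tock /st drop_oversize ?size_iota //=; congr Config; lia.
apply: (@runs_while_tt B C B_gt0 good H0 _ _ st n); first by is_cheap.
  move=> j jn; rewrite -{1}(size_iota 0 n) in jn.
  split; first by rewrite /eval_at /= vtrue_nlist_drop.
  have jn' : j < n by rewrite -(size_iota 0 n).
  apply: (assign_seq (v := Leaf j.+1)); first by is_cheap.
  - by rewrite /eval_at /= addn1.
  - by apply: vsize_leaf_le; apply: leq_ltn_trans nB.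
  apply: (assign_seq (v := Leaf (2 ^ j.+1))); first by is_cheap.
  - by rewrite /eval_at /= addnn -mul2n -expnS.
  - by rewrite vsize_leaf // ltn_exp2l // (leq_ltn_trans _ nB).
  apply: (assign (v := nlist (drop j.+1 (iota 0 n)))); first by is_cheap.
  - by rewrite /eval_at /= (drop_nth 0 jn).
  - by apply: leq_trans vars_small; rewrite /nlist map_drop vsize_drop.
  - by rewrite /put /tock /st /=; congr Config; lia.
by rewrite /eval_at /= vtrue_nlist_drop size_iota ltnn.
Qed.

(** By double counting there are at most [D * n / m] clauses, so [trials_of] is at
least [160] times the number of clauses times the squared precision, as
[estimate_accurate] requires. *)
Definition trials_of := 128 * (D * n + 1) * (E * E).
Definition steps_of := k * n * (n + 2 * trials_of).

Definition time_of r :=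
  4 * n + steps_of + r * (trials_of * (trial_steps steps_of).+1 + 9) + 20.

Lemma run_estimator (cl : seq {set 'I_n}) B' b :
  fm = clist cl -> H0 = hyp cl -> 0 < E -> vsize io <= B ->
  (forall c, c \in cl -> #|c| = m) ->
  (forall rest, suffix rest cl -> good (hyp rest, steps_of)) ->
  trials_of.+1 < B -> steps_of < B -> m.+1 * n < B -> n < B ->
  2 ^ n * trials_of ^ size cl < 2 ^ B' -> 2 * B' + 1 <= B -> 0 < B' ->
  runs (estimator m D k)
    (Config (regfile io (Leaf 0) 0 0 0 0 0 0 0
               (Leaf 0) (Leaf 0) (Leaf 0) 0 (Leaf 0)) 0 b)
    (bind (simulate (hyp cl) steps_of)
          (fun=> estimate steps_of trials_of cl (2 ^ n)))
    (fun z => Config (regfile (Cell (Leaf z) (Leaf (trials_of ^ size cl)))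
               (Leaf 0) n trials_of steps_of z (trials_of ^ size cl) 0 0
               (Leaf 0) (Leaf 0) (Leaf 0) 0 (Leaf 0)) (time_of (size cl) * S) true).
Proof.
move=> Efm EH E0 ioB clm gd wB tB mnB nB zB' BB' B'0.
have w0 : 0 < trials_of by rewrite /trials_of !muln_gt0 E0 addn1.
have B1 : 1 < B by apply: leq_ltn_trans wB.
have le2 : 2 ^ B' <= 2 ^ B by rewrite leq_exp2l //; apply: leq_trans BB'; lia.
have clB : vsize (clist cl) <= B.
  by apply: leq_trans ioB; rewrite -Efm /= -addnS -addSn addnC addnA leq_addl.
have FB : vsize (Cell (nlist (iota 0 n)) (clist cl)) <= B.
  by apply: leq_trans ioB; rewrite -Efm /= leqW // leq_addr.
have denB : trials_of ^ size cl < 2 ^ B'.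
  by apply: leq_ltn_trans zB'; rewrite leq_pmull // expn_gt0.
apply: (assign_seq (v := nlist (iota 0 n))) => //; first by is_cheap.
apply: (assign_seq (v := Leaf 1)) => //; first by is_cheap.
rewrite /put /=; apply: runs_tt_seq; first exact: run_count_vars.
apply: (assign_seq (v := Leaf trials_of)); first by is_cheap.
- by [].
- exact/vsize_leaf_le/ltnW.
apply: (assign_seq (v := Leaf steps_of)); first by is_cheap.
- by [].
- exact: vsize_leaf_le.
apply: (assign_seq (v := Leaf 1)) => //; first by is_cheap.
apply: (assign_seq (v := clist cl)) => //; first by is_cheap.
rewrite /put /=; apply: runs_seq.
  apply: (@runs_simulate B C B_gt0 good H0 _ _ _ (hyp cl) steps_of) => //.
  - by is_cheap.
  - by is_cheap.
  - by rewrite /eval_at /= Efm unvhypergraph_clist.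
  - by apply: gd; apply: suffix_refl.
  - by move=> X; apply: leq_trans (vsize_vset X) _.
move=> X /=; have -> : hyp cl == H0 by rewrite EH.
rewrite orbT.
apply: (assign_seq (v := Leaf 0)) => //; first by is_cheap.
rewrite /put /= -(bind_ret_r (estimate _ _ _ _)).
apply: runs_seq_inv; first apply: run_rounds => //.
- by move=> c rest sf; apply: gd; apply: suffix_trans sf; apply: (suffix_suffix [:: c] rest).
- exact: leq_trans zB' le2.
- by rewrite mul1n; apply: leq_trans denB le2.
- exact: surely_estimate.
move=> z zw; apply: (assign_le (v := Cell (Leaf z) (Leaf (trials_of ^ size cl)))).
- by is_cheap.
- by rewrite /eval_at /= mul1n.
- apply: leq_trans BB'; rewrite -[vsize _]/((vsize (Leaf z) + vsize (Leaf (trials_of ^ size cl))).+1).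
  by rewrite addn1 ltnS mul2n -addnn leq_add // vsize_leaf // (leq_ltn_trans zw).
- by rewrite /= mul1n.
- rewrite /= /time_of; move: (size cl * _) (C * B) => u s; clear.
  by rewrite !mulnDl; lia.
- by [].
Qed.

End Execution.

Local Open Scope ring_scope.

(** * Moments of the estimate *)
Definition expect A (d : dist A) (f : A -> rat) : rat := \sum_(wa <- d) wa.1 * f wa.2.

Definition nonneg A (d : dist A) : bool := all (fun wa : rat * A => 0 <= wa.1) d.

Lemma expect_ret A (a : A) f : expect (ret a) f = f a.
Proof. by rewrite /expect big_seq1 mul1r. Qed.

Lemma expect_bind A A' (d : dist A) (k : A -> dist A') f :
  expect (bind d k) f = expect d (fun a => expect (k a) f).
Proof.
rewrite /expect; elim: d => [|[w a] d IH]; first by rewrite !big_nil.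
rewrite bind_cons big_cat IH big_cons; congr (_ + _).
by rewrite big_map mulr_sumr; apply: eq_bigr => wb _; rewrite mulrA.
Qed.

Lemma eq_expect A (d : dist A) f g : f =1 g -> expect d f = expect d g.
Proof. by move=> fg; apply: eq_bigr => wa _; rewrite fg. Qed.

Lemma expectD A (d : dist A) f g :
  expect d (fun a => f a + g a) = expect d f + expect d g.
Proof. by rewrite /expect -big_split; apply: eq_bigr => wa _; rewrite mulrDr. Qed.

Lemma expectZ A (d : dist A) x f : expect d (fun a => x * f a) = x * expect d f.
Proof. by rewrite /expect mulr_sumr; apply: eq_bigr => wa _; rewrite mulrCA. Qed.

Lemma expect_le A (d : dist A) f g : nonneg d -> (forall a, f a <= g a) ->
  expect d f <= expect d g.
Proof.
move=> + fg; rewrite /expect; elim: d => [|[w a] d IH]; first by rewrite !big_nil.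
by move=> /andP[w0 d0]; rewrite !big_cons lerD ?IH // ler_wpM2l.
Qed.

Lemma prob_expect A (d : dist A) (E : pred A) :
  prob d E = expect d (fun a => (E a)%:R).
Proof.
rewrite /prob big_mkcond; apply: eq_bigr => wa _.
by case: (E _); rewrite ?mulr1 ?mulr0.
Qed.

Lemma nonneg_bind A A' (d : dist A) (k : A -> dist A') :
  nonneg d -> (forall a, nonneg (k a)) -> nonneg (bind d k).
Proof.
move=> + kn; elim: d => [//|[w a] d IH] /andP[/= w0 d0].
rewrite bind_cons /nonneg all_cat; apply/andP; split; last exact: IH.
by rewrite all_map; apply: sub_all (kn a) => wb wb0; apply: mulr_ge0.
Qed.

Lemma nonneg_chain A (nu : nat -> A -> dist A) i N a :
  (forall j b, nonneg (nu j b)) -> nonneg (chain nu i N a).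
Proof.
by move=> h; elim: N i a => [//|N IH] i a; apply: nonneg_bind => // b; apply: IH.
Qed.

Section Law.
Variable H : hypergraph.
Implicit Types X Y : {set 'I_(nverts H)}.

Lemma transition_ge0 X Y : 0 <= transition X Y.
Proof.
rewrite /transition; case: ifP => _; first by [].
rewrite mulr_ge0 ?invr_ge0 ?ler0n // sumr_ge0 // => v _.
by rewrite update_toggle divr_ge0 ?addr_ge0 ?ler0n.
Qed.

Lemma sum_pred1 Y : \sum_X (X == Y)%:R = 1 :> rat.
Proof.
rewrite (bigD1 Y) //= eqxx big1 ?addr0 // => X /negPf ->; by [].
Qed.

Lemma transition_sum X : \sum_Y transition X Y = 1.
Proof.
rewrite /transition; case: eqP => [_|/eqP n0]; first exact: sum_pred1.
rewrite -mulr_sumr exchange_big /= (eq_bigr (fun=> 1)) => [|v _].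
  by rewrite sumr_const card_ord mulVf // pnatr_eq0.
under eq_bigr => Y _ do rewrite update_toggle.
by rewrite -mulr_suml big_split /= !sum_pred1 divff.
Qed.

Lemma law_ge0 t X : 0 <= law H t X.
Proof.
elim: t X => [|t IH] X /=; first by [].
by apply: sumr_ge0 => Y _; rewrite mulr_ge0 ?transition_ge0.
Qed.

Lemma law_sum t : \sum_X law H t X = 1.
Proof.
elim: t => [|t IH] /=; first exact: sum_pred1.
rewrite exchange_big /= -[RHS]IH; apply: eq_bigr => X _.
by rewrite -mulr_sumr transition_sum mulr1.
Qed.

Lemma expect_simulate t f : expect (simulate H t) f = \sum_X law H t X * f X.
Proof.
rewrite /expect /simulate big_map big_filter /= big_mkcond big_enum /=.
by apply: eq_bigr => X _; case: eqP => //= ->; rewrite mul0r.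
Qed.

Lemma nonneg_simulate t : nonneg (simulate H t).
Proof.
by rewrite /nonneg all_map; apply/allP => X _ /=; apply: law_ge0.
Qed.

(** Twice the distance is a wasteful bound, but needs no positive and negative
parts. *)
Lemma law_event_le t (E : pred {set 'I_(nverts H)}) (e : rat) :
  tv_dist (law H t) (unif_indep H) <= e ->
  `|\sum_X law H t X * (E X)%:R - \sum_X unif_indep H X * (E X)%:R| <= 2 * e.
Proof.
move=> te; apply: (@le_trans _ _ (2 * tv_dist (law H t) (unif_indep H))); last first.
  by rewrite ler_wpM2l.
rewrite /tv_dist mulrA divff // mul1r -sumrB.
apply: le_trans (ler_norm_sum _ _ _) _; apply: ler_sum => X _.
rewrite -mulrBl normrM; case: (E X); rewrite ?normr1 ?mulr1 //.
by rewrite normr0 mulr0.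
Qed.

End Law.

Section Moments.
Variables (n t w : nat).
Implicit Types (rest cl : seq {set 'I_n}) (c : {set 'I_n}).

(** Probability that a sample of the simulated chain does not contain [c]. *)
Definition hit_prob rest c : rat :=
  \sum_X law (hyp rest) t X * (~~ (c \subset X))%:R.

Lemma expect_hit rest c h f :
  expect (hit_dist t rest c h) f =
    (1 - hit_prob rest c) * f h + hit_prob rest c * f h.+1.
Proof.
rewrite /hit_dist expect_bind expect_simulate.
under eq_bigr => X _.
  rewrite expect_ret (_ : f _ = f h + (~~ (c \subset X))%:R * (f h.+1 - f h)).
    rewrite mulrDr mulrA; over.
  by case: (_ \subset _) => /=; rewrite ?addn0 ?addn1; ring.
rewrite big_split /= -(mulr_suml _ _ _ (f h)) -mulr_suml.
by rewrite (law_sum (hyp rest)) -/(hit_prob rest c); ring.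
Qed.

Lemma expect_hits_chain rest c i N h :
  let d := chain (fun=> hit_dist t rest c) i N h in
  let q := hit_prob rest c in
  [/\ expect d (fun=> 1) = 1,
      expect d (fun a => a%:R) = h%:R + N%:R * q &
      expect d (fun a => a%:R ^+ 2) =
        h%:R ^+ 2 + 2 * h%:R * N%:R * q + N%:R * q + N%:R * (N%:R - 1) * q ^+ 2].
Proof.
move=> d q; rewrite {}/d; elim: N i h => [|N IH] i h /=.
  by rewrite !expect_ret; split=> //; ring.
split.
- rewrite expect_bind (@eq_expect _ _ _ (fun=> 1)) => [|a]; last by case: (IH i.+1 a).
  by rewrite expect_hit; ring.
- rewrite expect_bind (@eq_expect _ _ _ (fun a => a%:R + N%:R * q)) => [|a];
    last by case: (IH i.+1 a).
  by rewrite expect_hit -/q -natr1 -[N.+1%:R]natr1; ring.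
- rewrite expect_bind (@eq_expect _ _ _ (fun a => a%:R ^+ 2 + 2 * a%:R * N%:R * q
     + N%:R * q + N%:R * (N%:R - 1) * q ^+ 2)) => [|a]; last by case: (IH i.+1 a).
  by rewrite expect_hit -/q -[h.+1%:R]natr1 -[N.+1%:R]natr1; ring.
Qed.

(** First and second moments of the estimate divided by the power of [w], for
starting value [1]: both are products since the rounds are independent. *)
Fixpoint mean cl : rat :=
  if cl is c :: rest then hit_prob rest c * mean rest else 1.

Fixpoint second cl : rat :=
  if cl is c :: rest then
    let q := hit_prob rest c in
    (q / w%:R + (1 - w%:R^-1) * q ^+ 2) * second rest
  else 1.

Lemma expect_estimate cl num : (0 < w)%N ->
  let d := estimate t w cl num in
  let W := (w ^ size cl)%:R in
  [/\ expect d (fun=> 1) = 1,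
      expect d (fun z => z%:R / W) = num%:R * mean cl &
      expect d (fun z => (z%:R / W) ^+ 2) = num%:R ^+ 2 * second cl].
Proof.
move=> w0 /=; have nz : w%:R != 0 :> rat by rewrite pnatr_eq0 -lt0n.
elim: cl num => [|c rest IH] num /=.
  by rewrite !expect_ret expn0 divr1 !mulr1.
have [h0 h1 h2] := expect_hits_chain rest c 0 w 0.
have Wz : (w ^ size rest)%:R != 0 :> rat by rewrite natrX expf_neq0.
split.
- rewrite expect_bind (@eq_expect _ _ _ (fun=> 1)) // => a.
  by case: (IH (num * a)%N).
- rewrite expect_bind (@eq_expect _ _ _ (fun a => num%:R * mean rest / w%:R * a%:R))
    => [|a].
    by rewrite expectZ h1; field.
  have [_ E _] := IH (num * a)%N.
  rewrite (@eq_expect _ _ _ (fun z => w%:R^-1 * (z%:R / (w ^ size rest)%:R))) => [|z].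
    by rewrite expectZ E natrM; ring.
  by rewrite expnS natrM; field; rewrite nz Wz.
- rewrite expect_bind (@eq_expect _ _ _ (fun a =>
      num%:R ^+ 2 * second rest / w%:R ^+ 2 * a%:R ^+ 2)) => [|a].
    by rewrite expectZ h2; field.
  have [_ _ E] := IH (num * a)%N.
  rewrite (@eq_expect _ _ _ (fun z => (w%:R ^+ 2)^-1 * (z%:R / (w ^ size rest)%:R) ^+ 2))
    => [|z].
    by rewrite expectZ E natrM; ring.
  by rewrite expnS natrM; field; rewrite nz Wz.
Qed.

Lemma nonneg_estimate cl num : nonneg (estimate t w cl num).
Proof.
elim: cl num => [//|c rest IH] num; apply: nonneg_bind => [|h]; last exact: IH.
apply: nonneg_chain => j b; apply: nonneg_bind => [|X]; last by [].
exact: nonneg_simulate.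
Qed.

End Moments.

(** * Counting independent sets *)
Section Counting.
Variable n : nat.
Implicit Types (rest cl : seq {set 'I_n}) (c X : {set 'I_n}).

Definition nind cl : nat := #|[set X : {set 'I_n} | all (fun c => ~~ (c \subset X)) cl]|.

Lemma independent_hyp cl X : independent (hyp cl) X = all (fun c => ~~ (c \subset X)) cl.
Proof.
apply/independentP/allP => h c; last by rewrite inE; apply: h.
by move=> ccl; apply: h; rewrite inE.
Qed.

Lemma card_independent_hyp cl : #|[set X | independent (hyp cl) X]| = nind cl.
Proof. by apply: eq_card => X; rewrite !inE independent_hyp. Qed.

Lemma nind_nil : nind [::] = (2 ^ n)%N.
Proof.
rewrite /nind (_ : [set X | _] = powerset [set: 'I_n]).
  by rewrite card_powerset cardsT card_ord.
by apply/setP => X; rewrite !inE subsetT.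
Qed.

(** Removing a fixed vertex of [c] is injective on the sets that contain [c]. *)
Lemma nind_cons_ge c rest : (0 < #|c|)%N -> (nind rest <= 2 * nind (c :: rest))%N.
Proof.
case/card_gt0P => v vc; pose A := [set X : {set 'I_n} | all (fun c => ~~ (c \subset X)) rest].
rewrite -[nind rest]/#|A| -(cardsID [set X : {set 'I_n} | c \subset X] A) mul2n -addnn leq_add //.
  rewrite -(card_in_imset (f := fun X : {set 'I_n} => X :\ v)); last first.
    move=> X Y; rewrite !inE => /andP[_ cX] /andP[_ cY] E.
    by rewrite -(setD1K (subsetP cX v vc)) E setD1K // (subsetP cY).
  apply/subset_leq_card/subsetP => _ /imsetP[X + ->]; rewrite !inE => /andP[iX cX].
  apply/andP; split; first by apply/subsetPn; exists v; rewrite ?inE ?eqxx.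
  apply/allP => e /(allP iX); apply: contra => /subset_trans; apply.
  exact: subD1set.
by apply/subset_leq_card/subsetP => X; rewrite !inE /= => /andP[-> ->].
Qed.

Lemma nind_gt0 cl : (forall c, c \in cl -> 0 < #|c|)%N -> (0 < nind cl)%N.
Proof.
move=> cl0; apply/card_gt0P; exists set0; rewrite inE; apply/allP => c /cl0 c0.
by rewrite subset0 -cards_eq0 -lt0n.
Qed.

(** Under exact uniform sampling the hit probability is the ratio to be estimated. *)
Lemma unif_hit c rest : (0 < nind rest)%N ->
  \sum_X unif_indep (hyp rest) X * (~~ (c \subset X))%:R
    = (nind (c :: rest))%:R / (nind rest)%:R :> rat.
Proof.
move=> N0; rewrite /unif_indep card_independent_hyp.
rewrite (eq_bigr (fun X : {set 'I_n} => (nind rest)%:R^-1 * ((all (fun c => ~~ (c \subset X)) (c :: rest))%:R : rat)));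
  last first.
  move=> X _; rewrite independent_hyp /=.
  by case: (all _ _); case: (_ \subset _); rewrite /= ?mulr0 ?mul0r ?mulr1 // mul1r.
rewrite -mulr_sumr mulrC; congr (_ / _).
rewrite /nind -sum1_card natr_sum [RHS]big_mkcond /=; apply: eq_bigr => X _.
by rewrite inE /=; case: ifP.
Qed.

End Counting.

(** An assignment satisfies the formula when its set of false variables is
independent. *)
Lemma num_sat_nind (f : formula) : num_sat f = nind (clauses f).
Proof.
pose F (a : {ffun 'I_(nvars f) -> bool}) : {set 'I_(nvars f)} := [set x | ~~ a x].
pose G (X : {set 'I_(nvars f)}) : {ffun 'I_(nvars f) -> bool} := [ffun x => x \notin X].
have FG : cancel G F by move=> X; apply/setP => x; rewrite inE ffunE negbK.
have GF : cancel F G by move=> a; apply/ffunP => x; rewrite ffunE inE negbK.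
rewrite /num_sat /nind -(card_imset _ (can_inj GF)); apply: eq_card => X.
rewrite -[X]FG (mem_imset _ _ (can_inj GF)) !inE; apply: eq_all => c.
apply/exists_inP/subsetPn => [[x xc ax]|[x xc ax]]; exists x => //.
  by rewrite inE negbK.
by move: ax; rewrite inE negbK.
Qed.


(** * Accuracy of the estimate *)
Section Accuracy.
Variables (n t w m : nat).
Implicit Types (rest cl : seq {set 'I_n}) (c X : {set 'I_n}).
Hypothesis w_gt0 : (0 < w)%N.

Definition close cl : Prop := forall c rest, suffix (c :: rest) cl ->
  (0 < #|c|)%N /\
  tv_dist (law (hyp rest) t) (unif_indep (hyp rest)) <= w%:R^-1.

Lemma close_nind_gt0 cl : close cl -> (0 < nind cl)%N.
Proof.
move=> cc; apply: nind_gt0 => c ccl; case/splitPr: ccl cc => p1 p2 cc.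
by case: (cc c p2) => //; apply: suffix_suffix.
Qed.

Lemma close_cons c rest : close (c :: rest) -> close rest.
Proof.
move=> cc d s sf; apply: cc; apply: suffix_trans sf _.
exact: (suffix_suffix [:: c] rest).
Qed.

(** The ratio is at least one half, so the absolute error [2 / w] of the hit
probability is a relative error of at most [4 / w]. *)
Lemma hit_prob_close c rest : close (c :: rest) ->
  let r := (nind (c :: rest))%:R / (nind rest)%:R in
  [/\ 2^-1 <= r, r * (1 - 4 / w%:R) <= hit_prob t rest c
    & hit_prob t rest c <= r * (1 + 4 / w%:R)].
Proof.
move=> cc r; have [c0 tv] := cc _ _ (suffix_refl _).
have N0 := close_nind_gt0 (close_cons cc).
have N0' : 0 < (nind rest)%:R :> rat by rewrite ltr0n.
have r2 : 2^-1 <= r.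
  rewrite ler_pdivlMr // ler_pdivrMl // -(natrM _ 2) ler_nat.
  exact: nind_cons_ge.
have := @law_event_le (hyp rest) t (fun X : {set 'I_n} => ~~ (c \subset X)) _ tv.
rewrite (unif_hit c N0) -/(hit_prob t rest c) -/r ler_norml => /andP[lo hi].
have u0 : 0 <= w%:R^-1 :> rat by rewrite invr_ge0.
have ru : 2 * w%:R^-1 <= 4 * w%:R^-1 * r.
  have := ler_wpM2l u0 r2; lra.
by split=> //; move: lo hi ru; move: (w%:R^-1) (hit_prob _ _ _) => u q; lra.
Qed.

Lemma mean_lower cl : close cl -> (8 * size cl <= w)%N ->
  (nind cl)%:R * (1 - (size cl)%:R * (4 / w%:R)) <= 2 ^+ n * mean t cl.
Proof.
have w0 : 0 < w%:R :> rat by rewrite ltr0n.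
elim: cl => [|c rest IH] cc sw.
  by rewrite nind_nil natrX mul0r subr0.
have ccr := close_cons cc.
have {}IH : (nind rest)%:R * (1 - (size rest)%:R * (4 / w%:R)) <= 2 ^+ n * mean t rest.
  by apply: IH => //; apply: leq_trans sw; rewrite leq_mul2l leqnSn.
have [r2 lo _] := hit_prob_close cc.
have N0 : 0 < (nind rest)%:R :> rat by rewrite ltr0n close_nind_gt0.
have EN : (nind (c :: rest))%:R = (nind (c :: rest))%:R / (nind rest)%:R * (nind rest)%:R :> rat.
  by rewrite divfK // gt_eqF.
rewrite EN [mean t _]/= [2 ^+ n * _]mulrCA (_ : (size (c :: rest))%:R = (size rest)%:R + 1 :> rat);
  last by rewrite natr1.
move: r2 lo IH; set r := _ / (nind rest)%:R; set R := (nind rest)%:R in N0 *.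
set q := hit_prob t rest c; set k := (size rest)%:R; set u := 4 / w%:R => r2 lo IH.
have k0 : 0 <= k by rewrite ler0n.
have u0 : 0 <= u by rewrite divr_ge0 ?ler0n.
have ku : (k + 1) * u <= 2^-1.
  rewrite /u mulrA ler_pdivrMr // ler_pdivlMl // /k natr1.
  by rewrite -!natrM ler_nat; apply: leq_trans sw; rewrite mulnCA mulnC.
have r0 : 0 <= r by apply: le_trans r2.
have ku0 : 0 <= k * u by rewrite mulr_ge0.
apply: (@le_trans _ _ (r * (1 - u) * (R * (1 - k * u)))).
  rewrite -subr_ge0 (_ : _ - _ = r * R * (k * u * u)); last by ring.
  exact: mulr_ge0 (mulr_ge0 r0 (ltW N0)) (mulr_ge0 ku0 u0).
apply: ler_pM lo IH; apply: mulr_ge0 => //; first lra.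
lra.
Qed.

Lemma hit_prob_ge0 rest c : 0 <= hit_prob t rest c.
Proof. by apply: sumr_ge0 => X _; rewrite mulr_ge0 ?law_ge0. Qed.

Lemma winv_le1 : w%:R^-1 <= 1 :> rat.
Proof. by rewrite invf_le1 ?ltr0n // ler1n. Qed.

Lemma second_factor_ge0 (q : rat) : 0 <= q ->
  0 <= q / w%:R + (1 - w%:R^-1) * q ^+ 2.
Proof.
move=> q0; rewrite addr_ge0 ?divr_ge0 ?ler0n // mulr_ge0 ?sqr_ge0 // subr_ge0.
exact: winv_le1.
Qed.

Lemma second_ge0 cl : 0 <= second t w cl.
Proof.
elim: cl => [//|c rest IH] /=; rewrite mulr_ge0 // second_factor_ge0 //.
exact: hit_prob_ge0.
Qed.

(** Each clause contributes the relative bias squared, at most [(1 + 4 / w) ^ 2], and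
the relative variance of [w] trials, at most [2 * (1 + 4 / w) / w]; together they
are below [1 + 16 / w], and a product of few such factors is nearly linear. *)
Lemma second_upper cl : close cl -> (32 * size cl <= w)%N ->
  (2 ^+ n) ^+ 2 * second t w cl
    <= (nind cl)%:R ^+ 2 * (1 + 2 * (size cl)%:R * (16 / w%:R)).
Proof.
have w0 : 0 < w%:R :> rat by rewrite ltr0n.
elim: cl => [|c rest IH] cc sw.
  by rewrite nind_nil natrX mulr0 mul0r addr0.
have ccr := close_cons cc.
have {}IH : (2 ^+ n) ^+ 2 * second t w rest
    <= (nind rest)%:R ^+ 2 * (1 + 2 * (size rest)%:R * (16 / w%:R)).
  by apply: IH => //; apply: leq_trans sw; rewrite leq_mul2l leqnSn.
have [r2 _ hi] := hit_prob_close cc.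
have N0 : 0 < (nind rest)%:R :> rat by rewrite ltr0n close_nind_gt0.
have EN : (nind (c :: rest))%:R = (nind (c :: rest))%:R / (nind rest)%:R * (nind rest)%:R :> rat.
  by rewrite divfK // gt_eqF.
rewrite EN [second t w _]/= [2 ^+ n ^+ 2 * _]mulrCA (_ : (size (c :: rest))%:R = (size rest)%:R + 1 :> rat);
  last by rewrite natr1.
have q0 := hit_prob_ge0 rest c; have s0 := second_ge0 rest.
have f0 := second_factor_ge0 q0.
have u1 := winv_le1; have u0 : 0 <= w%:R^-1 :> rat by rewrite invr_ge0.
move: r2 hi IH q0 f0; set r := _ / (nind rest)%:R; set R := (nind rest)%:R in N0 *.
set q := hit_prob t rest c; set k := (size rest)%:R => r2 hi IH q0 f0.
have k0 : 0 <= k by rewrite ler0n.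
have ku : 32 * ((k + 1) * w%:R^-1) <= 1.
  rewrite mulrA (ler_pdivrMr _ _ w0) mul1r /k natr1.
  by rewrite -natrM ler_nat.
set u := w%:R^-1 in u0 u1 ku hi f0 IH *.
clearbody r R q k u.
have r0 : 0 <= r by apply: le_trans r2.
have ku0 : 0 <= k * u by rewrite mulr_ge0.
have u4 : 32 * u <= 1 by lra.
have fac : q * u + (1 - u) * q ^+ 2 <= r ^+ 2 * (1 + 16 * u).
  have q2 : q ^+ 2 <= (r * (1 + 4 * u)) ^+ 2 by apply: lerXn2r; rewrite ?nnegrE ?(le_trans q0 hi).
  have h1 : u * q ^+ 2 >= 0 by rewrite mulr_ge0 ?sqr_ge0.
  have h2 : q * u <= r * (1 + 4 * u) * u by rewrite ler_wpM2r.
  have a1 : 0 <= 1 + 4 * u by lra.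
  have a2 : 0 <= 2 * r - 1 by lra.
  have a3 : 0 <= 1 - 4 * u by lra.
  have h3 := mulr_ge0 (mulr_ge0 a1 u0) (mulr_ge0 r0 a2).
  have h4 := mulr_ge0 (sqr_ge0 r) (mulr_ge0 u0 a3).
  rewrite exprMn in q2; move: h1 h2 h3 h4 q2; rewrite !expr2; lra.
apply: (@le_trans _ _ (r ^+ 2 * (1 + 16 * u) * (R ^+ 2 * (1 + 2 * k * (16 * u))))).
  exact: ler_pM f0 (mulr_ge0 (sqr_ge0 _) s0) fac IH.
have a4 : 0 <= 1 - 32 * (k * u) by lra.
have h5 := mulr_ge0 (mulr_ge0 (sqr_ge0 r) (sqr_ge0 R)) (mulr_ge0 u0 a4).
rewrite exprMn; move: h5; move: (r ^+ 2) (R ^+ 2) => x y; lra.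
Qed.

(** Chebyshev's inequality around the true count rather than around the mean, which
treats bias and variance at once. *)
Lemma estimate_accurate cl E : close cl -> (0 < E)%N ->
  (160 * size cl * (E * E) <= w)%N ->
  3 / 4 <= prob (estimate t w cl (2 ^ n))
    (fun z => `|z%:R / (w ^ size cl)%:R - (nind cl)%:R| <= (nind cl)%:R / E%:R :> rat).
Proof.
move=> cc E0 hw; set d := estimate _ _ _ _; set N : rat := (nind cl)%:R.
have N0 : 0 < N by rewrite ltr0n close_nind_gt0.
have E0' : 0 < E%:R :> rat by rewrite ltr0n.
have EE : (1 <= E * E)%N by rewrite muln_gt0 E0.
have hw1 : (160 * size cl <= w)%N by apply: leq_trans hw; rewrite leq_pmulr.
have m1 : N * (1 - (size cl)%:R * (4 / w%:R)) <= 2 ^+ n * mean t cl.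
  by apply: mean_lower => //; apply: leq_trans hw1; rewrite leq_mul2r orbT.
have m2 : (2 ^+ n) ^+ 2 * second t w cl <= N ^+ 2 * (1 + 2 * (size cl)%:R * (16 / w%:R)).
  by apply: second_upper => //; apply: leq_trans hw1; rewrite leq_mul2r orbT.
have [e0 e1 e2] := expect_estimate t cl (2 ^ n) w_gt0; rewrite -/d in e0 e1 e2.
pose Z (z : nat) : rat := z%:R / (w ^ size cl)%:R.
pose a := (E%:R / N) ^+ 2.
rewrite prob_expect; apply: (@le_trans _ _ (expect d (fun z => 1 + (- a) * (Z z - N) ^+ 2))).
  have -> : expect d (fun z => 1 + (- a) * (Z z - N) ^+ 2) =
      1 - a * (2 ^+ n ^+ 2 * second t w cl - 2 * N * (2 ^+ n * mean t cl) + N ^+ 2).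
    rewrite expectD expectZ e0 mulNr; congr (_ - _ * _).
    rewrite (@eq_expect _ _ _ (fun z => Z z ^+ 2 + ((- 2 * N) * Z z + N ^+ 2 * 1))) => [|z].
      by rewrite !expectD !expectZ e0 e1 e2 natrX; ring.
    by ring.
  have -> : 3 / 4 = 1 - a * (N ^+ 2 / (4 * E%:R ^+ 2)).
    by rewrite /a; field; rewrite !gt_eqF.
  rewrite lerD2l lerN2 ler_wpM2l ?sqr_ge0 //.
  have w0 : 0 < w%:R :> rat by rewrite ltr0n.
  have key : (size cl)%:R * w%:R^-1 <= 160^-1 * (E%:R ^+ 2)^-1 :> rat.
    have E2 : 0 < E%:R ^+ 2 :> rat by rewrite exprn_gt0.
    have H : 160 * (size cl)%:R * E%:R ^+ 2 <= w%:R :> rat.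
      by rewrite -natrX -!natrM ler_nat -mulnn.
    have e2_ge0 : 0 <= (E%:R ^+ 2)^-1 :> rat by rewrite invr_ge0 ltW.
    rewrite (ler_pdivrMr _ _ w0).
    have := ler_wpM2r e2_ge0 H; rewrite (mulfK (lt0r_neq0 E2)).
    move: ((size cl)%:R : rat) ((E%:R ^+ 2)^-1) (w%:R : rat) => x y z; lra.
  have N2 : 0 < N ^+ 2 by rewrite exprn_gt0.
  have n1 := ler_wpM2l (ltW N0) m1; have n2 := ler_wpM2l (ltW N2) key.
  have -> : N ^+ 2 / (4 * E%:R ^+ 2) = N ^+ 2 * (4^-1 * (E%:R ^+ 2)^-1).
    by rewrite (invfM 4).
  move: m2 n1 n2; move: (w%:R^-1 : rat) ((E%:R ^+ 2)^-1) (size cl)%:R => u v k.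
  move: (2 ^+ n ^+ 2 * _) (2 ^+ n * _) => x y; rewrite !expr2; lra.
apply: expect_le; first exact: nonneg_estimate.
move=> z; rewrite -/(Z z); have [le|lt] := lerP `|Z z - N| (N / E%:R).
  apply: (@le_trans _ _ 1); last by [].
  by rewrite gerDl mulNr oppr_le0 mulr_ge0 ?sqr_ge0.
rewrite [_%:R](_ : _ = 0) //.
suff : 1 <= a * (Z z - N) ^+ 2 by rewrite mulNr; lra.
rewrite -exprMn -real_normK ?num_real // normrM ger0_norm; last by rewrite divr_ge0 ?ltW.
rewrite exprn_ege1 // mulrC mulrA ler_pdivlMr // mul1r.
by move: lt; rewrite ltr_pdivrMr // => /ltW.
Qed.

End Accuracy.

Local Close Scope ring_scope.

(** * Running time and conclusion *)
Lemma expn_le_exp2 a b : a ^ b <= 2 ^ (a * b).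
Proof.
rewrite expnM; case: b => [|b]; first by rewrite !expn0.
by rewrite leq_exp2r // ltnW // ltn_expl.
Qed.

(** Bounds by powers of a common base compose under sums and products, which is all
that is needed to see that the running time is polynomial. *)
Section PowerBounds.
Variable A : nat.
Hypothesis A_ge2 : 2 <= A.

Lemma powM x y i j : x <= A ^ i -> y <= A ^ j -> x * y <= A ^ (i + j).
Proof. by move=> xi yj; rewrite expnD leq_mul. Qed.

Lemma powD x y i j : x <= A ^ i -> y <= A ^ j -> x + y <= A ^ (maxn i j).+1.
Proof.
move=> xi yj; apply: (@leq_trans (2 * A ^ maxn i j)); last by rewrite expnS leq_mul2r A_ge2 orbT.
have mono u v : u <= v -> A ^ u <= A ^ v by rewrite leq_exp2l.
rewrite mul2n -addnn leq_add //.
  by apply: leq_trans xi (mono _ _ (leq_maxl i j)).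
by apply: leq_trans yj (mono _ _ (leq_maxr i j)).
Qed.

End PowerBounds.

Section Instance.
Variables (m D k : nat).

Lemma uniform_bounded_suffix n (cl rest : seq {set 'I_n}) :
  all (fun c : {set 'I_n} => #|c| == m) cl ->
  (forall x, count (fun c : {set 'I_n} => x \in c) cl <= D) ->
  suffix rest cl -> uniform_bounded m D (hyp rest).
Proof.
move=> um dg /suffixP[s E]; rewrite {}E in um dg.
move: um; rewrite all_cat => /andP[_ um]; apply/andP; split.
  by apply/forall_inP => e; rewrite inE => /(allP um).
apply/forallP => x; have := dg x; rewrite count_cat => /(leq_trans (leq_addl _ _)).
apply: leq_trans; rewrite -size_filter; apply: leq_trans (card_size _).
by apply/subset_leq_card/subsetP => e; rewrite !inE mem_filter andbC.
Qed.

(** Double counting of the occurrences of variables. *)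
Lemma clauses_le n (cl : seq {set 'I_n}) :
  all (fun c : {set 'I_n} => #|c| == m) cl ->
  (forall x, count (fun c : {set 'I_n} => x \in c) cl <= D) ->
  m * size cl <= D * n.
Proof.
move=> um dg; apply: (@leq_trans (\sum_(x < n) D)); last first.
  by rewrite sum_nat_const card_ord mulnC.
apply: (@leq_trans (\sum_(x < n) count (fun c : {set 'I_n} => x \in c) cl)); last first.
  by apply: leq_sum.
elim: cl um {dg} => [|c cl IH] /=; first by rewrite muln0.
case/andP=> /eqP cm /IH le; rewrite big_split /= mulnS leq_add //.
by rewrite -cm -sum1_card [leqLHS]big_mkcond /=.
Qed.

Definition step_cost := (vsize (Leaf m) + vsize (Leaf D) + vsize (Leaf k)
  + vsize (Leaf 2) + vsize (Leaf 128) + 100) ^ 2.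

(** Bound on the number of bits of the numerator and of the denominator. *)
Definition bits n r E := n + trials_of D n E * r + 1.

Definition size_bound n r E v :=
  v + trials_of D n E + steps_of D k n E + m.+1 * n + n + 2 * bits n r E + 3.

Lemma size_bound_gt n r E v (B := size_bound n r E v) :
  [&& v <= B, (trials_of D n E).+1 < B, steps_of D k n E < B, m.+1 * n < B,
      n < B & 2 * bits n r E + 1 <= B].
Proof.
rewrite {}/B /size_bound; move: (trials_of _ _ _) (steps_of _ _ _ _) (bits _ _ _).
by move: (_ * n) => a b c d; lia.
Qed.

Definition run_time n r E v :=
  time_of m D k n E r * (step_cost * size_bound n r E v).

(** The exponent is whatever the mechanical composition of bounds produces. *)
Lemma run_time_poly : exists2 K, 0 < K & forall n r E v,
  n <= v -> r <= v -> 0 < E -> run_time n r E (v + E.+1) <= K * (v + E) ^ 40.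
Proof.
pose K0 := m + D + k + step_cost + 200.
exists (K0 ^ 40); first by rewrite expn_gt0 /K0 addnS.
move=> n r E v nv rv E0; rewrite -expnMn; set A := K0 * (v + E).
have G1 : 1 <= v + E by rewrite addn_gt0 E0 orbT.
have KA x : x <= K0 -> x <= A ^ 1.
  by move=> xK; rewrite expn1 (leq_trans xK) // /A leq_pmulr.
have A200 : 200 <= A ^ 1 by apply: KA; rewrite /K0 leq_addl.
have A2 : 2 <= A by rewrite -[A]expn1; apply: leq_trans A200.
have K1 : 0 < K0 by rewrite /K0 addnS.
have vA x : x <= v + E -> x <= A ^ 1.
  by move=> xv; rewrite expn1 (leq_trans xv) // /A leq_pmull.
have cA x : x <= 200 -> x <= A ^ 1 by move=> x2; apply: leq_trans A200.
have A0 : 1 <= A ^ 0 by [].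
have M x y i j := @powM A x y i j; have P x y i j := @powD A A2 x y i j.
have hm : m <= A ^ 1 by apply: KA; rewrite /K0; lia.
have hD : D <= A ^ 1 by apply: KA; rewrite /K0; lia.
have hk : k <= A ^ 1 by apply: KA; rewrite /K0; lia.
have hC : step_cost <= A ^ 1 by apply: KA; rewrite /K0; lia.
have hn : n <= A ^ 1 by apply: vA; rewrite (leq_trans nv) ?leq_addr.
have hr : r <= A ^ 1 by apply: vA; rewrite (leq_trans rv) ?leq_addr.
have hE : E <= A ^ 1 by apply: vA; rewrite leq_addl.
have hv : v + E <= A ^ 1 by apply: vA.
have hw : trials_of D n E <= A ^ _ :=
  M _ _ _ _ (M _ _ _ _ (cA 128 isT) (P _ _ _ _ (M _ _ _ _ hD hn) A0)) (M _ _ _ _ hE hE).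
have ht : steps_of D k n E <= A ^ _ :=
  M _ _ _ _ (M _ _ _ _ hk hn) (P _ _ _ _ hn (M _ _ _ _ (cA 2 isT) hw)).
have hs : trial_steps m n (steps_of D k n E) <= A ^ _ :=
  P _ _ _ _ (P _ _ _ _ ht (M _ _ _ _ hm (P _ _ _ _ (M _ _ _ _ (cA 3 isT) hn) (cA 4 isT))))
    (cA 9 isT).
have hs1 := P _ _ _ _ hs A0; rewrite addn1 in hs1.
have hT : time_of m D k n E r <= A ^ _ :=
  P _ _ _ _ (P _ _ _ _ (P _ _ _ _ (M _ _ _ _ (cA 4 isT) hn) ht)
    (M _ _ _ _ hr (P _ _ _ _ (M _ _ _ _ hw hs1) (cA 9 isT)))) (cA 20 isT).
have hb : bits n r E <= A ^ _ := P _ _ _ _ (P _ _ _ _ hn (M _ _ _ _ hw hr)) A0.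
have hv1 := P _ _ _ _ hv A0; rewrite addn1 -addnS in hv1.
have hm1 := P _ _ _ _ hm A0; rewrite addn1 in hm1.
have hB : size_bound n r E (v + E.+1) <= A ^ _ :=
  P _ _ _ _ (P _ _ _ _ (P _ _ _ _ (P _ _ _ _ (P _ _ _ _ (P _ _ _ _ hv1 hw) ht)
    (M _ _ _ _ hm1 hn)) hn) (M _ _ _ _ (cA 2 isT) hb)) (cA 3 isT).
have hR : run_time n r E (v + E.+1) <= A ^ _ := M _ _ _ _ hT (M _ _ _ _ hC hB).
apply: leq_trans hR _; rewrite leq_exp2l //.
Qed.

Local Open Scope ring_scope.

Section Formula.
Hypothesis m_ge2 : (2 <= m)%N.
Hypothesis mixing : forall (H : hypergraph) (W : nat),
  uniform_bounded m D H -> (0 < W)%N ->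
  tv_dist (law H (k * nverts H * (nverts H + 2 * W))) (unif_indep H)
    <= W%:R^-1.
Variables (f : formula) (eps : rat).
Hypothesis fmD : monotone_sat m D f.
Hypothesis eps_gt0 : 0 < eps.

Local Notation n := (nvars f).
Local Notation cl := (clauses f).
Local Notation r := (size (clauses f)).
Definition precision : nat := `|Num.ceil eps^-1|%N.
Local Notation E := precision.
Local Notation w := (trials_of D n E).
Local Notation t := (steps_of D k n E).

Lemma precision_ge : eps^-1 <= E%:R.
Proof.
have : 0 <= Num.ceil eps^-1 by rewrite ceil_ge0 (lt_trans _ (_ : 0 < eps^-1)) ?invr_gt0.
rewrite /precision => c0; apply: le_trans (ceil_ge _) _.
by rewrite -[X in X%:~R](gez0_abs c0) pmulrn.
Qed.

Lemma precision_gt0 : (0 < E)%N.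
Proof. by rewrite -(ltr0n rat); apply: lt_le_trans precision_ge; rewrite invr_gt0. Qed.

Lemma precision_lt : E%:R < eps^-1 + 1.
Proof.
have c0 : 0 <= Num.ceil eps^-1 by rewrite ceil_ge0 (lt_trans _ (_ : 0 < eps^-1)) ?invr_gt0.
rewrite /precision pmulrn gez0_abs // -ltrBlDr.
by have := ceilB1_lt eps^-1; rewrite intrB.
Qed.

Lemma clause_card : all (fun c : {set 'I_n} => #|c| == m) cl.
Proof. by case/andP: fmD. Qed.

Lemma var_degree x : (count (fun c : {set 'I_n} => x \in c) cl <= D)%N.
Proof. by case/andP: fmD => _ /forallP. Qed.

Lemma trials_gt0 : (0 < w)%N.
Proof. by rewrite /trials_of !muln_gt0 precision_gt0 addn1. Qed.

Lemma trials_ge_precision : (E <= w)%N.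
Proof.
rewrite /trials_of mulnA; apply: leq_pmull.
by rewrite !muln_gt0 precision_gt0 addn1.
Qed.

Lemma suffix_uniform rest : suffix rest cl -> uniform_bounded m D (hyp rest).
Proof. exact: uniform_bounded_suffix clause_card var_degree. Qed.

Lemma suffix_mixed rest : suffix rest cl ->
  tv_dist (law (hyp rest) t) (unif_indep (hyp rest)) <= w%:R^-1.
Proof. by move=> sf; apply: mixing; rewrite ?suffix_uniform ?trials_gt0. Qed.

Definition good (h : hypergraph * nat) : bool :=
  uniform_bounded m D h.1 && (tv_dist (law h.1 h.2) (unif_indep h.1) <= eps).

Lemma good_suffix rest : suffix rest cl -> good (hyp rest, t).
Proof.
move=> sf; rewrite /good suffix_uniform //=.
apply: le_trans (suffix_mixed sf) _; rewrite -[eps]invrK lef_pV2 ?posrE.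
- by apply: le_trans precision_ge _; rewrite ler_nat trials_ge_precision.
- by rewrite ltr0n trials_gt0.
- by rewrite invr_gt0.
Qed.

Lemma clauses_close : close t w cl.
Proof.
move=> c rest sf; split.
  have /suffixP[s Ecl] := sf; have := clause_card; rewrite Ecl all_cat /=.
  by case/and3P=> _ /eqP-> _; apply: ltnW.
apply: suffix_mixed; apply: suffix_trans sf; exact: (suffix_suffix [:: c] rest).
Qed.

Lemma trials_enough : (160 * r * (E * E) <= w)%N.
Proof.
rewrite /trials_of leq_mul2r; apply/orP; right.
have le := clauses_le clause_card var_degree.
have : (2 * r <= D * n)%N by apply: leq_trans le; rewrite leq_mul2r m_ge2 orbT.
lia.
Qed.

Local Notation start := (init f eps).
Local Notation P := (estimator m D k).
Local Notation B := (size_bound n r E (vsize (vformula f) + E.+1)).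

Let mu := bind (simulate (hyp cl) t) (fun=> estimate t w cl (2 ^ n)).

Definition final (z : nat) : config :=
  Config (regfile (Cell (Leaf z) (Leaf (w ^ r))) (Leaf 0) n w t z (w ^ r) 0 0
    (Leaf 0) (Leaf 0) (Leaf 0) 0 (Leaf 0))
    (run_time n r E (vsize (vformula f) + E.+1)) true.

Lemma estimator_runs : exists d K,
  (forall j, (K <= j)%N -> exec j P start = d)
  /\ matched B good (hyp cl) d mu final.
Proof.
have /and5P[vB wB tB mB /andP[nB bB]] := size_bound_gt n r E (vsize (vformula f) + E.+1).
have sB x : (x <= vsize (vformula f) + E.+1)%N -> (x <= B)%N.
  by move=> /leq_trans; apply.
have ioB : (vsize (Cell (vformula f) (Leaf E)) <= B)%N.
  apply: sB; rewrite -[vsize _]/((vsize (vformula f) + vsize (Leaf E)).+1) -addnS.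
  by rewrite leq_add2l ltnS vsize_leaf ?precision_gt0 // ltn_expl.
have B0 : (0 < B)%N by rewrite /size_bound addn3.
have vars_small : (vsize (nlist (iota 0 n)) <= B)%N.
  apply: sB; rewrite -[vformula f]/(Cell (nlist (iota 0 n)) (clist cl)) /=.
  by rewrite -addSn addSnnS -addnA leq_addr.
have w_small := expn_le_exp2 w r.
have R := @run_estimator m D k B good (hyp cl) B0 n vars_small (clist cl) E cl
  (bits n r E) false erefl erefl precision_gt0 ioB.
apply: R.
- by move=> c /(allP clause_card) /eqP.
- exact: good_suffix.
- exact: wB.
- exact: tB.
- exact: mB.
- exact: nB.
- rewrite /bits addn1 expnS expnD mul2n -addnn.
  have : (2 ^ n * w ^ r <= 2 ^ n * 2 ^ (w * r))%N by rewrite leq_mul2l w_small orbT.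
  move=> /leq_ltn_trans; apply; rewrite -[X in (X < _)%N]addn0 ltn_add2l.
  by rewrite muln_gt0 !expn_gt0.
- exact: bB.
- by rewrite /bits addn1.
split=> //=.
- by case=> [|[|[|[|[|[|[|[|[|[|[|[|[|[|j]]]]]]]]]]]]]] //=; rewrite nth_nil.
case=> [|[|[|[|[|[|[|[|[|[|[|[|[|[|j]]]]]]]]]]]]]] //=; try by rewrite B0.
by rewrite nth_nil.
Qed.

Lemma surely_good :
  forall j, surely (exec j P start) (fun o =>
    if o is Some s then
      all (fun h => uniform_bounded m D h.1
                    && (tv_dist (law h.1 h.2) (unif_indep h.1) <= eps)) (sims s)
      && (hypergraph_of f \in [seq h.1 | h <- sims s])
    else true).
Proof.
move=> j; have [d [K [Ed M]]] := estimator_runs.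
pose F s := all good (sims s) && (hyp cl \in [seq h.1 | h <- sims s]).
rewrite (@eq_surely _ _ _ (if_halted F)); last by case.
apply: (@exec_mono_le j (maxn K j)); first exact: leq_maxr.
rewrite Ed ?leq_maxl //; apply: matched_surely M _ => z s [_ _ gs fs _].
by rewrite /if_halted /F gs.
Qed.

Lemma estimate_correct :
  3 / 4 <= prob mu (fun z =>
    (1 - eps) * (num_sat f)%:R <= z%:R / (w ^ r)%:R <= (1 + eps) * (num_sat f)%:R).
Proof.
rewrite prob_expect /mu expect_bind expect_simulate -mulr_suml law_sum mul1r.
apply: le_trans (estimate_accurate trials_gt0 clauses_close precision_gt0 trials_enough) _.
rewrite prob_expect; apply: expect_le; first exact: nonneg_estimate.
move=> z; rewrite num_sat_nind; set N := (nind cl)%:R; set Z := _ / _.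
have N0 : 0 <= N by rewrite ler0n.
case: (lerP `|Z - N|) => [le|_]; last by rewrite ler0n.
suff -> : (1 - eps) * N <= Z <= (1 + eps) * N by [].
have : `|Z - N| <= eps * N.
  apply: le_trans le _; rewrite mulrC ler_wpM2r // -[eps]invrK lef_pV2 ?posrE.
  - exact: precision_ge.
  - by rewrite ltr0n precision_gt0.
  - by rewrite invr_gt0.
by rewrite ler_norml => /andP[lo hi]; apply/andP; split; lra.
Qed.

End Formula.

End Instance.

(** The integer precision exceeds [1 / eps] by less than one, and the formula has
positive size, so the integer input size is at most twice the real one. *)
Lemma time_poly (v K T : nat) (eps : rat) : (0 < v)%N -> (0 < eps)%R ->
  T <= K * (v + precision eps) ^ 40 ->
  (T%:R <= (K * 2 ^ 40 + 40)%:R * (v%:R + eps^-1) ^+ (K * 2 ^ 40 + 40))%R.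
Proof.
move=> v0 eps0 le; set x := (v%:R + eps^-1)%R.
have i0 : (0 < eps^-1)%R by rewrite invr_gt0.
have v1 : (1 <= v%:R :> rat)%R by rewrite ler1n.
have x1 : (1 <= x)%R by rewrite /x; lra.
have vx : ((v + precision eps)%:R <= 2 * x)%R.
  by have := precision_lt eps0; rewrite natrD /x; lra.
apply: (@le_trans _ _ (K * (v + precision eps) ^ 40)%:R%R); first by rewrite ler_nat.
move: (40) => p; rewrite natrM natrX.
apply: (@le_trans _ _ (K%:R * (2 * x) ^+ p)%R).
  by rewrite ler_wpM2l ?ler0n // lerXn2r ?nnegrE ?ler0n // (le_trans _ vx) ?ler0n.
rewrite exprMn mulrA -natrX -natrM; apply: ler_pM; rewrite ?ler0n //.
- by rewrite exprn_ge0 // (le_trans _ x1).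
- by rewrite ler_nat leq_addr.
- by rewrite ler_weXn2l // leq_addl.
Qed.

Theorem theorem4p1 (m D : nat)
  (hmD : (D + 2 <= m /\ 5 <= D + 2) \/ (D = 3 /\ 2 <= m)) :
  chain_yields_FPRAS m D.
Proof.
have m2 : 2 <= m.
  by case: hmD => [[Dm D5]|[]//]; rewrite (leq_trans _ Dm) // leq_addl.
have [k mixing] := rapid_mixing hmD.
exists (estimator m D k); split; last first.
  by move=> f eps fmD eps0; apply: surely_good.
have [K K0 poly] := run_time_poly m D k.
exists (K * 2 ^ 40 + 40) => f eps fmD eps0.
have [d [j [Ed M]]] := estimator_runs mixing fmD eps0.
exists j; rewrite /= Ed //; split.
  apply: matched_surely M _ => z s [_ ts _ _ _] /=.
  have nv : nvars f <= vsize (vformula f).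
    by rewrite -[leqLHS](size_iota 0) -(size_map Leaf) (leq_trans (size_le_vsize _)) //=
      ltnW // ltnS leq_addr.
  have rv : size (clauses f) <= vsize (vformula f).
    by rewrite -(size_map (@vset _)) (leq_trans (size_le_vsize _)) //=
      ltnW // ltnS leq_addl.
  have le := leq_trans ts (poly _ _ _ _ nv rv (precision_gt0 eps0)).
  exact: (time_poly (vsize_gt0 _) eps0 le).
apply: le_trans (estimate_correct m2 mixing fmD eps0) _.
rewrite le_eqVlt; apply/orP; left; apply/eqP; apply/esym.
apply: matched_prob M _ => z s [rs _ _ _ _].
by rewrite /accurate /output !rs.
Qed.
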